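(* Let $n\geq2$, $d\geq1$, let $\Omega\subset\mathbb{R}^n$ be open, and suppose $f\in W^{1,n}(\Omega;\mathbb{R}^d)$ is continuous. Let $0\leq\lambda\leq n-1$ and $\alpha=1-\frac{\lambda}{n-1}$. If $$\int_\Omega |Df|^n\log^\lambda(e+|Df|)\,dy<\infty,$$ then there exists a set $E\subset\Omega$ such that $f$ satisfies Luzin's condition (N) in $\Omega\setminus E$, and $\mathcal{H}^\varphi(E)=0$ for every gauge function $\varphi$ which for some $\gamma>0$ satisfies $$\varphi(r)=\begin{cases}\exp\bigl(-\gamma\log^{\alpha}(\tfrac1r)\bigr), & \alpha>0,\\ \log^{-n-\gamma}(\tfrac1r), & \alpha=0,\end{cases}\qquad 0<r<1.$$
   Context: A gauge function is a nondecreasing function $h:[0,\infty]\to[0,\infty]$, positive on $(0,\infty]$ and right-continuous. For a gauge function $h$ and $A\subset\mathbb{R}^n$, $\mathcal{H}^h_\delta(A)=\inf\{\sum_j h(\operatorname{diam}C_j): A\subset\bigcup_j C_j,\ \operatorname{diam}C_j\leq\delta\}$ and $\mathcal{H}^h(A)=\lim_{\delta\to0}\mathcal{H}^h_\delta(A)$; $\mathcal{H}^n$ is the case $h(t)=t^n$ (taken in $\mathbb{R}^d$ for images). A map $f$ satisfies Luzin's condition (N) in a set $S$ if $\mathcal{H}^n(f(Z))=0$ for every $Z\subset S$ of zero $n$-dimensional Lebesgue measure. *)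

(* Defs.v *)
From HB Require Import structures.
From mathcomp Require Import all_boot all_order all_algebra.
From mathcomp Require Import all_classical all_reals all_analysis.

Set Implicit Arguments.
Unset Strict Implicit.
Unset Printing Implicit Defensive.
Import Order.TTheory GRing.Theory Num.Theory.
Import numFieldNormedType.Exports.

Local Open Scope classical_set_scope.
Local Open Scope ring_scope.

Section Defs.
Variable R : realType.

(** Points of R^k are k-tuples of reals; R^k carries the product
    (= Borel) sigma-algebra of the library's measurable structure on tuples. *)

Definition edist (k : nat) (x y : k.-tuple R) : R :=
  Num.sqrt (\sum_(i < k) (tnth x i - tnth y i) ^+ 2).

Definition shift (k : nat) (x : k.-tuple R) (j : 'I_k) (t : R) : k.-tuple R :=
  [tuple tnth x i + (if i == j then t else 0) | i < k].

Definition is_open (k : nat) (O : set (k.-tuple R)) : Prop :=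
  forall x, O x -> exists2 r : R, 0 < r & forall y, edist y x < r -> O y.

Definition is_closed (k : nat) (K : set (k.-tuple R)) : Prop :=
  forall x, (forall e : R, 0 < e -> exists y, K y /\ edist y x < e) -> K x.

Definition is_bounded (k : nat) (K : set (k.-tuple R)) : Prop :=
  exists M : R, forall x, K x -> forall i, `|tnth x i| <= M.

Definition rcontinuous (k : nat) (g : k.-tuple R -> R) : Prop :=
  forall x (e : R), 0 < e ->
    exists2 dl : R, 0 < dl & forall y, edist y x < dl -> `|g y - g x| < e.

Definition continuous_on (k m : nat) (S : set (k.-tuple R))
    (f : k.-tuple R -> m.-tuple R) : Prop :=
  forall x, S x -> forall e : R, 0 < e ->
    exists2 dl : R, 0 < dl &
      forall y, S y -> edist y x < dl -> edist (f y) (f x) < e.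

Definition pderiv (k : nat) (j : 'I_k) (g : k.-tuple R -> R) : k.-tuple R -> R :=
  fun x => derive1 (fun t : R => g (shift x j t)) 0.

Definition pderivable (k : nat) (j : 'I_k) (g : k.-tuple R -> R) : Prop :=
  forall x, derivable (fun t : R => g (shift x j t)) 0 1.

Fixpoint Cjs (k : nat) (js : seq 'I_k) (g : k.-tuple R -> R) : Prop :=
  match js with
  | [::] => rcontinuous g
  | j :: js' => pderivable j g /\ Cjs js' (pderiv j g)
  end.

Definition smooth (k : nat) (g : k.-tuple R -> R) : Prop :=
  forall js : seq 'I_k, Cjs js g.

Definition test_fun (k : nat) (O : set (k.-tuple R)) (g : k.-tuple R -> R) : Prop :=
  smooth g /\
  exists K : set (k.-tuple R),
    [/\ is_closed K, is_bounded K, K `<=` O & forall x, ~ K x -> g x = 0].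

Definition lebesgue_on_boxes (k : nat)
    (mu : {measure set (k.-tuple R) -> \bar R}) : Prop :=
  forall a b : k.-tuple R,
    mu [set x | forall i, tnth a i < tnth x i <= tnth b i] =
    (\prod_(i < k) Num.max (tnth b i - tnth a i) 0)%:E.

Definition in_Lp (k : nat) (mu : {measure set (k.-tuple R) -> \bar R})
    (O : set (k.-tuple R)) (p : nat) (g : k.-tuple R -> R) : Prop :=
  measurable_fun O g /\
  (\int[mu]_(x in O) (`|g x| ^+ p)%:E < +oo)%E.

Definition weak_jacobian (k m : nat) (mu : {measure set (k.-tuple R) -> \bar R})
    (O : set (k.-tuple R)) (f : k.-tuple R -> m.-tuple R)
    (G : 'I_m -> 'I_k -> k.-tuple R -> R) : Prop :=
  forall (i : 'I_m) (j : 'I_k) (phi : k.-tuple R -> R), test_fun O phi ->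
    (\int[mu]_(x in O) (tnth (f x) i * pderiv j phi x)%:E =
     - \int[mu]_(x in O) (G i j x * phi x)%:E)%E.

Definition jac_norm (k m : nat) (G : 'I_m -> 'I_k -> k.-tuple R -> R)
    (x : k.-tuple R) : R :=
  Num.sqrt (\sum_(i < m) \sum_(j < k) G i j x ^+ 2).

Definition sobolev_W1p_with (k m : nat) (mu : {measure set (k.-tuple R) -> \bar R})
    (O : set (k.-tuple R)) (p : nat) (f : k.-tuple R -> m.-tuple R)
    (G : 'I_m -> 'I_k -> k.-tuple R -> R) : Prop :=
  [/\ forall i, in_Lp mu O p (fun x => tnth (f x) i),
      forall i j, in_Lp mu O p (G i j) &
      weak_jacobian mu O f G].

(** Diameter (Euclidean); diam of the empty set is 0. *)
Definition diam (m : nat) (C : set (m.-tuple R)) : \bar R :=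
  ereal_sup ([set 0%E] `|` [set (edist x y)%:E | x in C & y in C]).

(** Gauge functions, represented on [0, +oo) (the value at +oo never
    intervenes in H^h_delta since covering sets have diameter <= delta). *)
Definition gauge (h : R -> \bar R) : Prop :=
  [/\ (0 <= h 0%R)%E,
      forall s t, 0 <= s -> s <= t -> (h s <= h t)%E,
      forall t, 0 < t -> (0 < h t)%E &
      forall t, 0 <= t -> h x @[x --> t^'+] --> h t].

Definition hausdorff_delta (m : nat) (h : R -> \bar R) (delta : R)
    (A : set (m.-tuple R)) : \bar R :=
  ereal_inf [set (\sum_(j <oo) h (fine (diam (C j))))%E
            | C in [set C : nat -> set (m.-tuple R) |
                     A `<=` \bigcup_j C j /\
                     forall j, (diam (C j) <= delta%:E)%E]].

(** H^h = lim_{delta -> 0} H^h_delta = sup_{delta > 0} H^h_delta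
    (H^h_delta is nonincreasing in delta). *)
Definition hausdorff (m : nat) (h : R -> \bar R) (A : set (m.-tuple R)) : \bar R :=
  ereal_sup [set hausdorff_delta h delta A | delta in [set delta : R | 0 < delta]].

Definition pow_gauge (k : nat) : R -> \bar R := fun t => (t ^+ k)%:E.

Definition luzin_N (k m : nat) (mu : {measure set (k.-tuple R) -> \bar R})
    (f : k.-tuple R -> m.-tuple R) (S : set (k.-tuple R)) : Prop :=
  forall Z, Z `<=` S -> mu.-negligible Z -> hausdorff (pow_gauge k) (f @` Z) = 0%E.

End Defs.

(* Main.v *)
(** Write F = |Df|^n log^lam(e + |Df|) and let Q_k(z) be the dyadic cell of side
    2^-k containing z.  The exceptional set E consists of the z at which, for every
    gamma' > 0, the energy of F on Q_k(z) is not O(phi_gamma'(2^-k)), where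
    phi_gamma' is the gauge of the theorem.  The first cells where this energy
    exceeds a large multiple of phi_gamma'(2^-k) are disjoint and cover E, so
    H^phi(E) = 0.

    Let z be outside E, u = |f - f(z)| and m = max(u, e^-N).  Averages of f against
    smooth bumps on the cells of a fine dyadic grid turn the weak derivative into a
    discrete gradient bound; telescoping the means of - ln m over the Q_k(z) gives
    N <= const + C sum_k 2^(k(n-1)) int_(Q_k(z)) |Df| / m.  Young's inequality bounds
    the sum over the first levels by a small multiple of N plus C int F / m^n, and
    the decay of the energy at z bounds the sum over the other levels.  If
    int_(U cap {u < e^-l}) (1 + F) < c e^(-ln) for all large l, the layer-cake formula
    gives int F / m^n <= const + c' N with c' small, so N is bounded: a contradiction.
    Hence these integrals are at least c e^(-ln) for arbitrarily large l, and a Vitali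
    selection of balls in the image bounds H^n(f(Z)) by C int_U (1 + F) / c for every
    open U containing Z; this is arbitrarily small when Z is negligible. *)
Require Import Defs.
From HB Require Import structures.
From mathcomp Require Import all_boot all_order all_algebra.
From mathcomp Require Import all_classical all_reals all_analysis.
From mathcomp Require Import finmap measurable_realfun ring lra zify.
Set Implicit Arguments.
Unset Strict Implicit.
Unset Printing Implicit Defensive.
Import Order.TTheory GRing.Theory Num.Theory.
Import numFieldNormedType.Exports.
Local Open Scope classical_set_scope.
Local Open Scope ring_scope.
Local Notation edist := Defs.edist.
Local Notation shift := Defs.shift.

(** * Real estimates *)

(** The obstacle is that [ln] of the distance from [f] to [f z] can be neither differentiated, only
    a weak gradient being given, nor bounded below. Truncation at [e^-N] bounds it, with value
    exactly [-N] at [z]. Taking the logarithm of averages of [f], rather than averages of the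
    logarithm, lets a finite-difference bound and the Lipschitz estimate for [ln] replace the chain
    rule. The bookkeeping is done in the unit [Theta K], the sum of [i^(alpha-1)] over [0 < i < K].
    The exponent [alpha - 1 = - lam / (n-1)] is what Young's inequality leaves of a logarithmic
    weight of size [i^lam]; the sum grows like [K^alpha], or like [ln K] when [alpha = 0], whence
    the two forms of the gauge. Controlling the last levels requires [Theta K] to be of the order of
    [N], while the first levels cost [s * Theta K]; so [s] is fixed in terms of the constant of the
    last levels. Neither [s] nor the final constant [c] depends on [z]: the covering argument needs
    one [c] for all points. *)

Section RealEstimates.
Variable R : realType.

(** A dichotomy replaces the sharp Young inequality. If [g <= s * b * La^(-1/(n-1))] the first term
    dominates; otherwise the left side may be multiplied by the [(n-1)]-th power of a ratio greater
    than [1], which turns it into the second term. The weight sits on [g ^+ n], to match the energy,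
    and is recovered as a gain on [b ^+ n]. *)
Lemma young_split (n : nat) (g b s La : R) : (2 <= n)%N -> 0 <= g -> 0 < b ->
  0 < s -> 1 <= La ->
  g * b ^+ n.-1 <= s * b ^+ n * powR La (- (n.-1)%:R^-1)
                   + s^-1 ^+ n.-1 * (g ^+ n * La).
Proof.
case: n => [//|m]; rewrite ltnS => m1 g0 b0 s0 La1 /=.
have La0 : 0 < La by lra.
have m0 : (m%:R : R) != 0 by rewrite pnatr_eq0; lia.
pose t := powR La (- m%:R^-1).
have t0 : 0 < t by rewrite powR_gt0.
have tm : t ^+ m = La^-1.
  by rewrite -powR_mulrn ?ltW// -powRrM mulNr mulVf// powR_inv1// ltW.
have [gs|sg] := leP g (s * b * t).
  apply: (@le_trans _ _ (s * b * t * b ^+ m)); first by rewrite ler_wpM2r// exprn_ge0 // ltW.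
  rewrite -/t exprS.
  suff : 0 <= s^-1 ^+ m * (g ^+ m.+1 * La) by lra.
  by rewrite !mulr_ge0 ?exprn_ge0 ?invr_ge0 // ltW.
have -> : s^-1 ^+ m * (g ^+ m.+1 * La) = g * b ^+ m * (g / (s * b * t)) ^+ m.
  rewrite expr_div_n !exprMn tm invfM invrK exprVn exprS.
  have : b ^+ m != 0 by rewrite expf_neq0 // gt_eqF.
  have : s ^+ m != 0 by rewrite expf_neq0 // gt_eqF.
  move: (b ^+ m) (s ^+ m) (g ^+ m) => X Y Z Y0 X0; field.
  by rewrite X0 Y0.
have : g * b ^+ m <= g * b ^+ m * (g / (s * b * t)) ^+ m.
  rewrite ler_peMr ?mulr_ge0 ?exprn_ge0 // ?(ltW b0)//.
  by rewrite exprn_ege1 // ler_pdivlMr ?mul1r ?ltW // !mulr_gt0.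
have : 0 <= s * b ^+ m.+1 * powR La (- m%:R^-1).
  by rewrite !mulr_ge0 ?exprn_ge0 ?powR_ge0 // ltW.
lra.
Qed.

Lemma ln_ge_frac (a : R) : 0 < a -> 1 - a^-1 <= ln a.
Proof.
move=> a0; have := le_ln1Dx (x := a^-1 - 1).
have -> : 1 + (a^-1 - 1) = a^-1 by lra.
rewrite lnV ?posrE // => /(_ _); rewrite ltrBDl subrr invr_gt0 a0 => /(_ isT); lra.
Qed.

(** The terms at least double from one level to the next because [n >= 2], so a selected sum is at
    most twice its last selected term. A pointwise sum over the levels thereby reduces to one level,
    and the energy is counted once instead of once per level. *)
Lemma geo_dom (n k0 K : nat) (P : pred nat) : (2 <= n)%N ->
  (\sum_(k0 <= k < K | P k) (2 ^+ k) ^+ n.-1 = 0 :> R) \/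
  exists i, [/\ (k0 <= i < K)%N, P i &
    \sum_(k0 <= k < K | P k) (2 ^+ k) ^+ n.-1 <= 2 * (2 ^+ i) ^+ n.-1 :> R].
Proof.
move=> n2; elim: K => [|K IH]; first by left; rewrite big_geq.
have [k0K|Kk0] := leqP k0 K; last by left; rewrite big_geq.
rewrite big_mkcond big_nat_recr//= -big_mkcond/=; case: ifP => PK; last first.
  rewrite addr0; case: IH => [->|[i [iK Pi le]]]; first by left.
  by right; exists i; split => //; lia.
right; exists K; split => //; first lia.
have p0 : 0 <= (2 ^+ K) ^+ n.-1 :> R by rewrite !exprn_ge0.
case: IH => [->|[i [iK Pi le]]]; first by lra.
suff : 2 * (2 ^+ i) ^+ n.-1 <= (2 ^+ K) ^+ n.-1 :> R by lra.
rewrite -!exprM -exprS ler_weXn2l ?ler1n//.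
by move: iK => /andP[_]; nia.
Qed.

Lemma ln_ge_geo (i : nat) (D e : R) : 0 <= e -> (6 / 5) ^+ i <= e + D ->
  i%:R / 6 <= ln (e + D).
Proof.
move=> e0 h; have p0 : 0 < (6 / 5) ^+ i :> R by rewrite exprn_gt0//; lra.
apply: (@le_trans _ _ (ln ((6 / 5) ^+ i))); last by rewrite ler_ln ?posrE // (lt_le_trans p0).
rewrite lnXn; last by lra.
have := @ln_ge_frac (6 / 5); rewrite invf_div => /(_ _); have -> : 0 < 6 / 5 :> R by lra.
by move=> /(_ isT) h1; rewrite -[X in _ <= X]mulr_natl ler_wpM2l //; lra.
Qed.

Variables (n : nat) (lam : R).
Hypotheses (n2 : (2 <= n)%N) (lam0 : 0 <= lam) (lam1 : lam <= (n.-1)%:R).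
Definition lalpha : R := 1 - lam / (n.-1)%:R.
Local Notation al := lalpha.

Lemma n1_gt0 : 0 < (n.-1)%:R :> R.
Proof. by rewrite ltr0n; lia. Qed.

Lemma alpha_ge0 : 0 <= al.
Proof. by rewrite /lalpha subr_ge0 ler_pdivrMr ?n1_gt0 // mul1r. Qed.

Lemma alpha_le1 : al <= 1.
Proof. by rewrite /lalpha gerBl divr_ge0 // ltW // n1_gt0. Qed.

(** This is [La^(-1/(n-1))] for a logarithmic factor [La = i^lam]. *)
Definition theta (i : nat) : R := powR i%:R (al - 1).

Lemma theta_ge0 i : 0 <= theta i.
Proof. exact: powR_ge0. Qed.

Lemma one_le_ln (D : R) : 0 <= D -> 1 <= ln (expR 1 + D).
Proof.
move=> D0; rewrite -[X in X <= _](expRK (1 : R)) ler_ln ?posrE ?expR_gt0 //; first by lra.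
by rewrite ltr_wpDr // expR_gt0.
Qed.

(* Cases: either [D / m] is at most [(3/2)^i] (summable contribution), or [D]
   is exponentially large in [i], so that the logarithmic factor is at least
   [(i/6)^lam], or [m] is so small that [i < 5 N]. *)
Lemma kernel_young (N i : nat) (D m s : R) : (0 < i)%N -> 0 <= D ->
  expR (- N%:R) <= m -> 0 < s ->
  D / m * (2 ^+ i) ^+ n.-1 <=
    (3 / 2) ^+ i * (2 ^+ i) ^+ n.-1
    + s * (2 ^+ i) ^+ n * (6 * theta i + (i < 5 * N)%:R)
    + s^-1 ^+ n.-1 * (D ^+ n * powR (ln (expR 1 + D)) lam / m ^+ n).
Proof.
move=> i0 D0 mN s0.
have m0 : 0 < m by apply: lt_le_trans mN; exact: expR_gt0.
set La := powR (ln (expR 1 + D)) lam.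
have l1 := one_le_ln D0.
have La1 : 1 <= La.
  by rewrite /La -[X in X <= _](powRr0 (ln (expR 1 + D))) ler_powR.
have g0 : 0 <= D / m by rewrite divr_ge0 // ltW.
have b0 : 0 < 2 ^+ i :> R by rewrite exprn_gt0.
have bn0 : 0 < (2 ^+ i) ^+ n :> R by rewrite exprn_gt0.
have bm0 : 0 < (2 ^+ i) ^+ n.-1 :> R by rewrite exprn_gt0.
have th0 := theta_ge0 i.
have -> : D ^+ n * La / m ^+ n = (D / m) ^+ n * La by rewrite expr_div_n; lra.
have A0 : 0 <= s^-1 ^+ n.-1 * ((D / m) ^+ n * La).
  by rewrite !mulr_ge0 ?exprn_ge0 ?invr_ge0 // ltW // (lt_le_trans ltr01).
have B0 : 0 <= s * (2 ^+ i) ^+ n by rewrite mulr_ge0 // ltW.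
have iN0 : 0 <= (i < 5 * N)%:R :> R by rewrite ler0n.
have C0 : 0 <= s * (2 ^+ i) ^+ n * (6 * theta i + (i < 5 * N)%:R).
  by rewrite mulr_ge0 //; lra.
have [gle|glt] := leP (D / m) ((3 / 2) ^+ i).
  have : D / m * (2 ^+ i) ^+ n.-1 <= (3 / 2) ^+ i * (2 ^+ i) ^+ n.-1 by rewrite ler_wpM2r // ltW.
  lra.
have E0 : 0 <= (3 / 2) ^+ i * (2 ^+ i) ^+ n.-1 :> R.
  by rewrite mulr_ge0 ?exprn_ge0 // ltW.
have Y := young_split n2 g0 b0 s0 La1.
suff H : powR La (- (n.-1)%:R^-1) <= 6 * theta i + (i < 5 * N)%:R.
  have : s * (2 ^+ i) ^+ n * powR La (- (n.-1)%:R^-1) <=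
     s * (2 ^+ i) ^+ n * (6 * theta i + (i < 5 * N)%:R) by rewrite ler_wpM2l.
  lra.
have n10 := n1_gt0.
have [iN|Ni] := ltnP i (5 * N).
  have : powR La (- (n.-1)%:R^-1) <= 1.
    rewrite powRN invf_le1 ?powR_gt0 //; last by lra.
    by rewrite -[X in X <= _](powRr0 La) ler_powR // invr_ge0 ltW.
  rewrite /=; lra.
(* [ln (5/4) >= 1/5] and [5 * N <= i] give [(5/4)^-i <= e^-N]. With [D / m > (3/2)^i] this forces
   [D] above [(3/2 * 4/5)^i = (6/5)^i]. *)
have hm : (5 / 4) ^- i <= m.
  apply: le_trans mN.
  have p54 : 0 < (5 / 4) ^+ i :> R by rewrite exprn_gt0 //; lra.
  rewrite -ler_ln ?posrE ?expR_gt0 ?invr_gt0 // expRK lnV ?posrE //.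
  rewrite lnXn; last by lra.
  have := @ln_ge_frac (5 / 4); rewrite invf_div => /(_ _); have -> : 0 < 5 / 4 :> R by lra.
  move=> /(_ isT) h1; rewrite lerN2.
  have : (N%:R : R) * 5 <= i%:R by rewrite -natrM ler_nat mulnC.
  have i0' : 0 < i%:R :> R by rewrite ltr0n.
  have : i%:R * (1 - 4 / 5) <= i%:R * ln (5 / 4) :> R by rewrite ler_wpM2l // ltW.
  rewrite -(mulr_natl (ln _)); lra.
have hD : (6 / 5) ^+ i <= expR 1 + D.
  apply: (@le_trans _ _ ((3 / 2) ^+ i * m)).
    apply: (@le_trans _ _ ((3 / 2) ^+ i * (5 / 4) ^- i)); last first.
      by rewrite ler_wpM2l // exprn_ge0.
    by rewrite -exprVn -exprMn invf_div (_ : 3 / 2 * (4 / 5) = 6 / 5 :> R) //; lra.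
  have h : (3 / 2) ^+ i * m <= D by rewrite -ler_pdivlMr // ltW.
  by apply: (le_trans h); rewrite lerDr expR_ge0.
have hl := ln_ge_geo (ltW (expR_gt0 1)) hD.
have i0' : 0 < i%:R / 6 :> R by rewrite divr_gt0 // ltr0n.
rewrite /La -powRrM.
apply: (@le_trans _ _ (powR (i%:R / 6) (lam * - (n.-1)%:R^-1))).
  have q0 : 0 <= lam * (n.-1)%:R^-1 by rewrite mulr_ge0 // invr_ge0 ltW.
  rewrite mulrN !powRN lef_pV2 ?posrE ?powR_gt0 //; last by lra.
  by rewrite ge0_ler_powR // nnegrE; lra.
have -> : lam * - (n.-1)%:R^-1 = al - 1 by rewrite /lalpha; lra.
(* The factor [6] of the conclusion is a bound for [6^(1 - al)], as [al >= 0]. *)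
rewrite powRM ?invr_ge0 ?ler0n // mulrC /= addr0 /theta ler_wpM2r ?powR_ge0 //.
rewrite -powR_inv1 // -powRrM mulN1r opprB -[X in _ <= X]powRr1 // ler_powR //; first by lra.
by have := alpha_ge0; lra.
Qed.

Definition Theta (K : nat) : R := \sum_(1 <= i < K) theta i.

Lemma Theta_mono (K L : nat) : (K <= L)%N -> Theta K <= Theta L.
Proof.
move=> KL; rewrite /Theta; have [K1|K1] := leqP 1 K; last first.
  by rewrite [X in X <= _]big_geq ?sumr_ge0 //= => *; rewrite ?theta_ge0 //; lia.
by rewrite [X in _ <= X](big_cat_nat K1 KL)//= lerDl sumr_ge0 // => *; exact: theta_ge0.
Qed.

Lemma theta_le1 i : (0 < i)%N -> theta i <= 1.
Proof.
move=> i0; rewrite /theta -[X in _ <= X](powRr0 i%:R) ler_powR ?ler1n //.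
by have := alpha_le1; lra.
Qed.

Lemma theta_geV i : (0 < i)%N -> i%:R^-1 <= theta i.
Proof.
move=> i0; rewrite /theta -powR_inv1 // ler_powR ?ler1n //.
by have := alpha_ge0; lra.
Qed.

(** [al >= 0] puts the terms above those of the harmonic series. *)
Lemma Theta_unbounded (A : R) : exists K, A <= Theta K.
Proof.
apply: contrapT => /forallNP h; apply: (@dvg_harmonic R).
apply: nondecreasing_is_cvgn.
  by apply: nondecreasing_series => m _ _; rewrite invr_ge0.
exists A => _ [m _ <-]; rewrite /series /=.
apply: (@le_trans _ _ (Theta m.+1)); last by have /negP := h m.+1; rewrite -ltNge => /ltW.
rewrite /Theta big_add1 /= ler_sum_nat // => i im.
exact: theta_geV.
Qed.

(** The least [K] reaching [A] overshoots by at most one term, and terms are at most [1]; raising it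
    to [k1] costs at most [Theta k1]. *)
Lemma Theta_pick (A : R) (k1 : nat) : 0 <= A ->
  exists K, [/\ (k1 <= K)%N, A <= Theta K & Theta K <= A + 1 + Theta k1].
Proof.
move=> A0; have [K0 hK0] := Theta_unbounded A.
have ex : exists K, A <= Theta K by exists K0.
have [K hK Kmin] := ex_minnP ex.
have hK1 : Theta K <= A + 1.
  case: K hK Kmin => [|K] hK Kmin; first by rewrite /Theta big_geq //; lra.
  have [K0'|K0'] := posnP K; first by rewrite K0' /Theta big_geq //; lra.
  rewrite /Theta big_nat_recr //= lerD // ?theta_le1 //.
  by rewrite leNgt; apply/negP => /ltW /Kmin; rewrite ltnn.
exists (maxn k1 K); split; first exact: leq_maxl.
- by apply: (le_trans hK); apply: Theta_mono; exact: leq_maxr.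
- have T0 k : 0 <= Theta k by rewrite sumr_ge0 // => *; exact: theta_ge0.
  have := T0 k1; have := T0 K.
  by rewrite /maxn; case: ifP => _; lra.
Qed.

Lemma ln_pred_ratio (j : nat) : (1 < j)%N -> ln (j.-1%:R / j%:R) <= - j%:R^-1 :> R.
Proof.
move=> j1; have j0 : 0 < j%:R :> R by rewrite ltr0n; lia.
have -> : j.-1%:R / j%:R = 1 + - j%:R^-1 :> R.
  by rewrite -subn1 natrB ?mulrBl ?divff ?gt_eqF //; [lra | lia].
apply: le_ln1Dx; rewrite ltrN2 invf_lt1 // ltr1n //.
Qed.

Lemma powR_pred_ratio (s : R) (j : nat) : (1 < j)%N ->
  powR j.-1%:R s = powR j%:R s * expR (s * ln (j.-1%:R / j%:R)).
Proof.
move=> j1; have j0 : 0 < j%:R :> R by rewrite ltr0n; lia.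
have j10 : 0 < j.-1%:R :> R by rewrite ltr0n; lia.
rewrite /powR !gt_eqF // -expRD ln_div ?posrE //; congr expR; lra.
Qed.

(* telescoping: [s j^(-1-s) <= (j-1)^(-s) - j^(-s)] *)
Lemma powR_sum_bound (s : R) : 0 < s -> exists2 C : R, 0 <= C & forall K L : nat,
  (0 < K)%N -> \sum_(K <= j < L) powR j%:R (- (1 + s)) <= C.
Proof.
move=> s0; exists (1 + s^-1); first by rewrite addr_ge0 // invr_ge0 ltW.
have step j : (1 < j)%N ->
    powR j%:R (- (1 + s)) <= s^-1 * (powR j.-1%:R (- s) - powR j%:R (- s)) :> R.
  move=> j1; have j0 : 0 < j%:R :> R by rewrite ltr0n; lia.
  rewrite powR_pred_ratio // opprD powRD; last by rewrite (gt_eqF j0) implybT.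
  rewrite powR_inv1 ?(ltW j0) //.
  set p := powR _ _; have p0 : 0 <= p by exact: powR_ge0.
  have h : 1 + s / j%:R <= expR (- s * ln (j.-1%:R / j%:R)).
    apply: le_trans (expR_ge1Dx _); rewrite lerD2l.
    have := ler_wpM2l (ltW s0) (ln_pred_ratio j1); lra.
  have := ler_wpM2l p0 h => h2.
  have -> : j%:R^-1 * p = s^-1 * (p * (1 + s / j%:R) - p) by field; rewrite !gt_eqF.
  by rewrite ler_wpM2l ?invr_ge0 ?(ltW s0) // lerB.
have tele m : \sum_(1 <= j < m.+1) powR j%:R (- (1 + s)) <= 1 + s^-1 * (1 - powR m%:R (- s)) :> R.
  elim: m => [|m IH].
    rewrite big_geq // powR0 ?subr0 ?mulr1 ?oppr_eq0 ?gt_eqF //.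
    by rewrite addr_ge0 // invr_ge0 ltW.
  rewrite big_nat_recr //=.
  case: m IH => [|m] IH; first by rewrite big_geq // !powR1; lra.
  have := step m.+2 isT; rewrite /=; lra.
move=> K L K0.
have [LK|KL] := leqP L K; first by rewrite big_geq // addr_ge0 // invr_ge0 ltW.
apply: (@le_trans _ _ (\sum_(1 <= j < L) powR j%:R (- (1 + s)))).
  rewrite [X in _ <= X](big_cat_nat (n := K)) //=; last exact: ltnW.
  by rewrite lerDr sumr_ge0 // => *; exact: powR_ge0.
case: L KL => // L _; apply: (le_trans (tele L)).
by rewrite lerD2l -[X in _ <= X]mulr1 ler_wpM2l ?invr_ge0 ?(ltW s0) // gerBl powR_ge0.
Qed.

(** The inequality [ln x <= x - 1] at [x = dl * j^a], with [dl = c * a / 2], becomes after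
    multiplication by [2 / a] a bound of [2 * ln j] by [c * j^a] up to a constant; exponentiating
    gives the power [j^-2]. *)
Lemma expR_powR_le (c a : R) : 0 < c -> 0 < a -> exists2 C : R, 0 <= C & forall j : nat,
  (0 < j)%N -> expR (- (c * powR j%:R a)) <= C * powR j%:R (- (1 + 1)).
Proof.
move=> c0 a0; pose dl := c * a / 2.
have dl0 : 0 < dl by rewrite /dl; apply: divr_gt0 => //; exact: mulr_gt0.
exists (expR (- (2 / a * ln dl))); first exact: expR_ge0.
move=> j j0; have j0' : 0 < j%:R :> R by rewrite ltr0n.
rewrite {2}/powR gt_eqF // -expRD ler_expR.
have p0 : 0 < powR j%:R a by exact: powR_gt0.
have := le_ln1Dx (x := dl * powR j%:R a - 1).
have -> : 1 + (dl * powR j%:R a - 1) = dl * powR j%:R a by lra.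
have -> : -1 < dl * powR j%:R a - 1 by rewrite ltrBrDr addNr mulr_gt0.
move=> /(_ isT); rewrite lnM ?posrE // ln_powR => h.
have a20 : 0 <= 2 / a by rewrite divr_ge0 // ltW.
have := ler_wpM2l a20 h.
have -> : 2 / a * (ln dl + a * ln j%:R) = 2 / a * ln dl + 2 * ln j%:R.
  by field; rewrite gt_eqF.
have -> : 2 / a * (dl * powR j%:R a - 1) = c * powR j%:R a - 2 / a.
  by rewrite /dl; field; rewrite gt_eqF.
lra.
Qed.

(* The gauge of the theorem at scale [2^-k], with [ln 2] absorbed in [gam]. *)
Definition gdecay (gam : R) (k : nat) : R :=
  if 0 < al then expR (- (gam * powR k%:R al)) else powR k%:R (- (n%:R + gam)).

Lemma gdecay_gt0 gam k : (0 < k)%N -> 0 < gdecay gam k.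
Proof. by move=> k0; rewrite /gdecay; case: ifP => _; rewrite ?expR_gt0 // powR_gt0 // ltr0n. Qed.

(** Induction against the increments of [2 / al * k^al]. With [x = al / k] in [[0, 1]], the chain
    [e^-x <= 1 / (1 + x) <= 1 - x / 2] shows that such an increment is at least [k^(al - 1)]; the
    factor [2] pays for the last inequality. *)
Lemma Theta_le_alpha k : 0 < al -> (0 < k)%N -> Theta k <= 2 / al * powR k%:R al + 1.
Proof.
move=> a0 k0; have q0 : 0 <= 2 / al by rewrite divr_ge0 // ltW.
apply: (le_trans (Theta_mono (leqnSn k))).
elim: k k0 => [//|[|k] IH] _.
  by rewrite /Theta big_nat1 /theta !powR1 mulr1 lerDr.
rewrite /Theta big_nat_recr //= -/(Theta k.+2).
have := IH isT.
suff : theta k.+2 <= 2 / al * (powR k.+2%:R al - powR k.+1%:R al).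
  by rewrite mulrBr; lra.
have k0 : 0 < k.+2%:R :> R by rewrite ltr0n.
have := @powR_pred_ratio al k.+2 isT => /= ->.
have ak : 0 <= al / k.+2%:R by rewrite divr_ge0 // ltW.
have ak1 : al / k.+2%:R <= 1.
  by rewrite ler_pdivrMr // mul1r; apply: (le_trans alpha_le1); rewrite ler1n.
have h : expR (al * ln (k.+1%:R / k.+2%:R)) <= 1 - al / k.+2%:R / 2.
  apply: (@le_trans _ _ (expR (- (al / k.+2%:R)))).
    by rewrite ler_expR -mulrN ler_wpM2l ?(ltW a0) // (@ln_pred_ratio k.+2 isT).
  rewrite expRN; apply: (@le_trans _ _ (1 + al / k.+2%:R)^-1).
    by rewrite lef_pV2 ?posrE ?expR_gt0 ?expR_ge1Dx // ltr_wpDr.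
  rewrite -[X in X <= _]div1r ler_pdivrMr ?ltr_wpDr //.
  move: ak ak1; move: (al / _) => x x0 x1.
  have : 0 <= x * (1 - x) by rewrite mulr_ge0 // subr_ge0.
  by lra.
rewrite -[X in _ <= _ * (X - _)]mulr1 -mulrBr.
have p0 : 0 <= powR k.+2%:R al by exact: powR_ge0.
have h2 : powR k.+2%:R al * (al / k.+2%:R / 2) <=
   powR k.+2%:R al * (1 - expR (al * ln (k.+1%:R / k.+2%:R))).
  by rewrite ler_wpM2l // lerBrDr addrC -lerBrDr.
apply: le_trans (ler_wpM2l q0 h2).
have -> : 2 / al * (powR k.+2%:R al * (al / k.+2%:R / 2)) = powR k.+2%:R al / k.+2%:R.
  by field; rewrite !gt_eqF.
rewrite /theta powRD; last by rewrite (gt_eqF k0) implybT.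
by rewrite powR_inv1 // ltW.
Qed.

Lemma Theta_le_ln k : al = 0 -> (0 < k)%N -> Theta k <= ln k%:R + 1.
Proof.
move=> a0 k0; apply: (le_trans (Theta_mono (leqnSn k))).
elim: k k0 => [//|[|k] IH] _.
  by rewrite /Theta big_nat1 /theta powR1 ln1 add0r.
rewrite /Theta big_nat_recr //= -/(Theta k.+2).
have := IH isT; have /= := @ln_pred_ratio k.+2 isT.
have k0 : 0 < k.+2%:R :> R by rewrite ltr0n.
have k1 : 0 < k.+1%:R :> R by rewrite ltr0n.
rewrite ln_div ?posrE // /theta a0 sub0r powR_inv1 ?(ltW k0) //.
move: (ln k.+1%:R) (ln k.+2%:R) (k.+2%:R^-1) (Theta k.+2) => x y z t; lra.
Qed.

(** The [n]-th root of the gauge is shared between two tasks: a factor exponentially small in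
    [Theta k], which will beat [e^N], and a summable factor. When [al = 0] the root is
    [k^-(1 + gam / n)]: the [n] in the exponent of the gauge supplies the power [-1], and the two
    halves of [gam / n] do one task each. *)
Lemma decay_split (gam : R) : 0 < gam -> exists s C t : R,
  [/\ 0 < s, 0 < t, 0 <= C & forall k, (0 < k)%N ->
     powR (gdecay gam k) n%:R^-1 <=
       C * expR (- (s * (Theta k - 1))) * powR k%:R (- (1 + t))].
Proof.
move=> g0; have n0 : 0 < n%:R :> R by rewrite ltr0n; lia.
have s0 : 0 < gam / n%:R / 2 by rewrite !divr_gt0.
have [a0|a0] := ltP 0 al.
  have [C C0 hC] := expR_powR_le s0 a0.
  exists (gam / n%:R / 2 * (al / 2)), C, 1; split => //.
    by rewrite mulr_gt0 // divr_gt0.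
  move=> k k0; rewrite /gdecay a0 -expRM.
  have -> : - (gam * powR k%:R al) * n%:R^-1 =
     - (gam / n%:R / 2 * powR k%:R al) + - (gam / n%:R / 2 * powR k%:R al) by field; rewrite gt_eqF.
  have := hC k k0; set X := gam / _ / _ * _ => hX.
  rewrite (expRD (- X) (- X)) (mulrC C) -mulrA.
  rewrite -[X in _ <= X]mulrA; apply: (ler_pM (expR_ge0 _) (expR_ge0 _) _ hX).
  rewrite ler_expR /X lerN2 ler_wpM2l ?(ltW s0) //.
  have := Theta_le_alpha a0 k0 => h.
  have : al / 2 * (Theta k - 1) <= al / 2 * (2 / al * powR k%:R al).
    by rewrite ler_wpM2l //; lra.
  have -> : al / 2 * (2 / al * powR k%:R al) = powR k%:R al by field; rewrite gt_eqF.
  lra.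
have a00 : al = 0 by apply/eqP; rewrite eq_le a0 alpha_ge0.
exists (gam / n%:R / 2), 1, (gam / n%:R / 2); split => //.
move=> k k0; rewrite /gdecay a00 ltxx -powRrM mul1r.
have k0' : 0 < k%:R :> R by rewrite ltr0n.
have -> : - (n%:R + gam) / n%:R = - (gam / n%:R / 2) + - (1 + gam / n%:R / 2).
  by field; rewrite gt_eqF.
rewrite powRD; last by rewrite (gt_eqF k0') implybT.
rewrite ler_wpM2r ?powR_ge0 // {1}/powR gt_eqF // ler_expR mulNr lerN2.
rewrite ler_wpM2l ?(ltW s0) //.
by have := Theta_le_ln a00 k0; lra.
Qed.

(** [K] is a level where [Theta K] has reached [N / s]: from there on [e^N] is absorbed and the tail
    is bounded independently of [N]. The order of the quantifiers matters: [B] comes before [k1],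
    which will depend on the point, so only the additive constant [C] varies with the point. *)
Lemma decay_tail (gam : R) : 0 < gam -> exists2 B : R, 0 <= B &
  forall k1 : nat, exists C : R, forall N : nat, exists K : nat,
    [/\ (k1 <= K)%N, Theta K <= B * N%:R + C &
      forall M, \sum_(K <= k < M) expR N%:R * powR (gdecay gam k) n%:R^-1 <= C].
Proof.
move=> g0; have [s [C [t [s0 t0 C0 h]]]] := decay_split g0.
have [C2 C20 h2] := powR_sum_bound t0.
exists s^-1; first by rewrite invr_ge0 ltW.
move=> k1; pose A := C * expR s * C2.
have A0 : 0 <= A by rewrite !mulr_ge0 // expR_ge0.
have T1 : 0 <= Theta k1.+1 by rewrite sumr_ge0 // => *; exact: theta_ge0.
exists (A + 1 + Theta k1.+1) => N.
have sN0 : 0 <= s^-1 * N%:R by rewrite mulr_ge0 // invr_ge0 ltW.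
(* Asking for [k1.+1] keeps every level of the tail positive, as [decay_split] requires. *)
have [K [kK NK KT]] := @Theta_pick (s^-1 * N%:R) k1.+1 sN0.
exists K; split; [exact: ltnW | by move: KT A0; clear; lra | move=> M].
apply: (@le_trans _ _ A); last by lra.
apply: (@le_trans _ _ (C * expR s * \sum_(K <= k < M) powR k%:R (- (1 + t)))); last first.
  by rewrite /A ler_wpM2l ?mulr_ge0 ?expR_ge0 // h2 // (leq_ltn_trans _ kK).
rewrite mulr_sumr; apply: ler_sum_nat => k /andP[Kk _].
have k0 : (0 < k)%N by rewrite (leq_trans _ Kk) // (leq_ltn_trans _ kK).
apply: (@le_trans _ _ (expR N%:R * (C * expR (- (s * (Theta k - 1))) * powR k%:R (- (1 + t))))).
  by rewrite ler_wpM2l ?expR_ge0 // h.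
have -> : expR N%:R * (C * expR (- (s * (Theta k - 1))) * powR k%:R (- (1 + t))) =
  C * expR (N%:R - s * (Theta k - 1)) * powR k%:R (- (1 + t)) by rewrite expRD; ring.
rewrite ler_wpM2r ?powR_ge0 // ler_wpM2l // ler_expR.
have : s * (s^-1 * N%:R) <= s * Theta k.
  by rewrite ler_wpM2l ?(ltW s0) // (le_trans NK) // Theta_mono.
by rewrite mulrA divff ?gt_eqF // mul1r; clear; lra.
Qed.

End RealEstimates.

(** * Smooth bumps and test functions *)

Section Bump.
Variable R : realType.
Implicit Types (P : {poly R}) (t : R).

Let S : {poly R} := 'X * (1 - 'X).

(* This family, with S = t (1 - t), contains the bump and is closed under derivation. *)
Definition bumpf P (k : nat) t : R :=
  if 0 < t < 1 then P.[t] * S.[t]^-1 ^+ k * expR (- S.[t]^-1) else 0.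

Let SE t : S.[t] = t * (1 - t).
Proof. by rewrite /S !hornerE. Qed.

Let S_gt0 t : 0 < t < 1 -> 0 < S.[t].
Proof. by move=> /andP[t0 t1]; rewrite SE mulr_gt0 // subr_gt0. Qed.

(** The numerator left when [S^-(k+2) * e^(-1/S)] is factored out of the derivative of
    [P * S^-k * e^(-1/S)]. *)
Definition bump_next P (k : nat) : {poly R} :=
  P^`() * S ^+ 2 - k%:R *: (P * S^`() * S) + P * S^`().

Lemma bump_next_eval P k t : (bump_next P k).[t] =
  P^`().[t] * S.[t] ^+ 2 - k%:R * (P.[t] * S^`().[t] * S.[t]) + P.[t] * S^`().[t].
Proof. by rewrite /bump_next; move: S => Q; rewrite !hornerE. Qed.

Lemma bump_ring k (e x s p p' : R) : x != 0 ->
  (p * x^-1 ^+ k) * (e * - (- x^-1 ^+ 2 * s)) +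
  e * (p * (k%:R * x^-1 ^+ k.-1 * (- x^-1 ^+ 2 * s)) + x^-1 ^+ k * p') =
  (p' * x ^+ 2 - k%:R * (p * s * x) + p * s) * x^-1 ^+ k.+2 * e.
Proof.
move=> x0; have -> : x^-1 ^+ k.+2 = x^-1 ^+ k * x^-1 ^+ 2 by rewrite -exprD addn2.
case: k => [|k]; first by rewrite !expr0; field.
have -> : x^-1 ^+ k.+1 = x^-1 ^+ k * x^-1 by rewrite exprSr.
have -> : k.+1.-1 = k by [].
by move: (x^-1 ^+ k) => z; field.
Qed.

Lemma bumpf_is_derive_in P k t : 0 < t < 1 ->
  is_derive t 1 (bumpf P k) (bumpf (bump_next P k) k.+2 t).
Proof.
move=> t01; have s0 := S_gt0 t01.
have dS := is_derive_poly S t.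
have dP := is_derive_poly P t.
have s0' : S.[t] != 0 by rewrite gt_eqF.
pose I := (fun u : R => S.[u]^-1).
have dI : is_derive t 1 I (- S.[t] ^- 2 *: S^`().[t]) := is_deriveV s0' dS.
have dIk := @is_deriveX R R I k t 1 _ dI.
have dNI := is_deriveN dI.
have dE := @is_derive1_comp R expR (- I) t _ _ (is_derive_expR _) dNI.
have dPI := is_deriveM dP dIk.
have D := is_deriveM dPI dE.
have E : \forall u \near t, (horner P * I ^+ k * (expR \o - I)) u = bumpf P k u.
  have : t \in `]0, 1[ by rewrite in_itv.
  move=> /near_in_itvoo; apply: filterS => u; rewrite in_itv /= /bumpf => ->.
  by rewrite /= !fctE.
apply: (near_eq_is_derive E).
apply: (is_derive_eq D); rewrite /bumpf t01 bump_next_eval.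
have -> : (expR \o - I) t = expR (- S.[t]^-1) by [].
have -> : (- I) t = - S.[t]^-1 by [].
have -> : (I ^+ k) t = S.[t]^-1 ^+ k by rewrite !fctE.
have -> : (horner P * I ^+ k) t = P.[t] * S.[t]^-1 ^+ k by rewrite !fctE.
have -> : I t = S.[t]^-1 by [].
rewrite -(@bump_ring k (expR (- S.[t]^-1)) S.[t] (S^`().[t])) //.
by rewrite /GRing.scale /= -exprVn.
Qed.

Lemma horner_bound01 P : exists2 C : R, 0 <= C & forall t, 0 <= t <= 1 -> `|P.[t]| <= C.
Proof.
elim/poly_ind: P => [|P c [C C0 h]]; first by exists 0 => // t _; rewrite horner0 normr0.
exists (C + `|c|); first by rewrite addr_ge0.
move=> t t01; rewrite !hornerE; apply: (le_trans (ler_normD _ _)).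
rewrite lerD2r normrM; apply: (le_trans _ (h t t01)).
by rewrite ler_piMr // ler_norml; move: t01 => /andP[]; lra.
Qed.

(** The [m]-th power of [y / m <= e^(y/m)]. *)
Lemma expRN_pow_le (m : nat) (y : R) : (0 < m)%N -> 0 <= y ->
  y ^+ m * expR (- y) <= m%:R ^+ m.
Proof.
move=> m0 y0; have m0' : 0 < m%:R :> R by rewrite ltr0n.
rewrite expRN ler_pdivrMr ?expR_gt0 //.
have -> : expR y = expR (y / m%:R) ^+ m.
  by rewrite -expRM_natl; congr expR; field; rewrite gt_eqF.
rewrite -exprMn lerXn2r ?nnegrE ?mulr_ge0 ?expR_ge0 //.
apply: (@le_trans _ _ (m%:R * (y / m%:R))).
  by rewrite mulrCA mulfV ?gt_eqF ?mulr1.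
rewrite ler_wpM2l ?(ltW m0') //; apply: le_trans (expR_ge1Dx _).
by rewrite lerDr.
Qed.

(** Inside the support [S] is at most the distance to any outside point [t0], and
    [S^-(k+2) * e^(-1/S)] is bounded. The two extra powers leave [S^2], hence a quadratic bound,
    which makes the derivative vanish at the endpoints. *)
Lemma bumpf_sq_bound P k t0 : ~~ (0 < t0 < 1) ->
  exists2 C : R, 0 <= C & forall t, `|bumpf P k t| <= C * (t - t0) ^+ 2.
Proof.
move=> t0n; have [C C0 h] := horner_bound01 P.
exists (C * k.+2%:R ^+ k.+2); first by rewrite mulr_ge0 // exprn_ge0.
move=> t; rewrite /bumpf; case: ifPn => [t01|_]; last first.
  by rewrite normr0 mulr_ge0 ?sqr_ge0 // mulr_ge0 // exprn_ge0.
have s0 := S_gt0 t01.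
have hs : S.[t] ^+ 2 <= (t - t0) ^+ 2.
  rewrite -(real_normK (num_real (t - t0))) lerXn2r ?nnegrE ?(ltW s0) // SE.
  move: t0n; rewrite negb_and -!leNgt => /orP[t00|t01'].
    apply: (@le_trans _ _ (t - t0)); last exact: ler_norm.
    by move: t01 => /andP[]; nra.
  rewrite distrC; apply: (@le_trans _ _ (t0 - t)); last exact: ler_norm.
  by move: t01 => /andP[]; nra.
have t01' : 0 <= t <= 1 by case/andP: t01 => a b; rewrite !ltW.
have y0 : 0 <= S.[t]^-1 by rewrite invr_ge0 ltW.
have yk0 : 0 <= S.[t]^-1 ^+ k by rewrite exprn_ge0.
rewrite !normrM (ger0_norm (expR_ge0 _)) (ger0_norm yk0) -mulrA -[X in _ <= X]mulrA.
apply: ler_pM; [exact: normr_ge0 | by rewrite mulr_ge0 // expR_ge0 | exact: h |].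
  apply: (@le_trans _ _ (k.+2%:R ^+ k.+2 * S.[t] ^+ 2)); last by rewrite ler_wpM2l // exprn_ge0.
  rewrite -ler_pdivrMr ?exprn_gt0 //; apply: le_trans (expRN_pow_le (m := k.+2) isT y0).
  rewrite mulrAC -exprVn -exprD addn2 //.
Qed.

Lemma sq_bound_is_derive (g : R -> R) (t0 C : R) :
  (forall t, `|g t| <= C * (t - t0) ^+ 2) -> is_derive t0 1 g 0.
Proof.
move=> h; have C0 : 0 <= C.
  by have := h (t0 + 1); rewrite addrAC subrr add0r expr1n mulr1; apply: le_trans.
have g0 : g t0 = 0.
  by apply/normr0_eq0/eqP; rewrite eq_le normr_ge0 andbT (le_trans (h t0)) // subrr expr0n mulr0.
have L : h0^-1 *: (g (h0 *: 1 + t0) - g t0) @[h0 --> 0^'] --> (0 : R).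
  apply/cvgr0Pnorm_le => e e0.
  near=> u; rewrite g0 subr0 normrZ.
  have u0 : u != 0 by near: u; exact: nbhs_dnbhs_neq.
  have -> : u *: 1 + t0 = t0 + u by rewrite /GRing.scale /= mulr1 addrC.
  rewrite normfV ler_pdivrMl ?normr_gt0 //.
  apply: (le_trans (h _)); rewrite addrAC subrr add0r -(real_normK (num_real u)) expr2 mulrA mulrC.
  rewrite ler_wpM2l //; apply: (@le_trans _ _ (C * (e / (C + 1)))).
    by rewrite ler_wpM2l //; near: u; apply: dnbhs0_le; rewrite divr_gt0 // ltr_wpDl.
  by rewrite mulrA ler_pdivrMr ?ltr_wpDl //; nra.
by apply: DeriveDef; [apply/cvg_ex; exists 0 | apply/cvg_lim].
Unshelve. all: by end_near. Qed.

Lemma bumpf_is_derive P k t :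
  is_derive t 1 (bumpf P k) (bumpf (bump_next P k) k.+2 t).
Proof.
have [t01|t01] := boolP (0 < t < 1); first exact: bumpf_is_derive_in.
have [C C0 h] := bumpf_sq_bound P k t01.
by rewrite [X in is_derive _ _ _ X]/bumpf (negPf t01); apply: sq_bound_is_derive h.
Qed.

(** The successive derivatives are carried as a sequence, so that smoothness passes termwise to
    affine substitutions, differences and products over the coordinates. *)
Definition smooth1 (w : R -> R) := exists W : nat -> R -> R,
  W 0%N = w /\ forall m t, is_derive t 1 (W m) (W m.+1 t).

Fixpoint bump_seq (m : nat) : {poly R} * nat :=
  if m is m'.+1 then (bump_next (bump_seq m').1 (bump_seq m').2, (bump_seq m').2.+2) else (1, 0%N).

(** On [(0, 1)] this is [e^(-1 / (t (1 - t)))]. *)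
Definition bumpR : R -> R := bumpf 1 0.

Lemma smooth1_bump : smooth1 bumpR.
Proof.
exists (fun m => bumpf (bump_seq m).1 (bump_seq m).2); split => // m t.
exact: bumpf_is_derive.
Qed.

Lemma smooth1_deriv w w' : smooth1 w' -> (forall t, is_derive t 1 w (w' t)) -> smooth1 w.
Proof.
move=> [W [W0 dW]] dw; exists (fun m => if m is m'.+1 then W m' else w); split => // -[|m] t //.
by rewrite W0.
Qed.

Lemma smooth1_affine w (c a : R) : smooth1 w -> smooth1 (fun t => w (c * t - a)).
Proof.
move=> [W [W0 dW]]; exists (fun m t => c ^+ m * W m (c * t - a)); split.
  by apply/funext => t; rewrite W0 expr0 mul1r.
move=> m t.
have dl : is_derive t 1 (fun u : R => c * u - a) c.
  have -> : (fun u : R => c * u - a) = (c \*: id) - cst a.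
    by apply/funext => u; rewrite !fctE.
  by apply: is_derive_eq; rewrite subr0 /GRing.scale /= mulr1.
have dc := @is_derive1_comp R (W m) (fun u => c * u - a) t _ _ (dW _ _) dl.
have D := is_deriveZ (c ^+ m) dc.
have -> : (fun u => c ^+ m * W m (c * u - a)) = c ^+ m \*: (W m \o (fun u => c * u - a)).
  by apply/funext => u; rewrite !fctE.
by apply: (is_derive_eq D); rewrite /GRing.scale /= exprS; ring.
Qed.

Lemma smooth1B w v : smooth1 w -> smooth1 v -> smooth1 (fun t => w t - v t).
Proof.
move=> [W [W0 dW]] [V [V0 dV]]; exists (fun m => W m - V m); split.
  by rewrite W0 V0; apply/funext => t; rewrite !fctE.
move=> m t; apply: is_deriveB.
Qed.

Lemma smooth1_derivable w t : smooth1 w -> derivable w t 1.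
Proof. by move=> [W [<- dW]]; have [] := dW 0%N t. Qed.

Lemma smooth1_continuous w : smooth1 w -> continuous w.
Proof. by move=> sw t; apply/differentiable_continuous/derivable1_diffP/smooth1_derivable. Qed.

Lemma bump_ge0 t : 0 <= bumpR t.
Proof.
rewrite /bumpR /bumpf; case: ifP => // _.
by rewrite hornerC mul1r expr0 mul1r expR_ge0.
Qed.

Lemma bump_le1 t : bumpR t <= 1.
Proof.
rewrite /bumpR /bumpf; case: ifP => // t01.
rewrite hornerC mul1r expr0 mul1r -expR0 ler_expR oppr_le0 invr_ge0 ltW //.
exact: S_gt0.
Qed.

Lemma bump_out t : ~~ (0 < t < 1) -> bumpR t = 0.
Proof. by rewrite /bumpR /bumpf => /negPf ->. Qed.

(** On the middle half [t (1 - t) >= 3/16 > 1/8]. *)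
Lemma bump_mid t : 4^-1 <= t <= 3 / 4 -> expR (- 8) <= bumpR t.
Proof.
move=> /andP[t1 t2]; rewrite /bumpR /bumpf ifT; last by apply/andP; split; lra.
rewrite hornerC mul1r expr0 mul1r ler_expR lerN2 SE.
rewrite -[X in _ <= X]invrK lef_pV2 ?posrE //; last by nra.
by nra.
Qed.

Lemma bump_continuous : continuous bumpR.
Proof. exact: smooth1_continuous smooth1_bump. Qed.

Lemma bump_primitive : exists B : R -> R,
  forall t, is_derive t 1 B (bumpR t).
Proof.
pose mu := @lebesgue_measure R.
(* The base point [-1] lies strictly to the left of the support, so the fundamental theorem of
   calculus applies at [t = 0] as well. *)
pose B x : R := (\int[mu]_(t in `[(-1)%R, x]) bumpR t)%R.
exists B => t.
have [t0|t0] := ltP t 0.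
  rewrite bump_out; last by apply/negP => /andP[]; lra.
  have E : \forall u \near t, cst 0 u = B u.
    have : t \in `]-oo, 0[ by rewrite in_itv.
    move=> /near_in_itvNyo; apply: filterS => u; rewrite in_itv /= => u0.
    have -> : B u = (\int[mu]_(t in `[(-1)%R, u]) cst 0 t)%R.
      apply: eq_Rintegral => x; rewrite in_setE /= in_itv /= => /andP[_ xu]; apply: bump_out.
      by apply/negP => /andP[]; lra.
    by rewrite Rintegral_cst ?mul0r.
  apply: (near_eq_is_derive E).
have [||||d1 d2] := @continuous_FTC1 R bumpR (BLeft (-1)) t (t + 1).
- by rewrite ltrDl.
- apply: continuous_compact_integrable; first exact: segment_compact.
  exact: continuous_subspaceT bump_continuous.
- by rewrite /= ?lee_fin ?lte_fin; lra.
- exact: bump_continuous.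
exact: (DeriveDef d1 (etrans (esym (derive1E _ _)) d2)).
Qed.

(** The tent is [B t - B (t - 1)] for a primitive [B] of the bump. [B] is constant on either side of
    [[0, 1]], so this difference has compact support although [B] itself has not. The difference of
    two neighbouring bumps is thus the derivative of an admissible test function. *)
Lemma smooth1_tent : exists psi : R -> R,
  [/\ smooth1 psi, forall t, is_derive t 1 psi (bumpR t - bumpR (t - 1)),
     forall t, ~~ (0 < t < 2) -> psi t = 0 & forall t, `|psi t| <= 1].
Proof.
have [B dB] := bump_primitive.
have sB : smooth1 B by exact: smooth1_deriv smooth1_bump dB.
have cB := smooth1_continuous sB.
have mvt a b : a <= b -> exists2 c, a <= c <= b & B b - B a = bumpR c * (b - a).
  move=> ab; have [c] := @MVT_segment R B bumpR a b ab (fun x _ => dB x) (continuous_subspaceT cB).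
  by rewrite in_itv /= => cab e; exists c.
have B0 t : t <= 0 -> B t = B 0.
  move=> t0; have [c /andP[_ c0] e] := mvt t 0 t0; apply/eqP; rewrite eq_sym -subr_eq0 e bump_out ?mul0r //.
  by rewrite negb_and -!leNgt c0.
have B1 t : 1 <= t -> B t = B 1.
  move=> t1; have [c /andP[c1 _] e] := mvt 1 t t1; apply/eqP; rewrite -subr_eq0 e bump_out ?mul0r //.
  by rewrite negb_and -!leNgt c1 orbT.
exists (fun t => B t - B (t - 1)).
have sB1 : smooth1 (fun t => B (t - 1)).
  by have -> : (fun t => B (t - 1)) = (fun t => B (1 * t - 1)) by [apply/funext => t; rewrite mul1r];
     exact: smooth1_affine.
have dB1 t : is_derive t 1 (fun t => B (t - 1)) (bumpR (t - 1)).
  have dl : is_derive t 1 (fun u : R => u - 1) 1.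
    have -> : (fun u : R => u - 1) = id - cst 1 by apply/funext => u; rewrite !fctE.
    by apply: is_derive_eq; rewrite subr0.
  have := @is_derive1_comp R B (fun u => u - 1) t _ _ (dB _) dl.
  by rewrite mulr1.
split.
- exact: smooth1B.
- by move=> t; exact: is_deriveB.
- move=> t; rewrite negb_and -!leNgt => /orP[t0|t2].
    by rewrite B0 // (B0 (t - 1)) ?subrr //; lra.
  by rewrite B1 ?(B1 (t - 1)) ?subrr //; lra.
- move=> t; have t1 : t - 1 <= t by rewrite gerBl.
  have [c _ ->] := mvt _ _ t1.
  by rewrite subKr mulr1 ger0_norm ?bump_ge0 // bump_le1.
Qed.


End Bump.

Section TestFunctions.
Variable R : realType.

Lemma edist_ge (k : nat) (x y : k.-tuple R) i : `|tnth x i - tnth y i| <= edist x y.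
Proof.
rewrite -sqrtr_sqr ler_wsqrtr // (bigD1 i) //= lerDl sumr_ge0 // => j _.
exact: sqr_ge0.
Qed.

Lemma edist_le_l1 (k : nat) (x y : k.-tuple R) :
  edist x y <= \sum_(i < k) `|tnth x i - tnth y i|.
Proof.
have s0 : 0 <= \sum_(i < k) `|tnth x i - tnth y i| by rewrite sumr_ge0.
rewrite -(ger0_norm s0) -sqrtr_sqr ler_wsqrtr //.
elim: (index_enum _) s0 => [|i s IH] s0; first by rewrite !big_nil expr0n.
have t0 : 0 <= \sum_(i <- s) `|tnth x i - tnth y i| by rewrite sumr_ge0.
rewrite !big_cons [X in _ <= X]sqrrD real_normK ?num_real //.
have := IH t0; have : 0 <= `|tnth x i - tnth y i| * \sum_(i <- s) `|tnth x i - tnth y i| by rewrite mulr_ge0.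
lra.
Qed.

Lemma rcontinuousM (k : nat) (g h : k.-tuple R -> R) :
  rcontinuous g -> rcontinuous h -> rcontinuous (fun x => g x * h x).
Proof.
move=> cg ch x e e0.
pose M := `|g x| + `|h x| + 1.
have M0 : 0 < M by rewrite ltr_wpDl // addr_ge0.
pose d := Num.min 1 (e / 2 / M).
have d0 : 0 < d by rewrite lt_min ltr01 !divr_gt0.
have [a a0 ha] := cg x d d0; have [b b0 hb] := ch x d d0.
exists (Num.min a b); first by rewrite lt_min a0 b0.
move=> y; rewrite lt_min => /andP[/ha h1 /hb h2].
have -> : g y * h y - g x * h x = (g y - g x) * h y + g x * (h y - h x) by ring.
apply: (le_lt_trans (ler_normD _ _)); rewrite !normrM.
have d1 : d <= 1 by rewrite ge_min lexx.
have d2 : d <= e / 2 / M by rewrite ge_min lexx orbT.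
have hy : `|h y| <= `|h x| + 1.
  have := ler_normD (h y - h x) (h x); rewrite subrK.
  by move=> /le_trans; apply; rewrite addrC lerD2l (le_trans (ltW h2)).
have A : `|g y - g x| * `|h y| <= d * (`|h x| + 1) by rewrite ler_pM // ltW.
have B : `|g x| * `|h y - h x| <= `|g x| * d by rewrite ler_wpM2l // ltW.
have C : d * M <= e / 2 by rewrite -ler_pdivlMr.
have : d * (`|h x| + 1) + `|g x| * d <= e / 2 by apply: le_trans C; rewrite /M; lra.
by lra.
Qed.

Lemma rcontinuous_coord (k : nat) (i : 'I_k) (w : R -> R) :
  continuous w -> rcontinuous (fun x : k.-tuple R => w (tnth x i)).
Proof.
move=> cw x e e0.
have /cvgrPdist_lt /(_ e e0) := cw (tnth x i).
move=> /nbhs_ballP[d /= d0 h]; exists d => // y yx.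
rewrite distrC; apply: h; rewrite /ball /= distrC.
exact: le_lt_trans (edist_ge y x i) yx.
Qed.

Lemma rcontinuous_prod (k : nat) (w : 'I_k -> R -> R) : (forall i, continuous (w i)) ->
  rcontinuous (fun x : k.-tuple R => \prod_(i < k) w i (tnth x i)).
Proof.
move=> cw; have : rcontinuous (fun x : k.-tuple R => \prod_(i <- index_enum 'I_k) w i (tnth x i)).
  elim: (index_enum _) => [|i s IH].
    have -> : (fun x : k.-tuple R => \prod_(i <- [::]) w i (tnth x i)) = (fun=> 1).
      by apply/funext => x; rewrite big_nil.
    by move=> x e e0; exists 1 => // y _; rewrite subrr normr0.
  have -> : (fun x : k.-tuple R => \prod_(j <- i :: s) w j (tnth x j)) =
     (fun x => w i (tnth x i) * \prod_(j <- s) w j (tnth x j)).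
    by apply/funext => x; rewrite big_cons.
  by apply: rcontinuousM => //; exact: rcontinuous_coord.
by [].
Qed.

Lemma tnth_shift (k : nat) (x : k.-tuple R) (j i : 'I_k) t :
  tnth (shift x j t) i = tnth x i + (if i == j then t else 0).
Proof. by rewrite tnth_mktuple. Qed.

Lemma prod_shiftE (k : nat) (w : 'I_k -> R -> R) (x : k.-tuple R) (j : 'I_k) :
  (fun t => \prod_(i < k) w i (tnth (shift x j t) i)) =
  (\prod_(i < k | i != j) w i (tnth x i)) \*: (fun t => w j (t + tnth x j)).
Proof.
apply/funext => t; rewrite /= (bigD1 j) //= tnth_shift eqxx addrC mulrC; congr (_ * _).
  by apply: eq_bigr => i /negPf ij; rewrite tnth_shift ij addr0.
Qed.

Lemma is_derive_prod_shift (k : nat) (w : 'I_k -> R -> R) (x : k.-tuple R) (j : 'I_k) (d : R) :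
  is_derive (tnth x j) 1 (w j) d ->
  is_derive (0 : R) 1 (fun t : R => \prod_(i < k) w i (tnth (shift x j t) i))
    ((\prod_(i < k | i != j) w i (tnth x i)) * d).
Proof.
move=> dw; rewrite prod_shiftE.
have dl : is_derive (0 : R) 1 (fun u : R => u + tnth x j) 1.
  have -> : (fun u : R => u + tnth x j) = id + cst (tnth x j) by apply/funext => u; rewrite !fctE.
  by apply: is_derive_eq; rewrite addr0.
have dw' : is_derive ((0 : R) + tnth x j) 1 (w j) d by rewrite add0r.
have := @is_derive1_comp R (w j) (fun u => u + tnth x j) 0 _ _ dw' dl.
by rewrite mulr1 => D; exact: is_deriveZ.
Qed.

Lemma pderiv_prod (k : nat) (w : 'I_k -> R -> R) (j : 'I_k) (w' : R -> R) :
  (forall t : R, is_derive t 1 (w j) (w' t)) ->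
  pderiv j (fun x : k.-tuple R => \prod_(i < k) w i (tnth x i)) =
  (fun x => \prod_(i < k) (if i == j then w' else w i) (tnth x i)).
Proof.
move=> dw; apply/funext => x; rewrite /pderiv derive1E.
have D := @is_derive_prod_shift k w x j _ (dw _).
rewrite (@derive_val _ _ _ _ _ _ _ D) [RHS](bigD1 j) //= eqxx mulrC; congr (_ * _).
by apply: eq_bigr => i /negPf ->.
Qed.

(** The induction on [js] closes for products in which every coordinate has its own order of
    differentiation [nu i]: a partial derivative in direction [j] only raises [nu j]. *)
Lemma smooth_prod (k : nat) (w : 'I_k -> R -> R) : (forall i, smooth1 (w i)) ->
  smooth (fun x : k.-tuple R => \prod_(i < k) w i (tnth x i)).
Proof.
move=> /choice[W hW] js.
have W0 i : W i 0%N = w i by have [] := hW i.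
have dW i m (t : R) : is_derive t 1 (W i m) (W i m.+1 t) by have [_] := hW i; exact.
suff H (nu : 'I_k -> nat) : Cjs js (fun x : k.-tuple R => \prod_(i < k) W i (nu i) (tnth x i)).
  have := H (fun=> 0%N); congr (Cjs js); apply/funext => x.
  by apply: eq_bigr => i _; rewrite W0.
elim: js nu => [|j js IH] nu /=.
  apply: (@rcontinuous_prod k (fun i => W i (nu i))) => i t.
  by apply/differentiable_continuous/derivable1_diffP; have [] := dW i (nu i) t.
split.
  by move=> x; have [] := @is_derive_prod_shift k (fun i => W i (nu i)) x j _ (dW _ _ _).
rewrite (@pderiv_prod k (fun i => W i (nu i)) j (W j (nu j).+1)) //.
have := IH (fun i => if i == j then (nu i).+1 else nu i).
congr (Cjs js); apply/funext => x; apply: eq_bigr => i _.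
by case: eqVneq => // ->.
Qed.

End TestFunctions.

(** * Dyadic cells *)

Section DensityMeasure.
Local Open Scope ereal_scope.
Context d (T : measurableType d) (R : realType).
Variables (mu : {measure set T -> \bar R}) (g : T -> \bar R).
Hypotheses (mg : measurable_fun [set: T] g) (g0 : forall x, 0 <= g x).

(** The hypotheses on [g] are arguments, so that the measure structure can be attached to the term
    itself. *)
Definition dens of measurable_fun [set: T] g & (forall x, 0 <= g x) : set T -> \bar R :=
  fun A => \int[mu]_(x in A) g x.

Let dens0 : dens mg g0 set0 = 0.
Proof. exact: integral_set0. Qed.

Let dens_ge0 A : 0 <= dens mg g0 A.
Proof. by apply: integral_ge0 => x _; exact: g0. Qed.

Let dens_sigma_additive : semi_sigma_additive (dens mg g0).
Proof.
move=> F mF tF mUF; rewrite /dens ge0_integral_bigcup //; last first.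
  exact: measurable_funS mg.
by apply: is_cvg_ereal_nneg_natsum_cond => m _ _; apply: integral_ge0.
Qed.

HB.instance Definition _ := isMeasure.Build _ _ _ (dens mg g0)
  dens0 dens_ge0 dens_sigma_additive.

End DensityMeasure.

Section Dyadic.
Variables (R : realType) (n : nat).
Local Notation T := (n.-tuple R).
Local Notation Z := {ffun 'I_n -> int}.
Implicit Types (c : Z) (x y : T).

(* The cell of lower corner [c / 2^M] and side [2^s / 2^M], open below and closed
   above as the boxes of [lebesgue_on_boxes]. *)
Definition box (M : nat) (c : Z) (s : nat) : set T :=
  [set x | forall i, (c i)%:~R < 2 ^+ M * tnth x i <= (c i)%:~R + 2 ^+ s].

(** A point on a dyadic hyperplane belongs to the cell below it: hence a ceiling minus one, not a
    floor. *)
Definition idx (M : nat) (x : T) : Z := [ffun i => Num.ceil (2 ^+ M * tnth x i) - 1].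

Definition dcube (k : nat) (x : T) : set T := box k (idx k x) 0.

(** The box of side [2^(s+1)] with corner [c] splits into [2^n] boxes of side [2^s]; [sg] tells in
    which directions the upper half is taken. *)
Definition cell_add (c : Z) (s : nat) (sg : {ffun 'I_n -> bool}) : Z :=
  [ffun i => c i + (if sg i then (2 ^ s)%N%:Z else 0)].

Lemma box_idx M x c : box M c 0 x <-> idx M x = c.
Proof.
split=> [h|<- i].
  apply/ffunP => i; rewrite ffunE; apply/eqP; rewrite subr_eq; apply/eqP.
  apply: ceil_def; have := h i; rewrite expr0 addrK intrD mulr1z.
  by [].
rewrite ffunE expr0 intrB mulr1z subrK.
have /andP[h1 h2] := ceil_itv (2 ^+ M * tnth x i).
by rewrite h2 andbT; move: h1; rewrite intrB mulr1z.
Qed.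

Lemma dcube_refl k x : dcube k x x.
Proof. exact/box_idx. Qed.

Lemma dcube_idx k x y : dcube k x y <-> idx k y = idx k x.
Proof. exact: box_idx. Qed.

Lemma measurable_box M c s : measurable (box M c s).
Proof.
have -> : box M c s = \bigcap_(i in [set: 'I_n])
   ((fun x : T => tnth x i) @^-1` `](c i)%:~R / 2 ^+ M, ((c i)%:~R + 2 ^+ s) / 2 ^+ M]%classic).
  apply/seteqP; split => x h i; have := h i.
    move=> /[swap] _; rewrite /= in_itv /= ltr_pdivrMr ?exprn_gt0 // ler_pdivlMr ?exprn_gt0 //.
    by rewrite mulrC.
  move=> /(_ I); rewrite /= in_itv /= ltr_pdivrMr ?exprn_gt0 // ler_pdivlMr ?exprn_gt0 //.
  by rewrite mulrC.
apply: fin_bigcap_measurable; first exact: finite_finset.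
move=> i _; rewrite -[X in measurable X]setTI; exact: measurable_tnth.
Qed.

Lemma box_refine M c s : box M c s = box M.+1 [ffun i => 2 * c i] s.+1.
Proof.
have E i x : ((c i)%:~R < 2 ^+ M * tnth x i <= (c i)%:~R + 2 ^+ s) =
   ((([ffun i => 2 * c i] : Z) i)%:~R < 2 ^+ M.+1 * tnth x i <=
     (([ffun i => 2 * c i] : Z) i)%:~R + 2 ^+ s.+1).
  rewrite ffunE intrM !exprS -!mulrA -mulrDr ltr_pM2l ?ltr0n // ler_pM2l ?ltr0n //.
by apply/seteqP; split => x h i; have := h i; rewrite E.
Qed.

Lemma box_refineD M c s j : box M c s = box (M + j) [ffun i => (2 ^ j)%N%:Z * c i] (s + j).
Proof.
elim: j => [|j IH].
  rewrite !addn0; congr (box M _ s); apply/ffunP => i; rewrite ffunE expn0 mul1r //.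
rewrite IH box_refine !addnS; congr box; apply/ffunP => i; rewrite !ffunE expnS PoszM mulrA //.
Qed.

Lemma cell_add_box_sub M c s sg : box M (cell_add c s sg) s `<=` box M c s.+1.
Proof.
move=> x h i; have := h i; rewrite ffunE exprS.
have p0 : 0 < 2 ^+ s :> R by rewrite exprn_gt0.
case: (sg i); last by rewrite addr0 => /andP[-> h2] /=; apply: (le_trans h2); lra.
rewrite intrD -pmulrn natrX => /andP[h1 h2]; apply/andP; split; lra.
Qed.

Lemma box_split M c s : box M c s.+1 = \bigcup_(sg in [set: {ffun 'I_n -> bool}]) box M (cell_add c s sg) s.
Proof.
apply/seteqP; split; last by move=> x [sg _]; exact: cell_add_box_sub.
move=> x h; exists [ffun i => (c i)%:~R + 2 ^+ s < 2 ^+ M * tnth x i] => // i.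
have := h i; rewrite !ffunE exprS => /andP[h1 h2].
case: ifP => h3; last by rewrite addr0 h1 /= leNgt h3.
by rewrite intrD -pmulrn natrX h3 /=; apply: (le_trans h2); lra.
Qed.

Lemma trivIset_box_split M c s : trivIset [set: {ffun 'I_n -> bool}] (fun sg => box M (cell_add c s sg) s).
Proof.
move=> sg tg _ _ [x [h1 h2]]; apply/ffunP => i.
have := h1 i; have := h2 i; rewrite !ffunE.
have p0 : 0 < 2 ^+ s :> R by rewrite exprn_gt0.
case: (sg i); case: (tg i) => //; rewrite ?addr0 intrD -pmulrn natrX => /andP[a b] /andP[a' b']; lra.
Qed.

Lemma measure_box_split (nu : {measure set T -> \bar R}) M c s :
  (nu (box M c s.+1) = \sum_(sg : {ffun 'I_n -> bool}) nu (box M (cell_add c s sg) s))%E.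
Proof.
rewrite box_split measure_fin_bigcup //; first last.
- by move=> i _; exact: measurable_box.
- exact: trivIset_box_split.
- exact: finite_finset.
rewrite (fsbigTE [fset x | x in {: {ffun 'I_n -> bool}}]%fset); last first.
  by move=> i; rewrite !inE.
by rewrite big_imfset //= big_enum.
Qed.

Lemma idx_next k x : exists sg, idx k.+1 x = cell_add [ffun i => 2 * idx k x i] 0 sg.
Proof.
have := dcube_refl k x; rewrite /dcube box_refine box_split => -[sg _].
by move=> /box_idx ->; exists sg.
Qed.

Lemma dcube_succ k x : dcube k.+1 x `<=` dcube k x.
Proof.
have [sg e] := idx_next k x; rewrite /dcube e [X in _ `<=` X]box_refine; exact: cell_add_box_sub.
Qed.

Lemma dcube_mono k l x : (k <= l)%N -> dcube l x `<=` dcube k x.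
Proof.
elim: l => [|l IH]; first by rewrite leqn0 => /eqP ->.
rewrite leq_eqVlt => /orP[/eqP -> //|kl]; apply: subset_trans (IH kl).
exact: dcube_succ.
Qed.

Lemma dcube_eq k x y : dcube k x y -> dcube k y = dcube k x.
Proof. by rewrite /dcube => /dcube_idx ->. Qed.

Lemma box_close M c s x y i : box M c s x -> box M c s y ->
  `|tnth x i - tnth y i| <= 2 ^+ s / 2 ^+ M.
Proof.
move=> /(_ i) /andP[x1 x2] /(_ i) /andP[y1 y2].
have p0 : 0 < 2 ^+ M :> R by rewrite exprn_gt0.
rewrite ler_pdivlMr // -[X in _ * X](ger0_norm (ltW p0)) -normrM ler_norml.
by rewrite mulrC mulrBr; apply/andP; split; lra.
Qed.

Lemma dcube_edist k x y z : dcube k x y -> dcube k x z -> edist y z <= n%:R / 2 ^+ k.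
Proof.
move=> hy hz; apply: (le_trans (edist_le_l1 y z)).
apply: (@le_trans _ _ (\sum_(i < n) (2 ^+ k)^-1)); last first.
  by rewrite sumr_const card_ord -[X in X <= _]mulr_natl.
by apply: ler_sum => i _; have := box_close i hy hz; rewrite expr0 mul1r.
Qed.

(* Cells being countable, these sets are measurable even if U is not Euclidean-open. *)
Definition dopen (U : set T) := forall x, U x -> exists k, dcube k x `<=` U.

Lemma dopenT : dopen setT.
Proof. by move=> x _; exists 0%N. Qed.

Lemma dopenI U V : dopen U -> dopen V -> dopen (U `&` V).
Proof.
move=> oU oV x [/oU[k hk] /oV[l hl]]; exists (maxn k l); rewrite subsetI; split.
  by apply: subset_trans hk; apply: dcube_mono; exact: leq_maxl.
by apply: subset_trans hl; apply: dcube_mono; exact: leq_maxr.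
Qed.

Lemma dopen_bigcup (I : Type) (P : set I) (F : I -> set T) :
  (forall i, P i -> dopen (F i)) -> dopen (\bigcup_(i in P) F i).
Proof.
move=> oF x [i Pi /(oF i Pi)[k hk]]; exists k => y /hk; by exists i.
Qed.

Lemma dopen_at (U : set T) x k0 : dopen U -> U x ->
  exists k, (k0 <= k)%N /\ dcube k x `<=` U.
Proof.
move=> oU /oU[k hk]; exists (maxn k0 k); split; first exact: leq_maxl.
by apply: subset_trans hk; apply: dcube_mono; exact: leq_maxr.
Qed.

Lemma pow2_small (e : R) : 0 < e -> exists k0 : nat, forall k, (k0 <= k)%N -> (2 ^+ k)^-1 < e.
Proof.
move=> e0; exists (Num.truncn e^-1).+1 => k hk.
rewrite invf_plt ?posrE ?exprn_gt0 //.
apply: (@lt_le_trans _ _ k%:R).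
  by apply: (lt_le_trans (truncnS_gt _)); rewrite ler_nat.
by rewrite -natrX ler_nat ltnW // ltn_expl.
Qed.

Lemma dcube_small (e : R) : 0 < e -> exists k0, forall k x y, (k0 <= k)%N ->
  dcube k x y -> edist y x < e.
Proof.
move=> e0; have [k0 hk0] := pow2_small (divr_gt0 e0 (ltr0Sn R n)).
exists k0 => k x y kk xy.
apply: (le_lt_trans (dcube_edist xy (dcube_refl k x))).
have := hk0 k kk; rewrite ltr_pdivlMr ?ltr0n // mulrC; apply: le_lt_trans.
by rewrite ler_wpM2r ?invr_ge0 ?exprn_ge0 // ler_nat.
Qed.

Lemma is_open_dopen (U : set T) : is_open U -> dopen U.
Proof.
move=> oU x /oU[r r0 h]; have [k0 hk] := dcube_small r0.
by exists k0 => y xy; apply: h; exact: hk xy.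
Qed.

Lemma dopen_measurable (U : set T) : dopen U -> measurable U.
Proof.
move=> oU; have -> : U = \bigcup_(p in [set p : nat * Z | box p.1 p.2 0 `<=` U]) box p.1 p.2 0.
  apply/seteqP; split; last by move=> x [p hp] /hp.
  by move=> x /oU[k hk]; exists (k, idx k x) => //; exact: dcube_refl.
rewrite bigcup_mkcond; apply: countable_bigcupT_measurable => // p.
by case: ifP => // _; exact: measurable_box.
Qed.

Lemma dopen_coord_gt i (a : R) : dopen [set x | a < tnth x i].
Proof.
apply: is_open_dopen => x /= xa; exists (tnth x i - a); first by rewrite subr_gt0.
move=> y yx; have := le_lt_trans (edist_ge y x i) yx.
by rewrite ltr_norml => /andP[]; lra.
Qed.

Lemma dopen_coord_lt i (a : R) : dopen [set x | tnth x i < a].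
Proof.
apply: is_open_dopen => x /= xa; exists (a - tnth x i); first by rewrite subr_gt0.
move=> y yx; have := le_lt_trans (edist_ge y x i) yx.
by rewrite ltr_norml => /andP[]; lra.
Qed.

(** * Regularity of finite measures *)

Section Regular.
Variable (nu : {measure set T -> \bar R}).
Hypothesis nu_fin : (nu setT < +oo)%E.

(** [A] lies between the complement of [V] and [U]. With two open sets the property is symmetric
    under complement, which eases the proof that such sets form a sigma-algebra. *)
Definition dregular (A : set T) := forall e : R, 0 < e ->
  exists U V, [/\ dopen U, dopen V, A `<=` U, ~` A `<=` V & (nu (U `&` V) <= e%:E)%E].

Let nu_lt A : measurable A -> (nu A < +oo)%E.
Proof. move=> mA; apply: le_lt_trans nu_fin.
by apply: le_measure; [exact/mem_set | exact/mem_set/measurableT | ]. Qed.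

Lemma decreasing_small (F : nat -> set T) (e : R) : (forall k, measurable (F k)) ->
  nonincreasing_seq F -> (nu (\bigcap_k F k) < e%:E)%E -> exists m, (nu (F m) <= e%:E)%E.
Proof.
move=> mF dF h.
have C : nu \o F @ \oo --> nu (\bigcap_k F k).
  apply: nonincreasing_cvg_mu => //; first exact: nu_lt.
  exact: bigcapT_measurable.
apply: contrapT => /forallNP H.
have : (e%:E <= nu (\bigcap_k F k))%E.
  rewrite -(cvg_lim _ C) //; apply: lime_ge; first by apply/cvg_ex; eexists; exact: C.
  by apply: nearW => m /=; rewrite ltW // ltNge; apply/negP/H.
by rewrite leNgt h.
Qed.

Lemma dregular_gt i (a : R) : dregular [set x | a < tnth x i].
Proof.
move=> e e0; pose V (m : nat) := [set x : T | tnth x i < a + m.+1%:R^-1].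
have oV m : dopen (V m) by exact: dopen_coord_lt.
pose U := [set x : T | a < tnth x i].
have oU : dopen U by exact: dopen_coord_gt.
have [m hm] : exists m, (nu (U `&` V m) <= e%:E)%E.
  apply: decreasing_small => [k|k l kl|].
  - by apply: measurableI; exact: dopen_measurable.
  - apply/subsetPset => x [Ux Vx]; split => //; move: Vx; rewrite /V /= => /lt_le_trans; apply.
    by rewrite lerD2l lef_pV2 ?posrE ?ltr0n // ler_nat.
  - rewrite (_ : \bigcap_k _ = set0) ?measure0 ?lte_fin // -subset0 => x h.
    have [Ux _] := h 0%N I; rewrite /U /= -subr_gt0 in Ux.
    have [k hk] := pow2_small Ux; have := hk k (leqnn k).
    have [_] := h (2 ^ k).-1 I; rewrite /V /= prednK ?expn_gt0 // natrX; lra.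
exists U, (V m); split => // x /negP; rewrite -leNgt => h.
by rewrite /V /=; apply: (le_lt_trans h); rewrite ltrDl invr_gt0.
Qed.

Lemma dregularC A : dregular A -> dregular (~` A).
Proof.
by move=> h e /h[U [V [oU oV AU AV l]]]; exists V, U; rewrite setCK setIC.
Qed.

(** An infinite intersection of the [V k] need not be open, so the complement is covered by a finite
    one, [W m]. As [m] grows the overlaps decrease to a set contained in the union of the [U k] meet
    [V k], of mass at most [e / 2]; continuity from above then gives a finite [m] with overlap at
    most [e]. *)
Lemma dregular_bigcup (F : nat -> set T) : (forall k, dregular (F k)) -> dregular (\bigcup_k F k).
Proof.
move=> h e e0.
have e2 : 0 < e / 2 by rewrite divr_gt0.
have e3 k : 0 < e / 2 / 2 / (2 ^ k.+1)%:R :> R by rewrite !divr_gt0 // ltr0n expn_gt0.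
have /choice[U /choice[V hUV]] : forall k, exists U, exists V,
   [/\ dopen U, dopen V, F k `<=` U, ~` F k `<=` V & (nu (U `&` V) <= (e / 2 / 2 / (2 ^ k.+1)%:R)%:E)%E].
  by move=> k; exact: h.
have oU k : dopen (U k) by have [] := hUV k.
have oV k : dopen (V k) by have [] := hUV k.
pose W m := \bigcap_(k < m) V k.
have oW m : dopen (W m).
  rewrite /W; elim: m => [|m IH]; first by rewrite bigcap_mkord big_ord0; exact: dopenT.
  by rewrite bigcap_mkord big_ord_recr /= -bigcap_mkord; exact: dopenI.
have oUU : dopen (\bigcup_k U k) by apply: dopen_bigcup.
have mU k := dopen_measurable (oU k).
have mV k := dopen_measurable (oV k).
have [m hm] : exists m, (nu ((\bigcup_k U k) `&` W m) <= e%:E)%E.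
  apply: decreasing_small => [k|k l kl|].
  - by apply: measurableI; exact: dopen_measurable.
  - apply/subsetPset => x [Ux Wx]; split => // i /= il; apply: Wx => /=; exact: leq_trans kl.
  - apply: (@le_lt_trans _ _ (e / 2)%:E); last by rewrite lte_fin; lra.
    apply: (@le_trans _ _ (\sum_(k <oo) nu (U k `&` V k))%E).
      apply: measure_sigma_subadditive => //.
      + by move=> k; apply: measurableI.
      + by apply: bigcapT_measurable => k; apply: measurableI; exact: dopen_measurable.
      + move=> x hx; have [[k _ Uk] _] := hx 0%N I; exists k => //; split => //.
        by have [_ /(_ k)] := hx k.+1 I; apply => /=.
    apply: (@le_trans _ _ (\sum_(k <oo) (e / 2 / 2 / (2 ^ k.+1)%:R)%:E)%E).
      by apply: lee_nneseries => // k _; have [] := hUV k.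
    apply: (le_trans (epsilon_trick0 xpredT _)); first by rewrite !divr_ge0 ?ltW.
    by rewrite lee_fin; lra.
exists (\bigcup_k U k), (W m); split => //.
- by move=> x [k _ Fk]; exists k => //; have [_ _ + _ _] := hUV k; apply.
- move=> x h1 k /= km; have [_ _ _ + _] := hUV k; apply => Fk; by apply: h1; exists k.
Qed.

Lemma dregular_measurable A : measurable A -> dregular A.
Proof.
have s0 : dregular set0.
  by move=> e e0; exists set0, setT; split => //; [exact: dopenT | rewrite set0I measure0 lee_fin ltW].
have sigma : sigma_algebra setT dregular.
  by split => //; [move=> B /dregularC; rewrite setTD | exact: dregular_bigcup].
apply: (smallest_sub sigma) => B; rewrite -bigcup_seq => -[i _ [C mC <-]].
rewrite setTI.
have mC' : (@RGenOInfty.G R).-sigma.-measurable C by rewrite -RGenOInfty.measurableE.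
pose P C := dregular ((fun x : T => tnth x i) @^-1` C).
have sigmaP : sigma_algebra setT P.
  split; rewrite /P.
  - by rewrite preimage_set0.
  - by move=> B' /dregularC; rewrite setTD preimage_setC.
  - by move=> F hF; rewrite preimage_bigcup; exact: dregular_bigcup.
apply: (smallest_sub sigmaP _ mC') => _ [a ->]; rewrite /P.
have := @dregular_gt i a; congr dregular; apply/seteqP; split => x /=; rewrite in_itv /= andbT //.
Qed.

End Regular.

Section Volume.
Variable (mu : {measure set T -> \bar R}).
Hypothesis Hmu : lebesgue_on_boxes mu.

Lemma mu_box M c s : mu (box M c s) = ((2 ^+ s / 2 ^+ M) ^+ n)%:E.
Proof.
pose a : T := [tuple (c i)%:~R / 2 ^+ M | i < n].
pose b : T := [tuple ((c i)%:~R + 2 ^+ s) / 2 ^+ M | i < n].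
have -> : box M c s = [set x | forall i, tnth a i < tnth x i <= tnth b i].
  apply/seteqP; split => x h i; have := h i; rewrite !tnth_mktuple ltr_pdivrMr ?exprn_gt0 //
    ler_pdivlMr ?exprn_gt0 // mulrC //.
rewrite Hmu; congr (_%:E).
rewrite -[in RHS](card_ord n) -prodr_const; apply: eq_bigr => i _.
rewrite !tnth_mktuple -mulrBl addrAC subrr add0r; apply/max_idPl.
by rewrite divr_ge0 // exprn_ge0.
Qed.

Lemma mu_dcube k x : mu (dcube k x) = ((2 ^+ k) ^- n)%:E.
Proof. by rewrite /dcube mu_box expr0 div1r exprVn. Qed.

End Volume.

End Dyadic.

(** * Averages against bumps *)

Section Translation.
Local Open Scope ereal_scope.
Variables (R : realType) (n : nat).
Local Notation T := (n.-tuple R).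
Local Notation Z := {ffun 'I_n -> int}.
Variable mu : {measure set T -> \bar R}.

Definition tau (a : T) (x : T) : T := [tuple tnth x i + tnth a i | i < n]%R.

Lemma measurable_tau a : measurable_fun [set: T] (tau a).
Proof.
apply/measurable_fun_tnthP => i.
have -> : (fun x => tnth x i) \o tau a = (fun x : T => (tnth x i + tnth a i)%R).
  by apply/funext => x /=; rewrite tnth_mktuple.
by apply: measurable_funD => //; exact: measurable_tnth.
Qed.

Definition translated (a : T) : set T -> \bar R := fun A => mu (tau a @^-1` A).

Let mpre a A : measurable A -> measurable (tau a @^-1` A).
Proof. by move=> mA; rewrite -[X in measurable X]setTI; exact: measurable_tau. Qed.

Section inst.
Variable a : T.

Let translated0 : translated a set0 = 0.
Proof. by rewrite /translated preimage_set0 measure0. Qed.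

Let translated_ge0 A : 0 <= translated a A.
Proof. exact: measure_ge0. Qed.

Let translated_sigma_additive : semi_sigma_additive (translated a).
Proof.
move=> F mF tF mUF; rewrite /translated preimage_bigcup.
apply: measure_semi_sigma_additive.
- by move=> k; exact: mpre.
- apply/trivIsetP => /= i j _ _ ij; rewrite -preimage_setI.
  by move/trivIsetP : tF => /(_ _ _ _ _ ij) ->//; rewrite preimage_set0.
- by rewrite -preimage_bigcup; exact: mpre.
Qed.

HB.instance Definition _ := isMeasure.Build _ _ _ (translated a)
  translated0 translated_ge0 translated_sigma_additive.
End inst.

Hypothesis Hmu : lebesgue_on_boxes mu.

Lemma translated_box a M c s : translated a (box M c s) = mu (box M c s).
Proof.
pose u : T := [tuple (c i)%:~R / 2 ^+ M - tnth a i | i < n]%R.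
pose v : T := [tuple ((c i)%:~R + 2 ^+ s) / 2 ^+ M - tnth a i | i < n]%R.
rewrite /translated.
have -> : tau a @^-1` box M c s = [set x | forall i, (tnth u i < tnth x i <= tnth v i)%R].
  apply/seteqP; split => x h i; have := h i; rewrite !tnth_mktuple.
    rewrite ltrBlDr lerBrDr ltr_pdivrMr ?exprn_gt0 // ler_pdivlMr ?exprn_gt0 // mulrC //.
  by rewrite ltrBlDr lerBrDr ltr_pdivrMr ?exprn_gt0 // ler_pdivlMr ?exprn_gt0 // mulrC.
rewrite Hmu mu_box //; congr (_%:E).
rewrite -[in RHS](card_ord n) -prodr_const; apply: eq_bigr => i _.
rewrite !tnth_mktuple opprD addrACA opprK addNr addr0 -mulrBl addrAC subrr add0r; apply/max_idPl.
by rewrite divr_ge0 // exprn_ge0.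
Qed.

Definition cells : set (set T) := [set A | A = set0 \/ exists M c, A = box M c 0].

Lemma setI_closed_cells : setI_closed cells.
Proof.
move=> A B [->|[M [c ->]]]; first by rewrite set0I; left.
move=> [->|[L [e ->]]]; first by rewrite setI0; left.
have [[x [h1 h2]]|h] := pselect (exists x : T, box M c 0 x /\ box L e 0 x); last first.
  by left; apply/seteqP; split => // x [hx1 hx2]; apply: h; exists x.
have E1 : box M c 0 = dcube M x by move/box_idx : h1 => <-.
have E2 : box L e 0 = dcube L x by move/box_idx : h2 => <-.
right; have [ML|LM] := leqP M L.
  exists L, e; rewrite E1 E2; apply/setIidPr; exact: dcube_mono.
exists M, c; rewrite E1 E2; apply/setIidPl; apply: dcube_mono; exact: ltnW.
Qed.

(** Half-spaces are dyadically open, hence countable unions of cells, and they generate the product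
    sigma-algebra. *)
Lemma measurable_cells : @measurable _ T = <<s cells >>.
Proof.
apply/seteqP; split; last first.
  apply: smallest_sub; first exact: sigma_algebra_measurable.
  by move=> A [->//|[M [c ->]]]; exact: measurable_box.
have sc : sigma_algebra setT (<<s cells >>) by exact: smallest_sigma_algebra.
have dop U : dopen U -> <<s cells >> U.
  move=> oU; pose F (k : nat) : set T := if @choice.unpickle (nat * Z)%type k is Some p then
     (if `[< box p.1 p.2 0 `<=` U >] then box p.1 p.2 0 else set0) else set0.
  have -> : U = \bigcup_k F k.
    apply/seteqP; split => [x Ux|x [k _]]; last first.
      by rewrite /F; case: choice.unpickle => // p; case: ifPn => // /asboolP h /h.
    have [k hk] := oU x Ux; exists (choice.pickle (k, idx k x)) => //.
    rewrite /F choice.pickleK; case: ifPn => [_|/asboolP]; last by [].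
    exact: dcube_refl.
  have [_ _ h] := sc; apply: h => k; rewrite /F.
  case: choice.unpickle => [p|]; last by apply: sub_sigma_algebra; left.
  case: ifPn => _; apply: sub_sigma_algebra; [right; by exists p.1, p.2 | by left].
move=> A mA; apply: (smallest_sub sc _ mA) => B; rewrite -bigcup_seq => -[i _ [C mC <-]].
rewrite setTI.
have mC' : (@RGenOInfty.G R).-sigma.-measurable C by rewrite -RGenOInfty.measurableE.
pose P C := <<s cells >> ((fun x : T => tnth x i) @^-1` C).
have sigmaP : sigma_algebra setT P.
  have [s0 sC sU] := sc; split; rewrite /P.
  - by rewrite preimage_set0.
  - by move=> B' /sC; rewrite !setTD preimage_setC.
  - by move=> F hF; rewrite preimage_bigcup; exact: sU.
apply: (smallest_sub sigmaP _ mC') => _ [r ->]; rewrite /P.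
have := dop _ (@dopen_coord_gt R n i r); congr (<<s cells >> _); apply/seteqP; split => x /=; rewrite in_itv /= andbT //.
Qed.

(** All that is known of [mu] is its value on boxes. Both measures agree on the cells, which are
    stable under intersection (two cells are nested or disjoint) and of which countably many, of
    finite measure, cover the space. *)
Lemma translatedE a A : measurable A -> translated a A = mu A.
Proof.
pose F (k : nat) : set T := if @choice.unpickle Z k is Some c then box 0 c 0 else set0.
apply: (measure_unique cells F).
- exact: measurable_cells.
- exact: setI_closed_cells.
- by move=> k; rewrite /F; case: choice.unpickle => [c|]; [right; exists 0%N, c | left].
- apply/seteqP; split => // x _; exists (choice.pickle (idx 0 x)) => //.
  by rewrite /F choice.pickleK; exact: dcube_refl.
- by move=> B [->|[M [c ->]]]; [rewrite !measure0 | exact: translated_box].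
- move=> k; rewrite /F; case: choice.unpickle => [c|]; last by rewrite measure0.
  by rewrite /= translated_box mu_box // ltry.
Qed.

Lemma integral_translate a (g : T -> \bar R) : measurable_fun setT g ->
  (forall x, 0 <= g x) -> \int[mu]_x g (tau a x) = \int[mu]_x g x.
Proof.
move=> mg g0.
have := @ge0_integral_pushforward _ _ T T R _ (measurable_tau a) mu setT g measurableT mg (fun y _ => g0 y).
rewrite preimage_setT => <-.
apply: (@eq_measure_integral _ T R setT mu (translated a : {measure set T -> \bar R})) => A mA _.
exact: translatedE.
Qed.

End Translation.

Section BumpAverage.
Variables (R : realType) (n : nat).
Local Notation T := (n.-tuple R).
Local Notation Z := {ffun 'I_n -> int}.
Implicit Types (c : Z) (x : T).
Variable mu : {measure set T -> \bar R}.
Hypothesis Hmu : lebesgue_on_boxes mu.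

Definition bumpn (M : nat) (c : Z) (x : T) : R :=
  \prod_(i < n) bumpR (2 ^+ M * tnth x i - (c i)%:~R).

Lemma bumpn_ge0 M c x : 0 <= bumpn M c x.
Proof. by apply: prodr_ge0 => i _; exact: bump_ge0. Qed.

Lemma bumpn_le1 M c x : bumpn M c x <= 1.
Proof.
apply: (@le_trans _ _ (\prod_(i < n) (1 : R))); last by rewrite big1.
by apply: ler_prod => i _; rewrite bump_ge0 bump_le1.
Qed.

Lemma bumpn_out M c x : ~ box M c 0 x -> bumpn M c x = 0.
Proof.
move=> /existsNP[i h]; rewrite /bumpn (bigD1 i) //= bump_out ?mul0r //.
apply/negP => /andP[h1 h2]; apply: h; rewrite expr0; apply/andP; split; lra.
Qed.

Lemma measurable_bumpn M c : measurable_fun [set: T] (bumpn M c).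
Proof.
apply: measurable_prod => i _; apply: (measurableT_comp (f := @bumpR R)).
  exact: continuous_measurable_fun (@bump_continuous R).
apply: measurable_funB => //; apply: measurable_funM => //; exact: measurable_tnth.
Qed.

(** The mass of a bump of level [M]; by translation invariance it is the same for every cell. *)
Definition omega (M : nat) : R := (\int[mu]_x bumpn M [ffun=> 0] x)%R.

Lemma integral_bumpn_ge M c :
  (((expR (- 8) / 2) ^+ n * (2 ^+ M) ^- n)%:E <= \int[mu]_x (bumpn M c x)%:E)%E.
Proof.
(* The concentric cube of half the side, in quarter-cell units: there every coordinate falls in the
   middle half of the bump. *)
pose B : set T := box (M + 2) [ffun i => 4 * c i + 1] 1.
have mB : measurable B by exact: measurable_box.
apply: (@le_trans _ _ (\int[mu]_(x in B) (expR (- 8) ^+ n)%:E)%E).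
  rewrite integral_cst // /B mu_box // -EFinM lee_fin.
  have -> : 2 ^+ 1 / 2 ^+ (M + 2) = 2^-1 * (2 ^+ M)^-1 :> R.
    by rewrite expr1 exprD; field; rewrite expf_neq0.
  by rewrite !exprMn !exprVn mulrA.
apply: (@le_trans _ _ (\int[mu]_(x in B) (bumpn M c x)%:E)%E).
  apply: ge0_le_integral => //.
  - by apply/measurable_EFinP; apply: measurable_funS (measurable_bumpn M c).
  move=> x Bx; rewrite lee_fin /bumpn -[in X in X <= _](card_ord n) -prodr_const.
  apply: ler_prod => i _; rewrite expR_ge0 /=; apply: bump_mid.
  have := Bx i; rewrite ffunE exprD expr1 intrD intrM.
  by move=> /andP[h1 h2]; apply/andP; split; lra.
apply: ge0_subset_integral => //.
- by apply/measurable_EFinP; exact: measurable_bumpn.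
- by move=> x _; rewrite lee_fin bumpn_ge0.
Qed.

Lemma integrable_bumpn M c : mu.-integrable setT (EFin \o bumpn M c).
Proof.
apply/integrableP; split; first by apply/measurable_EFinP; exact: measurable_bumpn.
apply: (@le_lt_trans _ _ (\int[mu]_x (\1_(box M c 0) x)%:E)%E).
  apply: ge0_le_integral => //.
  - by apply: measurableT_comp => //; by apply/measurable_EFinP; exact: measurable_bumpn.
  - by apply/measurable_EFinP; apply: measurable_indic; exact: measurable_box.
  move=> x _ /=; rewrite lee_fin ger0_norm ?bumpn_ge0 // indicE.
  have [h|h] := boolP (x \in box M c 0); first exact: bumpn_le1.
  by rewrite bumpn_out // => /mem_set; apply/negP.
rewrite integral_indic ?setIT //; last exact: measurable_box.
by rewrite mu_box // ltry.
Qed.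

Lemma integral_bumpn M c : (\int[mu]_x (bumpn M c x)%:E = (omega M)%:E)%E.
Proof.
rewrite /omega /Rintegral fineK; last first.
  exact: (integrable_fin_num _ (integrable_bumpn M [ffun=> 0])).
pose a : T := [tuple - ((c i)%:~R / 2 ^+ M) | i < n].
rewrite -[RHS](@integral_translate R n mu Hmu a (fun x => (bumpn M [ffun=> 0] x)%:E)) //; first last.
- by move=> x; rewrite lee_fin bumpn_ge0.
- by apply/measurable_EFinP; exact: measurable_bumpn.
apply: eq_integral => x _; congr (_%:E); apply: eq_bigr => i _; congr bumpR.
rewrite !tnth_mktuple ffunE mulrDr mulrN mulrCA divff ?expf_neq0 // mulr1 subr0 //.
Qed.

Lemma omega_ge M : (expR (- 8) / 2) ^+ n * (2 ^+ M) ^- n <= omega M.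
Proof. by rewrite -lee_fin -(integral_bumpn M [ffun=> 0]); exact: integral_bumpn_ge. Qed.

Lemma omega_gt0 M : 0 < omega M.
Proof.
apply: lt_le_trans (omega_ge M).
by rewrite mulr_gt0 ?invr_gt0 ?exprn_gt0 // divr_gt0 // expR_gt0.
Qed.

Section Integrable.
Variables (p : nat) (Om : set T) (g : T -> R).
Hypotheses (p0 : (0 < p)%N) (oOm : is_open Om) (gp : in_Lp mu Om p g).

Let mOm : measurable Om.
Proof. exact: dopen_measurable (is_open_dopen oOm). Qed.

(** [|g|] is at most [1 + |g|^p], so the product is dominated by the indicator of the box plus
    [|g|^p]. The indicator is what copes with an [Om] of infinite measure. *)
Lemma integrable_mul_bounded (w : T -> R) M c s : measurable_fun setT w ->
  (forall x, `|w x| <= 1) -> (forall x, ~ box M c s x -> w x = 0) ->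
  mu.-integrable Om (EFin \o (fun x => g x * w x)).
Proof.
move=> mw w1 w0; have [mg gfin] := gp.
have mgp : measurable_fun Om (EFin \o (fun x => `|g x| ^+ p)).
  by apply/measurable_EFinP; apply: measurable_funX; exact: measurableT_comp.
have ig : mu.-integrable Om (EFin \o (fun x => `|g x| ^+ p)).
  apply/integrableP; split => //.
  by under eq_integral => x _ do rewrite /= ger0_norm ?exprn_ge0 //.
have ib : mu.-integrable Om (EFin \o \1_(box M c s : set T)).
  apply/integrableP; split.
    by apply/measurable_EFinP; apply: measurable_indic; exact: measurable_box.
  under eq_integral => x _ do rewrite /= ger0_norm ?ler0n //.
  rewrite integral_indic //; last exact: measurable_box.
  apply: (@le_lt_trans _ _ (mu (box M c s))); last by rewrite mu_box // ltry.
  by apply: le_measure => //; apply/mem_set; [apply: measurableI|]; rewrite //; exact: measurable_box.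
apply: le_integrable (integrableD _ ib ig) => //.
  apply/measurable_EFinP; apply: measurable_funM => //; exact: measurable_funS mw.
move=> x Omx /=; rewrite lee_fin normrM indicE.
have g0 : 0 <= `|g x| ^+ p by rewrite exprn_ge0.
rewrite (@ger0_norm _ (_ + _)) ?addr_ge0 //.
have [h|h] := boolP (x \in (box M c s : set T)); last first.
  by rewrite (w0 x) ?normr0 ?mulr0 ?add0r //; move/negP: h => h /mem_set.
apply: (@le_trans _ _ `|g x|); first by rewrite ler_piMr.
have [g1|g1] := leP `|g x| 1; first by apply: (le_trans g1); rewrite lerDl.
by rewrite ler_wpDl // ler_eXnr // ltW.
Qed.

End Integrable.

Section Average.
Variables (p : nat) (Om : set T) (g : T -> R).
Hypotheses (p0 : (0 < p)%N) (oOm : is_open Om) (gp : in_Lp mu Om p g).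

Let mOm : measurable Om.
Proof. exact: dopen_measurable (is_open_dopen oOm). Qed.

Definition favg (M : nat) (c : Z) : R := (\int[mu]_(x in Om) (g x * bumpn M c x))%R / omega M.

Lemma favg_close M c (r eta : R) : box M c 0 `<=` Om -> 0 <= eta ->
  (forall x, box M c 0 x -> `|g x - r| <= eta) -> `|favg M c - r| <= eta.
Proof.
move=> BO eta0 h; have w0 := omega_gt0 M.
have I1 : mu.-integrable Om (EFin \o (fun x => g x * bumpn M c x)).
  apply: (@integrable_mul_bounded p Om g p0 oOm gp _ M c 0); first exact: measurable_bumpn.
    by move=> x; rewrite ger0_norm ?bumpn_ge0 // bumpn_le1.
  by move=> x; exact: bumpn_out.
have I2 : mu.-integrable Om (EFin \o bumpn M c).
  exact: integrableS (integrable_bumpn M c).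
have ow : omega M = (\int[mu]_(x in Om) bumpn M c x)%R.
  apply: EFin_inj; rewrite -(integral_bumpn M c) /Rintegral fineK; last exact: integrable_fin_num I2.
  rewrite [RHS]integral_mkcond; apply: eq_integral => x _; rewrite /patch.
  case: ifPn => // /negP xO; rewrite bumpn_out // => /BO Ox; apply: xO; exact: mem_set.
have -> : favg M c - r = (\int[mu]_(x in Om) ((g x - r) * bumpn M c x))%R / omega M.
  rewrite /favg -[X in _ - X](mulfK (lt0r_neq0 w0)) -mulrBl; congr (_ / _).
  rewrite {1}ow -RintegralZl // -RintegralB //; last exact: (integrableZl mOm r I2).
  by apply: eq_Rintegral => x _; rewrite mulrBl.
have I3 : mu.-integrable Om (EFin \o (fun x => (g x - r) * bumpn M c x)).
  have := integrableB mOm I1 (integrableZl mOm r I2); apply: eq_integrable => // x _ /=.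
  by rewrite -EFinD mulrBl.
rewrite normrM normfV (gtr0_norm w0) ler_pdivrMr //.
apply: (le_trans (le_normr_Rintegral mOm I3)).
rewrite ow -RintegralZl //; apply: le_Rintegral => //.
- have := integrable_abse I3; apply: eq_integrable => //.
- exact: (integrableZl mOm eta I2).
move=> x Ox; rewrite normrM (ger0_norm (bumpn_ge0 M c x)).
have [xB|xB] := pselect (box M c 0 x); last by rewrite bumpn_out // !mulr0.
by rewrite ler_wpM2r ?bumpn_ge0 // h.
Qed.

Variables (j : 'I_n) (Gj : T -> R).
Hypothesis Gp : in_Lp mu Om p Gj.
Hypothesis wk : forall phi : T -> R, test_fun Om phi ->
    (\int[mu]_(x in Om) (g x * pderiv j phi x)%:E =
     - \int[mu]_(x in Om) (Gj x * phi x)%:E)%E.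

Definition cnext (c : Z) : Z := [ffun i => if i == j then c i + 1 else c i].

Lemma bumpn_cnext M c x : bumpn M (cnext c) x =
  bumpR (2 ^+ M * tnth x j - (c j)%:~R - 1) * \prod_(i < n | i != j) bumpR (2 ^+ M * tnth x i - (c i)%:~R).
Proof.
rewrite /bumpn (bigD1 j) //= ffunE eqxx intrD opprD addrA; congr (_ * _).
by apply: eq_bigr => i /negPf ij; rewrite ffunE ij.
Qed.

(* The difference of two adjacent bumps is the derivative of a test function
   supported in the union of their cells. *)
Lemma favg_next M c :
  (forall x : T, (forall i, (c i)%:~R <= 2 ^+ M * tnth x i <= (c i)%:~R + (i == j)%:R + 1) -> Om x) ->
  (`|favg M (cnext c) - favg M c|%:E <=
    (((expR (- 8) / 2) ^+ n)^-1 * (2 ^+ M) ^+ n / 2 ^+ M)%:E *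
    (\int[mu]_(x in box M c 0) `|Gj x|%:E + \int[mu]_(x in box M (cnext c) 0) `|Gj x|%:E))%E.
Proof.
move=> KO; have w0 := omega_gt0 M; have p2 : 0 < 2 ^+ M :> R by rewrite exprn_gt0.
have [psi [spsi dpsi psi0 psi1]] := @smooth1_tent R.
pose w (i : 'I_n) (t : R) : R := (if i == j then psi else @bumpR R) (2 ^+ M * t - (c i)%:~R).
pose phi (x : T) := \prod_(i < n) w i (tnth x i).
have sw i : smooth1 (w i).
  by rewrite /w; case: (i == j); apply: smooth1_affine => //; exact: smooth1_bump.
(* The closed hull of the two cells. A test function needs a closed support inside [Om], which is
   why the hypothesis speaks of a closed box. *)
pose K : set T := [set x | forall i, (c i)%:~R <= 2 ^+ M * tnth x i <= (c i)%:~R + (i == j)%:R + 1].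
have phi0 x : ~ box M c 0 x -> ~ box M (cnext c) 0 x -> phi x = 0.
  move=> n1 n2; have [i hi] : exists i, w i (tnth x i) = 0.
    apply: contrapT => /forallNP H.
    have hb i : i != j -> 0 < 2 ^+ M * tnth x i - (c i)%:~R < 1.
      move=> /negPf ij; apply/negPn/negP => hn; apply: (H i).
      by rewrite /w ij bump_out.
    have hj : 0 < 2 ^+ M * tnth x j - (c j)%:~R < 2.
      by apply/negPn/negP => hn; apply: (H j); rewrite /w eqxx psi0.
    have [hle|hgt] := leP (2 ^+ M * tnth x j - (c j)%:~R) 1.
      apply: n1 => i; rewrite expr0; have [->|ij] := eqVneq i j; first by apply/andP; split; lra.
      by have := hb i ij; move=> /andP[a b]; apply/andP; split; lra.
    apply: n2 => i; rewrite expr0 ffunE; have [->|ij] := eqVneq i j.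
      by rewrite intrD; apply/andP; split; lra.
    by have := hb i ij; move=> /andP[a b]; apply/andP; split; lra.
  by rewrite /phi (bigD1 i) //= hi mul0r.
have boxK : box M c 0 `<=` K.
  move=> x h i; have := h i; rewrite expr0 => /andP[a b]; apply/andP; split; first lra.
  by case: (i == j); rewrite /=; lra.
have boxK' : box M (cnext c) 0 `<=` K.
  move=> x h i; have := h i; rewrite expr0 ffunE; case: (i == j); rewrite /= ?intrD => /andP[a b];
    apply/andP; split; lra.
have tphi : test_fun Om phi.
  split; first exact: smooth_prod.
  exists K; split.
  - move=> x hx i; apply/andP; split; rewrite leNgt; apply/negP => hlt.
      have e0 : 0 < ((c i)%:~R - 2 ^+ M * tnth x i) / 2 ^+ M by rewrite divr_gt0 // subr_gt0.
      have [y [Ky]] := hx _ e0; move=> /(le_lt_trans (edist_ge y x i)).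
      rewrite ltr_pdivlMr // => /(le_lt_trans (ler_wpM2r (ltW p2) (ler_norm _))).
      by have /andP[a _] := Ky i; rewrite mulrBl !(mulrC _ (2 ^+ M)); lra.
    have e0 : 0 < (2 ^+ M * tnth x i - ((c i)%:~R + (i == j)%:R + 1)) / 2 ^+ M by rewrite divr_gt0 // subr_gt0.
    have [y [Ky]] := hx _ e0; move=> /(le_lt_trans (edist_ge y x i)); rewrite distrC.
    rewrite ltr_pdivlMr // => /(le_lt_trans (ler_wpM2r (ltW p2) (ler_norm _))).
    by have /andP[_ a] := Ky i; rewrite mulrBl !(mulrC _ (2 ^+ M)); lra.
  - exists (\sum_(i < n) (`|(c i)%:~R| + 2)) => x Kx i.
    apply: (@le_trans _ _ (`|(c i)%:~R| + 2)); last first.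
      by rewrite (bigD1 i) //= lerDl sumr_ge0 // => *; rewrite addr_ge0.
    have h1 : `|2 ^+ M * tnth x i| <= `|(c i)%:~R| + 2.
      have /andP[a b] := Kx i; rewrite ler_norml; apply/andP; split.
        by have := ler_normr (c i)%:~R (- (c i)%:~R : R); have := ler_norm (- (c i)%:~R : R); rewrite normrN; lra.
      by have := ler_norm ((c i)%:~R : R); move: b; case: (i == j); rewrite /=; lra.
    apply: le_trans h1; rewrite normrM (ger0_norm (ltW p2)) ler_peMl //.
    by rewrite exprn_ege1 // ler1n.
  - exact: KO.
  - by move=> x nK; apply: phi0 => [/boxK|/boxK'].
have phi1 x : `|phi x| <= 1.
  rewrite /phi normr_prod; apply: (@le_trans _ _ (\prod_(i < n) (1 : R))); last by rewrite big1.
  apply: ler_prod => i _; rewrite normr_ge0 /= /w; case: (i == j); first exact: psi1.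
  by rewrite ger0_norm ?bump_ge0 // bump_le1.
have dphi x : pderiv j phi x = 2 ^+ M * (bumpn M c x - bumpn M (cnext c) x).
  pose w' (t : R) := 2 ^+ M * (bumpR (2 ^+ M * t - (c j)%:~R) - bumpR (2 ^+ M * t - (c j)%:~R - 1)).
  have dw (t : R) : is_derive t 1 (w j) (w' t).
    rewrite /w eqxx.
    have dl : is_derive t 1 (fun u : R => 2 ^+ M * u - (c j)%:~R) (2 ^+ M).
      have -> : (fun u : R => 2 ^+ M * u - (c j)%:~R) = (2 ^+ M \*: id) - cst (c j)%:~R.
        by apply/funext => u; rewrite !fctE.
      by apply: is_derive_eq; rewrite subr0 /GRing.scale /= mulr1.
    have := @is_derive1_comp R psi (fun u => 2 ^+ M * u - (c j)%:~R) t _ _ (dpsi _) dl.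
    by move=> D; apply: (is_derive_eq D); rewrite /w' mulrC.
  rewrite /phi (pderiv_prod dw) bumpn_cnext /bumpn !(bigD1 j (P := predT)) //= eqxx -mulrBl mulrA.
  congr (_ * _); apply: eq_bigr => i /negPf ij; by rewrite ij /w ij.
have mphi : measurable_fun setT phi.
  apply: measurable_prod => i _; apply: (measurableT_comp (f := w i)).
    exact: continuous_measurable_fun (smooth1_continuous (sw i)).
  exact: measurable_tnth.
have IG : mu.-integrable Om (EFin \o (fun x => Gj x * phi x)).
  apply: (@integrable_mul_bounded p Om Gj p0 oOm Gp _ M c 1) => // x nb.
  apply: phi0 => hb; apply: nb => i; have := hb i; rewrite expr0 expr1 ?ffunE.
    by move=> /andP[a b]; apply/andP; split; lra.
  by case: (i == j); rewrite ?intrD => /andP[a b]; apply/andP; split; lra.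
have Ib e : mu.-integrable Om (EFin \o (fun x => g x * bumpn M e x)).
  apply: (@integrable_mul_bounded p Om g p0 oOm gp _ M e 0); first exact: measurable_bumpn.
    by move=> x; rewrite ger0_norm ?bumpn_ge0 // bumpn_le1.
  by move=> x; exact: bumpn_out.
have R1 : (\int[mu]_(x in Om) (g x * pderiv j phi x))%R =
    2 ^+ M * omega M * (favg M c - favg M (cnext c)).
  rewrite /favg mulrAC -mulrA -mulrBl divfK ?lt0r_neq0 // -RintegralB // -RintegralZl //; last first.
    exact: (integrableB mOm (Ib _) (Ib _)).
  by apply: eq_Rintegral => x _; rewrite dphi; ring.
have R2 : (\int[mu]_(x in Om) (g x * pderiv j phi x))%R = - (\int[mu]_(x in Om) (Gj x * phi x))%R.
  by rewrite /Rintegral (wk tphi) fineN.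
pose I := (\int[mu]_(x in Om) (Gj x * phi x))%R.
have NI : `|favg M (cnext c) - favg M c| = (2 ^+ M * omega M)^-1 * `|I|.
  have q0 : 0 < 2 ^+ M * omega M by rewrite mulr_gt0.
  have -> : `|I| = `|2 ^+ M * omega M * (favg M c - favg M (cnext c))| by rewrite -R1 R2 normrN.
  by rewrite normrM (gtr0_norm q0) mulrA mulVf ?lt0r_neq0 // mul1r distrC.
have subO : box M c 0 `<=` Om by move=> x /boxK /KO.
have subO' : box M (cnext c) 0 `<=` Om by move=> x /boxK' /KO.
have mG : measurable_fun Om (fun x => `|Gj x|%:E).
  by have [mG _] := Gp; apply/measurable_EFinP; exact: measurableT_comp.
have restr e : box M e 0 `<=` Om ->
   (\int[mu]_(x in box M e 0) `|Gj x|%:E = \int[mu]_(x in Om) ((fun x => `|Gj x|%:E) \_ (box M e 0)) x)%E.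
  by move=> sO; rewrite -integral_mkcondr (setIidr sO).
have mGr e : measurable_fun Om ((fun x => `|Gj x|%:E) \_ (box M e 0)).
  apply/(measurable_restrict _ (measurable_box _ _ _) mOm).
  by apply: measurable_funS mG => //; exact: subIsetl.
have r0 e x : (0 <= ((fun x => `|Gj x|%:E) \_ (box M e 0)) x)%E by apply: erestrict_ge0.
have HI : (`|I|%:E <= \int[mu]_(x in box M c 0) `|Gj x|%:E + \int[mu]_(x in box M (cnext c) 0) `|Gj x|%:E)%E.
  rewrite /I EFin_normr_Rintegral // (restr c) // (restr (cnext c)) // -ge0_integralD //.
  apply: (le_trans (le_abse_integral mu mOm _)); first by have /integrableP[] := IG.
  apply: ge0_le_integral => //.
  - by apply: measurableT_comp => //; have /integrableP[] := IG.
  - by apply: emeasurable_funD.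
  move=> x Ox /=; rewrite /patch.
  have hb : `|Gj x * phi x| <= `|Gj x| by rewrite normrM ler_piMr.
  case: ifPn => h1; case: ifPn => h2; rewrite ?adde0 ?add0e ?lee_fin //.
    by apply: (le_trans hb); rewrite lerDl.
  rewrite phi0 ?mulr0 ?normr0 //; first by move=> h; move/negP: h1; apply; exact: mem_set.
  by move=> h; move/negP: h2; apply; exact: mem_set.
rewrite NI EFinM; apply: lee_pmul => //; first by rewrite lee_fin invr_ge0 mulr_ge0 ?ltW.
rewrite lee_fin invfM mulrC ler_wpM2r ?invr_ge0 ?(ltW p2) //.
have := omega_ge M => how.
have k0 : 0 < (expR (- 8) / 2) ^+ n :> R by rewrite exprn_gt0 // divr_gt0 // expR_gt0.
by rewrite -[X in _ <= X]invrK invfM invrK lef_pV2 ?posrE // mulr_gt0 // invr_gt0 exprn_gt0.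
Qed.

End Average.

End BumpAverage.

(** * Telescoping means over dyadic cells *)

Section CubeAverages.
Variables (R : realType) (n : nat).
Local Notation T := (n.-tuple R).
Local Notation Z := {ffun 'I_n -> int}.
Local Notation Sg := {ffun 'I_n -> bool}.
Implicit Types (c b : Z) (x : T) (sg : Sg).

(* The mean of [V] over the [2^(n s)] cells of level [M] composing [box M c s]. *)
Fixpoint wavg (V : Z -> R) (s : nat) (c : Z) : R :=
  if s is s'.+1 then (2 ^+ n)^-1 * \sum_(sg : Sg) wavg V s' (cell_add c s' sg) else V c.

Variable M : nat.

Lemma cnext_cell_add j c s sg : cnext j (cell_add c s sg) = cell_add (cnext j c) s sg.
Proof. by apply/ffunP => i; rewrite !ffunE; case: (i == j) => //; rewrite addrAC. Qed.

Section WithMeasure.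
Variables (nu : {measure set T -> \bar R}) (nu_fin : (nu setT < +oo)%E).

Let r (A : set T) : R := fine (nu A).

Lemma fin_num_nu A : measurable A -> nu A \is a fin_num.
Proof.
move=> mA; rewrite ge0_fin_numE //; apply: le_lt_trans nu_fin.
by apply: le_measure => //; apply/mem_set.
Qed.

Lemma fine_nu_ge0 A : 0 <= r A.
Proof. exact: fine_ge0. Qed.

Lemma fine_nu_le A B : measurable A -> measurable B -> A `<=` B -> r A <= r B.
Proof.
move=> mA mB AB; apply: fine_le; rewrite ?fin_num_nu //.
by apply: le_measure => //; apply/mem_set.
Qed.

Lemma fine_nu_split c s : r (box M c s.+1) = \sum_(sg : Sg) r (box M (cell_add c s sg) s).
Proof.
rewrite /r measure_box_split sum_fine // => sg _.
by apply: fin_num_nu; exact: measurable_box.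
Qed.

Variable (Q : set T) (V : Z -> R).

Lemma wavg_le (m0 : R) :
  (forall c, box M c 0 `<=` Q -> V c * m0 <= r (box M c 0)) ->
  forall s c, box M c s `<=` Q -> wavg V s c * (m0 * (2 ^+ n) ^+ s) <= r (box M c s).
Proof.
move=> h; elim=> [|s IH] c cQ; first by rewrite expr0 mulr1; exact: h.
rewrite fine_nu_split /= exprS.
have -> : (2 ^+ n)^-1 * (\sum_sg wavg V s (cell_add c s sg)) * (m0 * (2 ^+ n * (2 ^+ n) ^+ s)) =
  \sum_sg wavg V s (cell_add c s sg) * (m0 * (2 ^+ n) ^+ s).
  by rewrite -mulr_suml; field; rewrite expf_neq0.
apply: ler_sum => sg _; apply: IH; apply: subset_trans cQ; exact: cell_add_box_sub.
Qed.

Variable a : R.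
Hypothesis a0 : 0 <= a.
Hypothesis Vnext : forall j c, box M c 0 `<=` Q -> box M (cnext j c) 0 `<=` Q ->
  `|V (cnext j c) - V c| <= a * (r (box M c 0) + r (box M (cnext j c) 0)).

(** The shift by one fine cell commutes with the passage to children, so the bound for means is the
    average of the bounds for cells. *)
Lemma wavg_next j s c : box M c s `<=` Q -> box M (cnext j c) s `<=` Q ->
  `|wavg V s (cnext j c) - wavg V s c| <=
     (2 ^+ n) ^- s * (a * (r (box M c s) + r (box M (cnext j c) s))).
Proof.
elim: s c => [|s IH] c h1 h2; first by rewrite expr0 invr1 mul1r; exact: Vnext.
rewrite /= -mulrBr -sumrB normrM ger0_norm ?invr_ge0 ?exprn_ge0 //.
rewrite exprS invfM -mulrA ler_wpM2l ?invr_ge0 ?exprn_ge0 //.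
apply: (le_trans (ler_norm_sum _ _ _)).
rewrite !fine_nu_split -big_split /= !mulr_sumr; apply: ler_sum => sg _.
rewrite -cnext_cell_add; apply: IH.
  by apply: subset_trans h1; exact: cell_add_box_sub.
by rewrite cnext_cell_add; apply: subset_trans h2; exact: cell_add_box_sub.
Qed.

Definition flip (j : 'I_n) sg : Sg := [ffun i => (i == j) || sg i].

Lemma iter_cnextE j l c i : iter l (cnext j) c i = c i + (if i == j then l%:Z else 0).
Proof.
elim: l => [|l IH]; first by rewrite /=; case: (i == j); rewrite addr0.
by rewrite iterS ffunE IH; case: (i == j) => //; rewrite -addrA -[l.+1]addn1 PoszD.
Qed.

Lemma cell_add_flip j b s sg : sg j = false -> cell_add b s (flip j sg) = iter (2 ^ s) (cnext j) (cell_add b s sg).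
Proof.
move=> sj; apply/ffunP => i; rewrite iter_cnextE !ffunE.
by case: eqVneq => [->|ij] /=; rewrite ?sj addr0.
Qed.

Lemma iter_box_sub j l b s sg : sg j = false -> (l <= 2 ^ s)%N ->
  box M (iter l (cnext j) (cell_add b s sg)) s `<=` (box M b s.+1 : set T).
Proof.
move=> sj ls x h i; have := h i; have := @cell_add_box_sub R n M b s sg.
rewrite iter_cnextE ffunE; case: eqVneq => [->|ij].
  rewrite sj addr0 intrD -pmulrn => _ /andP[h1 h2].
  have l0 : 0 <= l%:R :> R by rewrite ler0n.
  have l1 : l%:R <= 2 ^+ s :> R by rewrite -natrX ler_nat.
  by rewrite exprS; apply/andP; split; lra.
move=> _; rewrite addr0 exprS.
have p0 : 0 < 2 ^+ s :> R by rewrite exprn_gt0.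
case: (sg i); last by rewrite addr0 => /andP[-> h2] /=; apply: (le_trans h2); lra.
by rewrite intrD -pmulrn natrX => /andP[h1 h2]; apply/andP; split; lra.
Qed.

(** Carrying a child onto its neighbour takes [2^s] shifts by one fine cell, all inside the parent
    box. Each one costs at most twice the mass of the parent, times [a] and the normalisation
    [2^(-n s)]. *)
Lemma wavg_flip j b s sg : box M b s.+1 `<=` Q -> sg j = false ->
  `|wavg V s (cell_add b s (flip j sg)) - wavg V s (cell_add b s sg)| <=
    2 * a * 2 ^+ s * (2 ^+ n) ^- s * r (box M b s.+1).
Proof.
move=> bQ sj; rewrite cell_add_flip //.
suff H l : (l <= 2 ^ s)%N ->
   `|wavg V s (iter l (cnext j) (cell_add b s sg)) - wavg V s (cell_add b s sg)| <=
   l%:R * (2 * a * (2 ^+ n) ^- s * r (box M b s.+1)).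
  by apply: (le_trans (H _ (leqnn _))); rewrite natrX le_eqVlt; apply/orP; left; apply/eqP; ring.
have sub k : (k <= 2 ^ s)%N -> box M (iter k (cnext j) (cell_add b s sg)) s `<=` (box M b s.+1 : set T) by move=> kl; exact: iter_box_sub.
elim: l => [|l IH] ls; first by rewrite subrr normr0 mul0r.
rewrite -[X in `|X|](subrKA (wavg V s (iter l (cnext j) (cell_add b s sg)))).
apply: (le_trans (ler_normD _ _)); rewrite -[l.+1]addn1 natrD mulrDl addrC lerD ?IH // ?(ltnW ls) //.
rewrite mul1r addn1 iterS.
apply: (le_trans (wavg_next _ _)).
- by apply: subset_trans bQ; apply: sub; exact: ltnW.
- by rewrite -iterS; apply: subset_trans bQ; apply: sub.
have q0 : 0 <= (2 ^+ n) ^- s :> R by rewrite invr_ge0 !exprn_ge0.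
rewrite [X in _ <= X](_ : _ = (2 ^+ n) ^- s * (a * (r (box M b s.+1) + r (box M b s.+1)))); last by ring.
rewrite ler_wpM2l // ler_wpM2l // lerD //; apply: fine_nu_le; try exact: measurable_box.
  by apply: sub; exact: ltnW.
by rewrite -iterS; exact: sub.
Qed.

(** Every vertex of the discrete cube is reached from the all-false one by raising coordinates one
    at a time, in at most [n] flips. *)
Lemma cube_path (X : Sg -> R) (B : R) : 0 <= B ->
  (forall j sg, sg j = false -> `|X (flip j sg) - X sg| <= B) ->
  forall sg, `|X sg - X [ffun=> false]| <= n%:R * B.
Proof.
move=> B0 h sg; pose p (k : nat) : Sg := [ffun i : 'I_n => sg i && (i < k)%N].
have p0 : p 0%N = [ffun=> false] by apply/ffunP => i; rewrite !ffunE ltn0 andbF.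
have pn : p n = sg by apply/ffunP => i; rewrite !ffunE ltn_ord andbT.
suff H k : (k <= n)%N -> `|X (p k) - X (p 0%N)| <= k%:R * B by rewrite -{1}pn -p0; exact: H.
elim: k => [|k IH] kn; first by rewrite subrr normr0 mul0r.
rewrite -[X in `|X|](subrKA (X (p k))).
apply: (le_trans (ler_normD _ _)); rewrite -[k.+1]addn1 natrD mulrDl addrC lerD ?IH // ?(ltnW kn) //.
rewrite mul1r addn1; pose i0 : 'I_n := Ordinal kn.
case E : (sg i0).
  have -> : p k.+1 = flip i0 (p k).
    apply/ffunP => i; rewrite !ffunE ltnS leq_eqVlt.
    have -> : (i == k :> nat) = (i == i0) by [].
    by case: eqVneq => [->|] //=; rewrite E.
  by apply: h; rewrite ffunE ltnn andbF.
have -> : p k.+1 = p k.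
  apply/ffunP => i; rewrite !ffunE ltnS leq_eqVlt.
  have -> : (i == k :> nat) = (i == i0) by [].
  by case: eqVneq => [->|] //=; rewrite E.
by rewrite subrr normr0.
Qed.

(** The parent mean is the mean over the children, and two children are joined by two paths through
    the all-false child: [4 * n] is [2 * n] times the constant [2] of a single flip. *)
Lemma wavg_child b s tg : box M b s.+1 `<=` Q ->
  `|wavg V s (cell_add b s tg) - wavg V s.+1 b| <=
    4 * n%:R * a * 2 ^+ s * (2 ^+ n) ^- s * r (box M b s.+1).
Proof.
move=> bQ; set B := 2 * a * 2 ^+ s * (2 ^+ n) ^- s * r (box M b s.+1).
have B0 : 0 <= B by rewrite !mulr_ge0 ?fine_nu_ge0 ?invr_ge0 ?exprn_ge0.
pose X sg := wavg V s (cell_add b s sg).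
have hX sg : `|X sg - X [ffun=> false]| <= n%:R * B.
  by apply: cube_path => // j tau0 tj; exact: wavg_flip.
have c0 : (2 ^+ n)^-1 * \sum_(sg : Sg) (1 : R) = 1.
  by rewrite sumr_const cardT -cardE card_ffun card_bool card_ord natrX mulVf // expf_neq0.
have -> : wavg V s (cell_add b s tg) - wavg V s.+1 b = (2 ^+ n)^-1 * \sum_(sg : Sg) (X tg - X sg).
  by rewrite sumrB mulrBr -[X in \sum_(sg : Sg) X]mul1r -mulr_suml mulrA c0 mul1r.
rewrite normrM ger0_norm ?invr_ge0 ?exprn_ge0 //.
apply: (@le_trans _ _ ((2 ^+ n)^-1 * \sum_(sg : Sg) (2 * (n%:R * B)))).
  rewrite ler_wpM2l ?invr_ge0 ?exprn_ge0 //; apply: (le_trans (ler_norm_sum _ _ _)).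
  apply: ler_sum => sg _; rewrite -(subrKA (X [ffun=> false])) mulr_natl mulr2n.
  by apply: (le_trans (ler_normD _ _)); rewrite lerD // distrC.
have -> : \sum_(sg : Sg) (2 * (n%:R * B)) = (\sum_(sg : Sg) 1) * (2 * (n%:R * B)).
  by rewrite mulr_suml; apply: eq_bigr => sg _; rewrite mul1r.
rewrite [X in X <= _]mulrA c0 mul1r /B.
by rewrite le_eqVlt; apply/orP; left; apply/eqP; ring.
Qed.

End WithMeasure.

Definition corner (z : T) (k : nat) : Z := [ffun i => (2 ^ (M - k))%N%:Z * idx k z i].

Lemma box_corner z k : (k <= M)%N -> box M (corner z k) (M - k) = dcube k z.
Proof. by move=> kM; rewrite /dcube (@box_refineD R n k _ 0 (M - k)) subnKC. Qed.

Lemma corner_next z k : (k < M)%N ->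
  exists tg, corner z k.+1 = cell_add (corner z k) (M - k.+1) tg.
Proof.
move=> kM; have [tg e] := idx_next k z; exists tg; apply/ffunP => i.
rewrite [LHS]ffunE e !ffunE expn0.
have -> : (M - k = (M - k.+1).+1)%N by lia.
by rewrite expnS PoszM mulrDr; case: (tg i) => /=; rewrite ?mulr1 ?mulr0 ?addr0; ring.
Qed.

Lemma corner_top z : corner z M = idx M z.
Proof. by apply/ffunP => i; rewrite ffunE subnn expn0 mul1r. Qed.

(** The steps between consecutive cells around [z] are summed. At level [k], with [s = M - (k+1)],
    the factor [2^s * 2^(-n s)] cancels against [2^(M(n-1))] and leaves [2^((k+1)(n-1))]: the
    estimate does not see the fine scale [M]. *)
Lemma wavg_chain (nu : {measure set T -> \bar R}) (V : Z -> R) (a : R) (z : T) (k0 : nat) :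
  (nu setT < +oo)%E -> 0 <= a -> (k0 <= M)%N -> (0 < n)%N ->
  (forall j c, box M c 0 `<=` dcube k0 z -> box M (cnext j c) 0 `<=` dcube k0 z ->
    `|V (cnext j c) - V c| <= a * (2 ^+ M) ^+ n.-1 * (fine (nu (box M c 0)) + fine (nu (box M (cnext j c) 0)))) ->
  `|V (idx M z) - wavg V (M - k0) (corner z k0)| <=
    4 * n%:R * a * 2 ^+ n.-1 * \sum_(k0 <= k < M) (2 ^+ k) ^+ n.-1 * fine (nu (dcube k z)).
Proof.
move=> nufin a0 kM n0 hV.
have a0' : 0 <= a * (2 ^+ M) ^+ n.-1 by rewrite mulr_ge0 // !exprn_ge0.
suff H m : (k0 <= m <= M)%N -> `|wavg V (M - m) (corner z m) - wavg V (M - k0) (corner z k0)| <=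
    4 * n%:R * a * 2 ^+ n.-1 * \sum_(k0 <= k < m) (2 ^+ k) ^+ n.-1 * fine (nu (dcube k z)).
  by have := H M; rewrite subnn /= corner_top; apply; rewrite kM leqnn.
elim: m => [|m IH] /andP[k0m mM].
  by move: k0m; rewrite leqn0 => /eqP ->; rewrite subrr normr0 big_geq // mulr0.
move: k0m; rewrite leq_eqVlt => /orP[/eqP <-|k0m]; first by rewrite subrr normr0 big_geq // mulr0.
rewrite ltnS in k0m.
rewrite -[X in `|X|](subrKA (wavg V (M - m) (corner z m))).
apply: (le_trans (ler_normD _ _)); rewrite big_nat_recr //= mulrDr addrC.
apply: lerD; first by apply: IH; rewrite k0m ltnW.
have [tg ->] := corner_next z mM.
have e : (M - m = (M - m.+1).+1)%N by lia.
have bc := box_corner z (ltnW mM).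
have bQ : box M (corner z m) (M - m.+1).+1 `<=` dcube k0 z.
  by rewrite -e bc; exact: dcube_mono.
rewrite {1}e; apply: (le_trans (wavg_child nufin a0' hV tg bQ)).
rewrite -e bc [X in _ <= X]mulrA ler_wpM2r ?fine_ge0 //.
set s := (M - m.+1)%N.
have eM : M = (s + m.+1)%N by rewrite /s; lia.
rewrite le_eqVlt; apply/orP; left; apply/eqP.
have -> : (2 ^+ n) ^- s = (2 ^+ s)^-1 * (2 ^+ s) ^- n.-1 :> R.
  by rewrite -invfM -exprS prednK // -!exprM mulnC.
rewrite [in (2 ^+ M)]eM exprD exprS !exprMn.
by field; rewrite !expf_neq0.
Qed.

End CubeAverages.

(** * Integrals of nonnegative functions and restricted densities *)

Section Restricted.
Local Open Scope ereal_scope.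
Context d (T : measurableType d) (R : realType) (mu : {measure set T -> \bar R}).

Section RealIntegrands.
Variable Q : set T.
Hypothesis mQ : measurable Q.
Implicit Types h : T -> R.
Local Open Scope ring_scope.

Lemma int_Zl h (a : R) : measurable_fun Q h -> (forall x, 0 <= h x) -> 0 <= a ->
  (\int[mu]_(x in Q) (a * h x)%:E = a%:E * \int[mu]_(x in Q) (h x)%:E)%E.
Proof.
move=> mh h0 a0; under eq_integral => x _ do rewrite EFinM.
by rewrite ge0_integralZl //; [apply/measurable_EFinP | move=> x _; rewrite lee_fin].
Qed.

Lemma int_D h1 h2 : measurable_fun Q h1 -> measurable_fun Q h2 ->
  (forall x, 0 <= h1 x) -> (forall x, 0 <= h2 x) ->
  (\int[mu]_(x in Q) (h1 x + h2 x)%:E =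
   \int[mu]_(x in Q) (h1 x)%:E + \int[mu]_(x in Q) (h2 x)%:E)%E.
Proof.
move=> m1 m2 h1p h2p; under eq_integral => x _ do rewrite EFinD.
by rewrite ge0_integralD //; (try by move=> x _; rewrite lee_fin); apply/measurable_EFinP.
Qed.

Lemma int_le h1 h2 : measurable_fun Q h1 -> measurable_fun Q h2 ->
  (forall x, 0 <= h1 x) -> (forall x, Q x -> h1 x <= h2 x) ->
  (\int[mu]_(x in Q) (h1 x)%:E <= \int[mu]_(x in Q) (h2 x)%:E)%E.
Proof.
move=> m1 m2 h1p h12; apply: ge0_le_integral => //; try by apply/measurable_EFinP.
by move=> x _; rewrite lee_fin.
Qed.

Lemma int_sum (I : Type) (s : seq I) (h : I -> T -> R) : (forall i, measurable_fun Q (h i)) ->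
  (forall i x, 0 <= h i x) ->
  (\int[mu]_(x in Q) (\sum_(i <- s) h i x)%:E = \sum_(i <- s) \int[mu]_(x in Q) (h i x)%:E)%E.
Proof.
move=> mh h0; under eq_integral => x _ do rewrite -sumEFin.
by rewrite ge0_integral_sum // => i; [apply/measurable_EFinP | move=> x _; rewrite lee_fin].
Qed.

Lemma int_indic (A : set T) h : measurable A -> A `<=` Q ->
  (\int[mu]_(x in A) (h x)%:E = \int[mu]_(x in Q) (\1_A x * h x)%:E)%E.
Proof.
move=> mA AQ; rewrite -[in LHS](setIidr AQ) integral_mkcondr; apply: eq_integral => x _.
by rewrite /patch indicE; case: ifP => _; rewrite ?mul1r ?mul0r.
Qed.

Lemma measurable_indicM (A : set T) h : measurable A -> measurable_fun Q h ->
  measurable_fun Q (fun x => \1_A x * h x).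
Proof. by move=> mA mh; apply: measurable_funM => //; exact: measurable_indic. Qed.

End RealIntegrands.

(** Turns integrals over cells into values of a measure, to which additivity over boxes, regularity
    and the covering lemma apply. *)
Lemma restricted_density (Q : set T) (g : T -> R) : measurable Q -> measurable_fun Q g ->
  (forall x, (0 <= g x)%R) ->
  exists nu : {measure set T -> \bar R}, forall A, nu A = \int[mu]_(x in A `&` Q) (g x)%:E.
Proof.
move=> mQ mg g0.
have mg' : measurable_fun setT ((EFin \o g) \_ Q).
  by apply/(measurable_restrictT _ mQ); apply/measurable_EFinP.
have g0' x : 0 <= ((EFin \o g) \_ Q) x by apply: erestrict_ge0 => y _; rewrite lee_fin.
exists (dens mu mg' g0' : {measure set T -> \bar R}) => A.
by rewrite /= /dens -integral_mkcondr.
Qed.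

End Restricted.

(** * Uniform continuity on closed cells *)

Section UniformContinuity.
Variables (R : realType) (n d : nat).

Definition ccell (k : nat) (z : n.-tuple R) : set (n.-tuple R) :=
  [set x | forall i, (idx k z i)%:~R <= 2 ^+ k * tnth x i <= (idx k z i)%:~R + 1].

Lemma ccell_dcube k z : dcube k z `<=` ccell k z.
Proof. by move=> x h i; have := h i; rewrite expr0 => /andP[/ltW -> ->]. Qed.

Lemma ccell_close k (z x y : n.-tuple R) i : ccell k z x -> ccell k z y -> `|tnth x i - tnth y i| <= (2 ^+ k)^-1.
Proof.
move=> /(_ i) /andP[x1 x2] /(_ i) /andP[y1 y2].
have p0 : 0 < 2 ^+ k :> R by rewrite exprn_gt0.
rewrite -[X in _ <= X]mul1r ler_pdivlMr // -[X in _ * X](ger0_norm (ltW p0)) -normrM ler_norml.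
by rewrite mulrC mulrBr; apply/andP; split; lra.
Qed.

Lemma l1_edist_lt (x y : n.-tuple R) (e : R) : 0 < e ->
  (forall i, `|tnth x i - tnth y i| <= e / n.+1%:R) -> edist x y < e.
Proof.
move=> e0 h; apply: (le_lt_trans (edist_le_l1 x y)).
apply: (@le_lt_trans _ _ (\sum_(i < n) e / n.+1%:R)); first by apply: ler_sum => i _; exact: h.
rewrite sumr_const card_ord -[X in X < _]mulr_natl mulrCA gtr_pMr //.
by rewrite ltr_pdivrMr ?ltr0n // mul1r ltr_nat.
Qed.

Lemma ccell_sub_open (U : set (n.-tuple R)) z : is_open U -> U z ->
  exists k0, forall k, (k0 <= k)%N -> ccell k z `<=` U.
Proof.
move=> oU /oU[r r0 h].
have [k0 hk0] := pow2_small (divr_gt0 r0 (ltr0Sn R n)).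
exists k0 => k kk x cx; apply: h; apply: l1_edist_lt => // i.
apply: (le_trans (ccell_close i cx (ccell_dcube (dcube_refl k z)))).
by rewrite ltW // hk0.
Qed.

(** Among row vectors the closed cell is a compact product of segments. Near a point [v] of it,
    [f (tt v')] and [f y] are both within [eta / 2] of [f (tt v)] once [2 / 2^M] is small; the
    near-covering form of compactness makes the threshold on [M] uniform. *)
Lemma ccell_unif_continuous (Om : set (n.-tuple R)) (f : n.-tuple R -> d.-tuple R) k z (eta : R) :
  continuous_on Om f -> ccell k z `<=` Om -> 0 < eta ->
  exists M0, forall M, (M0 <= M)%N -> forall x y, ccell k z x -> ccell k z y ->
    (forall i, `|tnth x i - tnth y i| <= 2 / 2 ^+ M) ->
    forall i, `|tnth (f x) i - tnth (f y) i| <= eta.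
Proof.
move=> cf cO e0.
pose tt (v : 'rV[R]_n) : n.-tuple R := [tuple v ord0 i | i < n].
pose rr (x : n.-tuple R) : 'rV[R]_n := \row_i tnth x i.
have trK x : tt (rr x) = x by apply: eq_from_tnth => i; rewrite tnth_mktuple mxE.
pose K := [set v : 'rV[R]_n | forall i : 'I_n,
   v ord0 i \in `[(idx k z i)%:~R / 2 ^+ k, ((idx k z i)%:~R + 1) / 2 ^+ k]].
have cK : compact K.
  apply: (@rV_compact _ _ (fun i : 'I_n =>
    `[((idx k z i)%:~R / 2 ^+ k : R), ((idx k z i)%:~R + 1) / 2 ^+ k]%classic)).
  by move=> i; apply: segment_compact.
have KE v : K v <-> ccell k z (tt v).
  split=> h i; have := h i; rewrite ?tnth_mktuple /= in_itv /= ler_pdivrMr ?exprn_gt0 // ler_pdivlMr ?exprn_gt0 // mulrC //.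
pose P (M : nat) (v : 'rV[R]_n) := K v -> forall y, ccell k z y ->
  (forall i, `|tnth (tt v) i - tnth y i| <= 2 / 2 ^+ M) -> forall i, `|tnth (f (tt v)) i - tnth (f y) i| <= eta.
have [M0 _ hM] : \forall M \near \oo, K `<=` P M.
  move/compact_near_coveringP: cK; apply => v Kv.
  have Ov : Om (tt v) by apply: cO; apply/KE.
  have e20 : 0 < eta / 2 by rewrite divr_gt0.
  have [dl dl0 hdl] := cf _ Ov _ e20.
  pose r := dl / n.+1%:R / 2.
  have r0 : 0 < r by rewrite /r !divr_gt0.
  have [k0 hk0] := pow2_small (divr_gt0 r0 (ltr0Sn R 1)).
  exists (ball v r, [set M | (k0 <= M)%N]); first by split; [exact: nbhsx_ballx | exists k0].
  move=> [v' M] [/= bv kM] Kv' y cy hy i.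
  have close i' : `|tnth (tt v') i' - tnth (tt v) i'| <= r.
    by rewrite !tnth_mktuple distrC ltW //; have := bv.2 ord0 i'.
  have hM : 2 / 2 ^+ M <= r.
    by have := hk0 M kM; rewrite ltr_pdivlMr // mulrC => /ltW.
  have h1 : edist (f (tt v')) (f (tt v)) < eta / 2.
    apply: hdl; first by apply: cO; apply/KE.
    apply: l1_edist_lt => // i'; apply: (le_trans (close i')).
    by rewrite /r ler_pdivrMr // ler_peMr ?ler1n // ltW // divr_gt0.
  have h2 : edist (f y) (f (tt v)) < eta / 2.
    apply: hdl; first exact: cO.
    apply: l1_edist_lt => // i'; rewrite -(subrKA (tnth (tt v') i')).
    apply: (le_trans (ler_normD _ _)); rewrite (splitr (dl / n.+1%:R)) lerD //.
    by rewrite distrC (le_trans (hy i')).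
  rewrite -(subrKA (tnth (f (tt v)) i)); apply: (le_trans (ler_normD _ _)).
  rewrite (splitr eta) lerD //.
    by apply: (le_trans (edist_ge (f (tt v')) (f (tt v)) i)); rewrite ltW.
  by rewrite distrC; apply: (le_trans (edist_ge (f y) (f (tt v)) i)); rewrite ltW.
exists M0 => M MM x y cx cy hxy i.
have Kx : K (rr x) by apply/KE; rewrite trK.
by have := hM M MM _ Kx Kx y cy; rewrite trK; apply.
Qed.

End UniformContinuity.

(** * Energy sums over the levels *)

Section EnergySums.
Variables (R : realType) (n : nat).
Local Notation T := (n.-tuple R).
Variables (mu : {measure set T -> \bar R}) (lam : R).
Hypotheses (Hmu : lebesgue_on_boxes mu) (n2 : (2 <= n)%N) (lam0 : 0 <= lam) (lam1 : lam <= (n.-1)%:R).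
Variables (z : T) (D : T -> R).
Hypothesis D0 : forall x, 0 <= D x.

Definition lenergy (D : T -> R) (x : T) : R := D x ^+ n * powR (ln (expR 1 + D x)) lam.

Lemma lenergy_ge0 x : 0 <= lenergy D x.
Proof. by rewrite mulr_ge0 ?exprn_ge0 ?powR_ge0. Qed.

Lemma lenergy_ge x : D x ^+ n <= lenergy D x.
Proof.
rewrite /lenergy ler_peMr ?exprn_ge0 // -[X in X <= _](powRr0 (ln (expR 1 + D x))).
by rewrite ler_powR // one_le_ln.
Qed.

Let mcube k : measurable (dcube k z).
Proof. exact: measurable_box. Qed.

Lemma measurable_lenergy Q : measurable_fun Q D -> measurable_fun Q (lenergy D).
Proof.
move=> mD; apply: measurable_funM; first exact: measurable_funX.
apply: (measurableT_comp (f := fun y : R => powR y lam)); first exact: measurable_powR.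
apply: (measurableT_comp (f := @ln R)); first exact: measurable_ln.
exact: measurable_funD.
Qed.

(** [young_split] with [La = 1] and [b = 2^k], integrated over a cell of volume [2^(-k n)], so that
    the first term integrates to [sg]. The parameter [sg] will be chosen level by level. *)
Lemma tail_energy k (sg : R) : 0 < sg -> measurable_fun (dcube k z) D ->
  (((2 ^+ k) ^+ n.-1)%:E * \int[mu]_(x in dcube k z) (D x)%:E <=
   sg%:E + (sg^-1 ^+ n.-1)%:E * \int[mu]_(x in dcube k z) (lenergy D x)%:E)%E.
Proof.
move=> s0 mD; have b0 : 0 < 2 ^+ k :> R by rewrite exprn_gt0.
have mF := measurable_lenergy mD.
have q0 : 0 <= sg^-1 ^+ n.-1 by rewrite exprn_ge0 // invr_ge0 ltW.
have b1 : 0 <= (2 ^+ k) ^+ n.-1 :> R by rewrite !exprn_ge0.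
rewrite -int_Zl // -int_Zl //; last exact: lenergy_ge0.
have -> : (sg%:E = \int[mu]_(x in dcube k z) (sg * (2 ^+ k) ^+ n)%:E)%E.
  by rewrite integral_cst // mu_dcube // -EFinM -mulrA mulfV ?mulr1 // expf_neq0 // gt_eqF.
have s1 : 0 <= sg * (2 ^+ k) ^+ n by rewrite mulr_ge0 ?exprn_ge0 // ltW.
rewrite -int_D //; last 2 first.
- by apply: measurable_funM.
- by move=> x; rewrite mulr_ge0 ?lenergy_ge0.
apply: int_le => //.
- by apply: measurable_funM.
- by apply: measurable_funD => //; apply: measurable_funM.
- by move=> x; rewrite mulr_ge0.
move=> x _; rewrite mulrC.
have := young_split n2 (D0 x) b0 s0 (lexx 1); rewrite powR1 !mulr1 => h.
by apply: (le_trans h); rewrite lerD2l ler_wpM2l ?lenergy_ge.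
Qed.

Definition kterm (s : R) (N k : nat) : R :=
  (3 / 2) ^+ k * (2 ^+ k) ^+ n.-1 + s * (2 ^+ k) ^+ n * (6 * theta n lam k + (k < 5 * N)%:R).

Lemma kterm_ge0 (s : R) N k : 0 < s -> 0 <= kterm s N k.
Proof.
move=> /ltW s0; apply: addr_ge0.
  by apply: mulr_ge0; rewrite ?exprn_ge0 // divr_ge0.
apply: mulr_ge0; first by apply: mulr_ge0; rewrite ?exprn_ge0.
by apply: addr_ge0; rewrite ?ler0n // mulr_ge0 // theta_ge0.
Qed.

(** By [geo_dom] a single level [i] carries at least half of the sum. [kernel_young] is applied
    there only, and the [kterm] of the other levels are added because they are nonnegative; the
    energy term is not multiplied by the number of levels. *)
Lemma kernel_sum_le (k0 K N : nat) (m s : R) (x : T) : (0 < k0)%N ->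
  expR (- N%:R) <= m -> 0 < s ->
  \sum_(k0 <= k < K | x \in dcube k z) (2 ^+ k) ^+ n.-1 * (D x / m) <=
  2 * \sum_(k0 <= k < K | x \in dcube k z) kterm s N k
  + 2 * s^-1 ^+ n.-1 * (lenergy D x / m ^+ n).
Proof.
move=> k00 mN s0; have m0 : 0 < m by apply: lt_le_trans mN; exact: expR_gt0.
have L0 : 0 <= 2 * s^-1 ^+ n.-1 * (lenergy D x / m ^+ n).
  apply: mulr_ge0; first by apply: mulr_ge0 => //; rewrite exprn_ge0 // invr_ge0 ltW.
  by apply: divr_ge0; [exact: lenergy_ge0 | rewrite exprn_ge0 // ltW].
have t0 k : 0 <= kterm s N k by exact: kterm_ge0.
rewrite -mulr_suml; have [->|[i [/andP[k0i iK] Pi le]]] := geo_dom R k0 K (fun k => x \in dcube k z) n2.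
  by rewrite mul0r addr_ge0 // mulr_ge0 // sumr_ge0.
have g0 : 0 <= D x / m by rewrite divr_ge0 // ltW.
apply: (le_trans (ler_wpM2r g0 le)).
have i0 : (0 < i)%N by exact: leq_trans k0i.
have Y := kernel_young n2 lam0 lam1 i0 (D0 x) mN s0.
rewrite -/(lenergy D x) in Y.
have -> : 2 * (2 ^+ i) ^+ n.-1 * (D x / m) = 2 * (D x / m * (2 ^+ i) ^+ n.-1).
  by rewrite -mulrA; congr (2 * _); rewrite mulrC.
rewrite -(mulrA 2 (s^-1 ^+ n.-1)) -mulrDr ler_wpM2l //.
apply: (le_trans Y); rewrite lerD2r -/(kterm s N i).
rewrite big_mkcond /= (bigD1_seq i) //= ?mem_index_iota ?k0i ?iota_uniq // Pi lerDl.
by rewrite sumr_ge0 // => k _; case: ifP.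
Qed.

Lemma sum_nat_widen (F : nat -> R) (a b c : nat) : (forall k, 0 <= F k) -> (a <= b)%N ->
  \sum_(b <= k < c) F k <= \sum_(a <= k < c) F k.
Proof.
move=> F0 ab; have [bc|cb] := leqP b c; last first.
  by rewrite [X in X <= _]big_geq ?(ltnW cb) //; apply: sumr_ge0.
by rewrite [X in _ <= X](big_cat_nat (n := b)) //= lerDr; apply: sumr_ge0.
Qed.

Lemma sum_lt_le (a b c : nat) : \sum_(a <= k < b) ((k < c)%:R : R) <= c%:R.
Proof.
apply: (le_trans (sum_nat_widen _ _ (leq0n a))) => //.
suff h : \sum_(0 <= k < b) ((k < c)%:R : R) <= (minn b c)%:R.
  by apply: (le_trans h); rewrite ler_nat geq_minr.
elim: b => [|b IH]; first by rewrite big_geq.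
rewrite big_nat_recr //=; apply: (le_trans (lerD IH (lexx _))).
by rewrite -natrD ler_nat; case: ltnP; lia.
Qed.

Lemma pow_geo (q : R) (k0 K : nat) : 0 <= q < 1 -> \sum_(k0 <= k < K) q ^+ k <= (1 - q)^-1.
Proof.
move=> /andP[q0 q1]; have q10 : 0 < 1 - q by rewrite subr_gt0.
apply: (@le_trans _ _ (\sum_(0 <= k < K) q ^+ k)).
  by apply: sum_nat_widen => // k; exact: exprn_ge0.
rewrite big_mkord -[X in _ <= X]div1r ler_pdivlMr //.
have -> : (\sum_(i < K) q ^+ i) * (1 - q) = 1 - q ^+ K by rewrite -opprB mulrN mulrC -subrX1 opprB.
by rewrite gerBl exprn_ge0.
Qed.

(** Over a cell of level [k] the term [kterm] integrates to [(3/4)^k + s * (6 * theta k +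
    [k < 5 N])]. The three sums over [k] are at most [4], [6 * s * Theta K] and [5 * s * N]. *)
Lemma head_energy (k0 K N : nat) (m : T -> R) (s : R) : (0 < k0)%N ->
  (forall x, expR (- N%:R) <= m x) -> 0 < s ->
  measurable_fun (dcube k0 z) D -> measurable_fun (dcube k0 z) m ->
  (\sum_(k0 <= k < K) ((2 ^+ k) ^+ n.-1)%:E * \int[mu]_(x in dcube k z) (D x / m x)%:E <=
   (2 * (4 + s * (6 * Theta n lam K + 5 * N%:R)))%:E +
   (2 * s^-1 ^+ n.-1)%:E * \int[mu]_(x in dcube k0 z) (lenergy D x / m x ^+ n)%:E)%E.
Proof.
move=> k00 hm s0 mD mm; have mQ := mcube k0.
have m0 x : 0 < m x by apply: lt_le_trans (hm x); exact: expR_gt0.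
have mF := measurable_lenergy mD.
have minv : measurable_fun (dcube k0 z) (fun x => (m x)^-1).
  have -> : (fun x => (m x)^-1) = (fun x => powR (m x) (- 1)).
    by apply/funext => x; rewrite powR_inv1 // ltW.
  by apply: (measurableT_comp (f := fun y : R => powR y (- 1))) => //; exact: measurable_powR.
have mg : measurable_fun (dcube k0 z) (fun x => D x / m x) by apply: measurable_funM.
have mFm : measurable_fun (dcube k0 z) (fun x => lenergy D x / m x ^+ n).
  apply: measurable_funM => //; have -> : (fun x => (m x ^+ n)^-1) = (fun x => (m x)^-1 ^+ n).
    by apply/funext => x; rewrite exprVn.
  exact: measurable_funX.
have g0 x : 0 <= D x / m x by rewrite divr_ge0 // ltW.
have Fm0 x : 0 <= lenergy D x / m x ^+ n by rewrite divr_ge0 ?lenergy_ge0 // exprn_ge0 // ltW.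
pose t := kterm s N.
have t0 k : 0 <= t k by exact: kterm_ge0.
have b0 k : 0 <= (2 ^+ k) ^+ n.-1 :> R by rewrite !exprn_ge0.
have i0 k x : 0 <= \1_(dcube k z) x :> R by rewrite indicE ler0n.
have sn : 0 <= 2 * s^-1 ^+ n.-1 by rewrite mulr_ge0 // exprn_ge0 // invr_ge0 ltW.
pose L x := \sum_(k0 <= k < K) (2 ^+ k) ^+ n.-1 * (\1_(dcube k z) x * (D x / m x)).
have mL1 k : measurable_fun (dcube k0 z) (fun x => (2 ^+ k) ^+ n.-1 * (\1_(dcube k z) x * (D x / m x))).
  by apply: measurable_funM => //; apply: measurable_indicM.
have mt1 k : measurable_fun (dcube k0 z) (fun x => t k * (\1_(dcube k z) x * 1)).
  by apply: measurable_funM => //; apply: measurable_indicM.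
have -> : (\sum_(k0 <= k < K) ((2 ^+ k) ^+ n.-1)%:E * \int[mu]_(x in dcube k z) (D x / m x)%:E =
   \int[mu]_(x in dcube k0 z) (L x)%:E)%E.
  rewrite /L int_sum //; last by move=> k x; apply: mulr_ge0 => //; exact: mulr_ge0.
  rewrite big_nat_cond [RHS]big_nat_cond; apply: eq_bigr => k /andP[/andP[k0k _] _].
  rewrite int_Zl //; [|by apply: measurable_indicM | by move=> x; rewrite mulr_ge0].
  by rewrite -int_indic //; exact: dcube_mono.
pose S x := 2 * (\sum_(k0 <= k < K) t k * (\1_(dcube k z) x * 1)).
have S0 x : 0 <= \sum_(k0 <= k < K) t k * (\1_(dcube k z) x * 1).
  by apply: sumr_ge0 => k _; apply: mulr_ge0 => //; exact: mulr_ge0.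
have mS : measurable_fun (dcube k0 z) (fun x => \sum_(k0 <= k < K) t k * (\1_(dcube k z) x * 1)).
  exact: measurable_sum.
apply: (@le_trans _ _ (\int[mu]_(x in dcube k0 z) (S x + 2 * s^-1 ^+ n.-1 * (lenergy D x / m x ^+ n))%:E)%E).
  apply: int_le => //.
  - by apply: measurable_sum.
  - by apply: measurable_funD; apply: measurable_funM.
  - by move=> x; apply: sumr_ge0 => k _; apply: mulr_ge0 => //; exact: mulr_ge0.
  move=> x _; apply: (le_trans (le_trans _ (kernel_sum_le K x k00 (hm x) s0))).
    rewrite /L [X in _ <= X]big_mkcond; apply: ler_sum => k _; rewrite indicE.
    by case: ifP => _; rewrite ?mul1r // mul0r mulr0.
  rewrite lerD2r /S ler_wpM2l // big_mkcond; apply: ler_sum => k _; rewrite indicE.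
  by case: ifP => _; rewrite ?mulr1 ?mul0r ?mulr0.
rewrite int_D //; last 4 first.
- by apply: measurable_funM.
- by apply: measurable_funM.
- by move=> x; apply: mulr_ge0.
- by move=> x; apply: mulr_ge0.
rewrite int_Zl // int_Zl // leeD2r // int_sum //; last first.
  by move=> k x; apply: mulr_ge0 => //; apply: mulr_ge0.
have E k : (k0 <= k)%N -> (\int[mu]_(x in dcube k0 z) (t k * (\1_(dcube k z) x * 1))%:E =
    ((3 / 4) ^+ k + s * (6 * theta n lam k + (k < 5 * N)%:R))%:E)%E.
  move=> k0k; rewrite int_Zl //; last exact: measurable_indicM.
  rewrite -int_indic //; last exact: dcube_mono.
  rewrite integral_cst // mu_dcube // mul1e -EFinM; congr (_%:E).
  have p0 : (2 ^+ k : R) != 0 by rewrite expf_neq0.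
  rewrite /t /kterm -exprVn; set th := 6 * _ + _.
  have h : (2 ^+ k)^-1 ^+ n * (2 ^+ k) ^+ n = 1 :> R by rewrite -exprMn mulVf // expr1n.
  have h1 : (2 ^+ k)^-1 ^+ n * (2 ^+ k) ^+ n.-1 = (2 ^+ k)^-1 :> R.
    by rewrite -[in X in X * _](prednK (ltnW n2)) exprS -mulrA -exprMn mulVf // expr1n mulr1.
  have -> : (3 / 4) ^+ k = (3 / 2) ^+ k * (2 ^+ k)^-1 :> R.
    by rewrite -exprVn -exprMn; congr (_ ^+ k); lra.
  rewrite mulrDl; congr (_ + _).
    by rewrite -mulrA [X in _ * X]mulrC h1.
  have -> : s * (2 ^+ k) ^+ n * th * (2 ^+ k)^-1 ^+ n = s * th * ((2 ^+ k)^-1 ^+ n * (2 ^+ k) ^+ n) by ring.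
  by rewrite h mulr1.
rewrite big_nat_cond (eq_bigr (fun k => ((3 / 4) ^+ k + s * (6 * theta n lam k + (k < 5 * N)%:R))%:E)); last first.
  by move=> k /andP[/andP[kk _] _]; exact: E.
rewrite -big_nat_cond sumEFin -EFinM lee_fin ler_wpM2l // big_split /= lerD //.
  apply: (le_trans (pow_geo k0 K _)); first by lra.
  by rewrite (_ : 1 - 3 / 4 = 4^-1) ?invrK //; lra.
rewrite -mulr_sumr ler_wpM2l ?(ltW s0) // big_split /= lerD //.
  rewrite -mulr_sumr ler_wpM2l // /Theta.
  by apply: sum_nat_widen => // k; exact: theta_ge0.
by rewrite -natrM; exact: sum_lt_le.
Qed.

End EnergySums.

(** * The logarithmic estimate *)

Section L1Distance.
Variable R : realType.

(** Averages are taken coordinate by coordinate, so distances in the image are measured by a sum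
    over the coordinates. *)
Definition l1dist (k : nat) (p q : k.-tuple R) : R := \sum_(i < k) `|tnth p i - tnth q i|.

Lemma l1distC k (p q : k.-tuple R) : l1dist p q = l1dist q p.
Proof. by apply: eq_bigr => i _; exact: distrC. Qed.

Lemma l1dist_triangle k (p q r : k.-tuple R) : l1dist p r <= l1dist p q + l1dist q r.
Proof.
rewrite /l1dist -big_split /=; apply: ler_sum => i _.
by rewrite -(subrKA (tnth q i)) ler_normD.
Qed.

Lemma l1dist_le k (p q : k.-tuple R) (e : R) :
  (forall i, `|tnth p i - tnth q i| <= e) -> l1dist p q <= k%:R * e.
Proof.
move=> h; apply: (@le_trans _ _ (\sum_(i < k) e)); first by apply: ler_sum.
by rewrite sumr_const card_ord mulr_natl.
Qed.

Lemma ln_lipschitz (a b t : R) : 0 < t -> t <= a -> t <= b -> `|ln a - ln b| <= `|a - b| / t.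
Proof.
move=> t0; wlog ab : a b / b <= a => [h ta tb|ta tb].
  by have [ab|/ltW ba] := leP b a; [exact: h | rewrite distrC (distrC a); exact: h].
have b0 : 0 < b by exact: lt_le_trans tb.
have a0 : 0 < a by exact: lt_le_trans ta.
rewrite !ger0_norm ?subr_ge0 ?ler_ln ?posrE // -ln_div ?posrE //.
have h := @le_ln1Dx R (a / b - 1).
have ab1 : 1 <= a / b by rewrite ler_pdivlMr // mul1r.
have : ln (a / b) <= a / b - 1.
  by rewrite -{1}(subrKC 1 (a / b)); apply: h; lra.
move=> /le_trans; apply.
have -> : a / b - 1 = (a - b) / b by rewrite mulrBl divff // gt_eqF.
by rewrite ler_wpM2l ?subr_ge0 // lef_pV2 ?posrE.
Qed.

Lemma exists_min (a b : R) : 0 < a -> 0 < b -> exists t,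
  [/\ 0 < t, t <= a, t <= b & forall y, y <= 2 * a -> y <= 2 * b -> y <= 2 * t].
Proof.
by move=> a0 b0; have [ab|/ltW ba] := leP a b; [exists a | exists b].
Qed.

Lemma ln_le_sub1 (y : R) : 0 < y -> ln y <= y - 1.
Proof.
by move=> y0; have := @ln_ge_frac R y^-1; rewrite invr_gt0 invrK lnV ?posrE // => /(_ y0); lra.
Qed.

(** A substitute for Jensen's inequality: with [dl] the volume of a cell and [a = S^-n], integrating
    over the cell and dividing by [dl] bounds the mean of [ln a] by [1 - ln dl] plus the integral of
    [S^-n]. The slack from [-1] to [1] keeps this bound nonnegative for [dl <= 1]. *)
Lemma ln_scaled_bound (a dl r : R) : 0 < a -> 0 < dl -> dl * a <= r -> ln a <= 1 - ln dl + r.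
Proof.
by move=> a0 dl0 h; have := ln_le_sub1 (mulr_gt0 dl0 a0); rewrite lnM ?posrE //; lra.
Qed.

Lemma max_lipschitz (a b e : R) : `|Num.max a e - Num.max b e| <= `|a - b|.
Proof.
have [ae|ae] := leP a e; have [be|be] := leP b e.
- by rewrite subrr normr0.
- by rewrite !ler0_norm; lra.
- by rewrite !ger0_norm; lra.
- by [].
Qed.

Lemma l1dist_lipschitz k (p q r : k.-tuple R) : `|l1dist p r - l1dist q r| <= l1dist p q.
Proof.
rewrite ler_norml; have := l1dist_triangle p q r; have := l1dist_triangle q p r.
by rewrite (l1distC q p) => h1 h2; apply/andP; split; lra.
Qed.

End L1Distance.

Section Logarithm.
Variables (R : realType) (n d : nat) (lam : R).
Local Notation T := (n.-tuple R).
Local Notation Z := {ffun 'I_n -> int}.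
Variables (mu : {measure set T -> \bar R}) (Om : set T) (f : T -> d.-tuple R).
Variable (G : 'I_d -> 'I_n -> T -> R).
Hypotheses (Hmu : lebesgue_on_boxes mu) (n2 : (2 <= n)%N) (oOm : is_open Om).
Hypotheses (HS : sobolev_W1p_with mu Om n f G) (cf : continuous_on Om f).
Local Notation D := (jac_norm G).
Hypotheses (lam0 : 0 <= lam) (HF : (\int[mu]_(y in Om) (lenergy lam D y)%:E < +oo)%E).

Lemma cnext_close M (c : Z) j (x y : T) i : box M c 0 x -> box M (cnext j c) 0 y ->
  `|tnth x i - tnth y i| <= 2 / 2 ^+ M.
Proof.
move=> /(_ i) /andP[x1 x2] /(_ i) /andP[y1 y2].
have p0 : 0 < 2 ^+ M :> R by rewrite exprn_gt0.
rewrite ler_pdivlMr // -[X in _ * X](ger0_norm (ltW p0)) -normrM ler_norml mulrC mulrBr.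
move: y1 y2 x1 x2; rewrite expr0 ffunE; case: (i == j); last first.
  by move=> y1 y2 x1 x2; apply/andP; split; lra.
by rewrite intrD /= => y1 y2 x1 x2; apply/andP; split; lra.
Qed.

(** Cells contain their upper corner. Testing the two inclusions there gives inequalities between
    integer corners, and these control the closed hull. *)
Lemma double_cell M k0 z c j : (k0 <= M)%N ->
  box M c 0 `<=` dcube k0 z -> box M (cnext j c) 0 `<=` dcube k0 z ->
  forall x : T, (forall i, (c i)%:~R <= 2 ^+ M * tnth x i <= (c i)%:~R + (i == j)%:R + 1) -> ccell k0 z x.
Proof.
move=> kM s1 s2 x hx i.
have p0 : 0 < 2 ^+ k0 :> R by rewrite exprn_gt0.
have q0 : 0 < 2 ^+ (M - k0) :> R by rewrite exprn_gt0.
have pq : 2 ^+ M = 2 ^+ (M - k0) * 2 ^+ k0 :> R by rewrite -exprD subnK.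
pose top (b : Z) : T := [tuple ((b i)%:~R + 1) / 2 ^+ M | i < n].
have htop (b : Z) : box M b 0 (top b).
  by move=> l; rewrite tnth_mktuple mulrC divfK ?expf_neq0 // expr0 lexx ltrDl ltr01.
have tE (b : Z) : 2 ^+ (M - k0) * (2 ^+ k0 * tnth (top b) i) = (b i)%:~R + 1.
  by rewrite mulrA -pq tnth_mktuple mulrC divfK // expf_neq0.
have := s1 _ (htop c) i; have := s2 _ (htop (cnext j c)) i.
rewrite expr0 => /andP[_]; rewrite -(ler_pM2l q0) tE => h2 /andP[]; rewrite -(ltr_pM2l q0) tE => h1 _.
have h3 : 2 ^+ (M - k0) * (idx k0 z i)%:~R <= (c i)%:~R :> R.
  move: h1; rewrite -[2 ^+ (M - k0)]/((2%:Z)%:~R ^+ (M - k0)) -rmorphXn -rmorphM /=.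
  by rewrite -[_ + 1](@intrD R _ 1) ltr_int ler_int ltzD1.
have := hx i; rewrite pq -(ler_pM2l q0 _ (2 ^+ k0 * _)) -(ler_pM2l q0 (2 ^+ k0 * _)) !mulrA => /andP[x1 x2].
apply/andP; split; first by lra.
apply: (le_trans x2); apply: le_trans h2.
rewrite /cnext ffunE; case: (i == j); rewrite ?addr0 //.
by rewrite intrD.
Qed.

Let mOm : measurable Om.
Proof. exact: dopen_measurable (is_open_dopen oOm). Qed.

Lemma jac_norm_ge0 x : 0 <= D x. Proof. exact: sqrtr_ge0. Qed.

Lemma jac_norm_ge i j x : `|G i j x| <= D x.
Proof.
rewrite -sqrtr_sqr ler_wsqrtr // (bigD1 i) //= (bigD1 j) //= -addrA lerDl.
by rewrite addr_ge0 // sumr_ge0 // => *; rewrite ?sumr_ge0 // => *; rewrite sqr_ge0.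
Qed.

Lemma measurable_jac_norm : measurable_fun Om D.
Proof.
have [_ hG _] := HS; apply: (measurableT_comp (f := @Num.sqrt R)).
  apply: continuous_measurable_fun; exact: sqrt_continuous.
apply: measurable_sum => i; apply: measurable_sum => j; apply: measurable_funX.
by have [] := hG i j.
Qed.

Lemma measurable_coord i : measurable_fun Om (fun x => tnth (f x) i).
Proof. by have [hf _ _] := HS; have [] := hf i. Qed.

Definition vavg (M : nat) (c : Z) : d.-tuple R :=
  [tuple favg mu Om (fun x => tnth (f x) i) M c | i < d].

Lemma vavg_close M c (p : d.-tuple R) (eta : R) : box M c 0 `<=` Om -> 0 <= eta ->
  (forall x, box M c 0 x -> forall i, `|tnth (f x) i - tnth p i| <= eta) ->
  l1dist (vavg M c) p <= d%:R * eta.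
Proof.
move=> cO e0 h; apply: l1dist_le => i; rewrite tnth_mktuple.
have [hf _ _] := HS.
by apply: (favg_close Hmu (ltnW n2) oOm (hf i)) => // x bx; exact: h.
Qed.

Definition vavg_cst : R := d%:R * ((expR (- 8) / 2) ^+ n)^-1.

Lemma vavg_cst_ge0 : 0 <= vavg_cst.
Proof. by rewrite mulr_ge0 // invr_ge0 exprn_ge0 // divr_ge0 // expR_ge0. Qed.

Lemma vavg_next j M c : box M c 0 `<=` Om -> box M (cnext j c) 0 `<=` Om ->
  (forall x : T, (forall i, (c i)%:~R <= 2 ^+ M * tnth x i <= (c i)%:~R + (i == j)%:R + 1) -> Om x) ->
  ((l1dist (vavg M (cnext j c)) (vavg M c))%:E <= (vavg_cst * (2 ^+ M) ^+ n.-1)%:E *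
    (\int[mu]_(x in box M c 0) (D x)%:E + \int[mu]_(x in box M (cnext j c) 0) (D x)%:E))%E.
Proof.
move=> b1 b2 hO; have [hf hG wk] := HS.
set I1 := (\int[mu]_(x in box M c 0) (D x)%:E)%E.
set I2 := (\int[mu]_(x in box M (cnext j c) 0) (D x)%:E)%E.
have mb (b : Z) : measurable (box M b 0 : set T) by exact: measurable_box.
have mD (b : Z) : box M b 0 `<=` Om -> measurable_fun (box M b 0) D.
  by move=> bO; apply: measurable_funS measurable_jac_norm.
have mG i (b : Z) : box M b 0 `<=` Om -> measurable_fun (box M b 0) (fun x => `|G i j x|).
  move=> bO; apply: measurableT_comp => //; apply: measurable_funS bO _ => //.
  by have [] := hG i j.
have p0 : (2 ^+ M : R) != 0 by rewrite expf_neq0.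
have pe : (2 ^+ M) ^+ n / 2 ^+ M = (2 ^+ M) ^+ n.-1 :> R.
  by rewrite -[in LHS](prednK (ltnW n2)) exprS mulrAC divff // mul1r.
rewrite /l1dist -sumEFin.
apply: (@le_trans _ _ (\sum_(i < d) (((expR (- 8) / 2) ^+ n)^-1 * (2 ^+ M) ^+ n.-1)%:E * (I1 + I2))%E).
  apply: lee_sum => i _; rewrite !tnth_mktuple.
  have wki : forall phi : T -> R, test_fun Om phi ->
    (\int[mu]_(x in Om) (tnth (f x) i * pderiv j phi x)%:E =
     - \int[mu]_(x in Om) (G i j x * phi x)%:E)%E by move=> phi; exact: wk.
  apply: le_trans (favg_next Hmu (ltnW n2) oOm (hf i) (hG i j) wki hO) _.
  rewrite -mulrA pe lee_wpmul2l ?lee_fin ?mulr_ge0 ?exprn_ge0 ?invr_ge0 ?divr_ge0 ?expR_ge0 ?exprn_ge0 ?divr_ge0 ?expR_ge0 //.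
  apply: leeD; apply: int_le => //; try exact: mG; try exact: mD; by move=> x _; exact: jac_norm_ge.
rewrite -ge0_sume_distrl; last first.
  by move=> i _; rewrite lee_fin mulr_ge0 ?exprn_ge0 // invr_ge0 exprn_ge0 // divr_ge0 // expR_ge0.
have -> : (\sum_(i < d) (((expR (- 8) / 2) ^+ n)^-1 * (2 ^+ M) ^+ n.-1)%:E)%E = (vavg_cst * (2 ^+ M) ^+ n.-1)%:E.
  rewrite sumEFin sumr_const card_ord /vavg_cst -mulrA; congr (_%:E); exact: esym (mulr_natl _ _).
by [].
Qed.

Section LogMean.
Variables (z : T) (k0 N : nat).
Hypothesis hz : ccell k0 z `<=` Om.
Let e : R := expR (- N%:R).
Definition lmax (x : T) : R := Num.max (l1dist (f x) (f z)) e.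

Let e0 : 0 < e. Proof. exact: expR_gt0. Qed.

Lemma lmax_ge x : expR (- N%:R) <= lmax x. Proof. by rewrite le_max lexx orbT. Qed.

Lemma lmax_gt0 x : 0 < lmax x. Proof. exact: lt_le_trans e0 (lmax_ge x). Qed.

Lemma measurable_lmax : measurable_fun Om lmax.
Proof.
apply: measurable_maxr => //; apply: measurable_sum => i; apply: measurableT_comp => //.
by apply: measurable_funB => //; exact: measurable_coord.
Qed.

(** [M] is so fine that an average is within [e / 2] of the values of [f] on its cell and on
    adjacent cells of the starting cell; hence [lmax <= 2 * S] there, [S] being the truncated
    distance from the average to [f z]. As [ln] is [1/t]-Lipschitz above [t], the difference bound
    for averages becomes one for [V] in terms of [D / lmax]. At the cell of [z] the average is
    closer than [e] to [f z], so [V] equals [N] exactly. *)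
Lemma log_mean_bound : exists M0, forall M, (M0 <= M)%N ->
  N%:R <= 1 - ln ((2 ^+ k0) ^- n) + 2 ^+ n * fine (\int[mu]_(x in dcube k0 z) (lmax x ^- n)%:E) +
    4 * n%:R * (2 * vavg_cst) * 2 ^+ n.-1 * \sum_(k0 <= k < M) (2 ^+ k) ^+ n.-1 *
        fine (\int[mu]_(x in dcube k z) (D x / lmax x)%:E).
Proof.
pose eta : R := e / (2 * d.+1%:R).
have eta0 : 0 < eta by rewrite divr_gt0 // mulr_gt0 // ltr0n.
have deta : d%:R * eta <= e / 2.
  have h : (d%:R : R) / d.+1%:R <= 1 by rewrite ler_pdivrMr ?ltr0n // mul1r ler_nat.
  have -> : d%:R * eta = (d%:R / d.+1%:R) * (e / 2) by rewrite /eta invfM; ring.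
  by rewrite ler_piMl // divr_ge0 // ltW.
have [M0 hM0] := ccell_unif_continuous cf hz eta0.
exists (maxn M0 k0) => M; rewrite geq_max => /andP[M0M kM].
set Q0 := dcube k0 z.
have QO : Q0 `<=` Om by move=> x /ccell_dcube; exact: hz.
have mQ : measurable Q0 by exact: measurable_box.
have hx x y : Q0 x -> Q0 y -> (forall i, `|tnth x i - tnth y i| <= 2 / 2 ^+ M) ->
    forall i, `|tnth (f x) i - tnth (f y) i| <= eta.
  by move=> /ccell_dcube Qx /ccell_dcube Qy; exact: hM0.
have p2 : 0 < 2 ^+ M :> R by rewrite exprn_gt0.
pose S (c : Z) : R := Num.max (l1dist (vavg M c) (f z)) e.
pose V (c : Z) : R := - ln (S c).
have S0 c : 0 < S c by rewrite lt_max e0 orbT.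
have near_val (c : Z) x : box M c 0 `<=` Q0 -> Q0 x ->
    (forall y, box M c 0 y -> forall i, `|tnth y i - tnth x i| <= 2 / 2 ^+ M) ->
    lmax x <= 2 * S c.
  move=> cQ Qx hc; have h : l1dist (vavg M c) (f x) <= e / 2.
    apply: le_trans deta; apply: vavg_close => //; [exact: subset_trans QO | exact: ltW |].
    by move=> y cy; apply: hx => //; [exact: cQ | exact: hc].
  have h2 := l1dist_triangle (f x) (vavg M c) (f z); rewrite (l1distC (f x) (vavg M c)) in h2.
  have h3 : l1dist (vavg M c) (f z) <= S c by rewrite le_max lexx.
  have h4 : e <= S c by rewrite le_max lexx orbT.
  by rewrite /lmax -/e ge_max; move: h h2 h3 h4 e0; move: (S c) (e) => Sc e' h h2 h3 h4 e0'; apply/andP; split; lra.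
have close1 (c : Z) x y i : box M c 0 x -> box M c 0 y -> `|tnth x i - tnth y i| <= 2 / 2 ^+ M.
  move=> bx by_; apply: (le_trans (box_close i bx by_)).
  by rewrite ler_pM2r ?invr_gt0 // expr0 ler1n.
have nearc (c : Z) x : box M c 0 `<=` Q0 -> box M c 0 x -> lmax x <= 2 * S c.
  by move=> cQ cx; apply: near_val => // [|y cy i]; [exact: cQ | exact: close1 cy cx].
have nearc' (c : Z) j x : box M c 0 `<=` Q0 -> box M (cnext j c) 0 `<=` Q0 ->
    box M c 0 x -> lmax x <= 2 * S (cnext j c).
  move=> cQ cQ' cx; apply: near_val => // [|y cy i]; first exact: cQ.
  by rewrite distrC; exact: cnext_close cx cy.
have nearc'' (c : Z) j x : box M c 0 `<=` Q0 -> box M (cnext j c) 0 `<=` Q0 ->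
    box M (cnext j c) 0 x -> lmax x <= 2 * S c.
  move=> cQ cQ' cx; apply: near_val => // [|y cy i]; first exact: cQ'.
  exact: cnext_close cy cx.
have Vz : V (idx M z) = N%:R.
  rewrite /V /S; have -> : Num.max (l1dist (vavg M (idx M z)) (f z)) e = e.
    apply/max_idPr; apply: (@le_trans _ _ (e / 2)); last by rewrite ler_pdivrMr // ler_peMr ?ler1n // ltW.
    apply: le_trans deta; apply: vavg_close => //; last first.
    - move=> x bx i; apply: hx; [exact: dcube_mono kM _ bx | exact: dcube_refl | move=> i'].
      exact: close1 bx (dcube_refl M z).
    - exact: ltW.
    - by apply: subset_trans QO; exact: dcube_mono.
  by rewrite expRK opprK.
have mD : measurable_fun Q0 D by apply: measurable_funS measurable_jac_norm.
have mm : measurable_fun Q0 lmax by apply: measurable_funS measurable_lmax.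
have minv : measurable_fun Q0 (fun x => (lmax x)^-1).
  have -> : (fun x => (lmax x)^-1) = (fun x => powR (lmax x) (- 1)).
    by apply/funext => x; rewrite powR_inv1 // ltW // lmax_gt0.
  by apply: (measurableT_comp (f := fun y : R => powR y (- 1))) => //; exact: measurable_powR.
have mg : measurable_fun Q0 (fun x => D x / lmax x) by apply: measurable_funM.
have mg2 : measurable_fun Q0 (fun x => lmax x ^- n).
  have -> : (fun x => lmax x ^- n) = (fun x => (lmax x)^-1 ^+ n) by apply/funext => x; rewrite exprVn.
  exact: measurable_funX.
have g0 x : 0 <= D x / lmax x by rewrite divr_ge0 ?jac_norm_ge0 // ltW // lmax_gt0.
have g20 x : 0 <= lmax x ^- n by rewrite invr_ge0 exprn_ge0 // ltW // lmax_gt0.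
have [nu nuE] := restricted_density mu mQ mg g0.
have D1 x : D x <= 1 + D x ^+ n.
  have D0 := jac_norm_ge0 x; have [D1|D1] := leP (D x) 1; first by have := exprn_ge0 n D0; lra.
  have h : D x <= D x ^+ n by apply: ler_eXnr; [exact: ltnW | exact: ltW].
  lra.
have mx x : (lmax x)^-1 <= e^-1.
  by rewrite lef_pV2 ?posrE ?lmax_gt0 // lmax_ge.
have Q0f : (\int[mu]_(x in Q0) (1 : R)%:E < +oo)%E.
  by rewrite integral_cst // mu_dcube // ltry.
have nuf : (nu setT < +oo)%E.
  rewrite nuE setTI.
  apply: (@le_lt_trans _ _ (\int[mu]_(x in Q0) (e^-1 * (1 + D x ^+ n))%:E)%E).
    apply: int_le => //.
      by apply: measurable_funM => //; apply: measurable_funD => //; apply: measurable_funX.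
    by move=> x _; rewrite mulrC; apply: ler_pM => //; rewrite ?jac_norm_ge0 // invr_ge0 ltW // lmax_gt0.
  rewrite int_Zl //.
  - rewrite int_D //.
    + rewrite lte_mul_pinfty ?lee_fin ?invr_ge0 ?ltW // lte_add_pinfty //.
      apply: le_lt_trans HF; apply: (@le_trans _ _ (\int[mu]_(x in Q0) (lenergy lam D x)%:E)%E).
        apply: int_le => //; [exact: measurable_funX | exact: measurable_lenergy | |].
          by move=> x; rewrite exprn_ge0 // jac_norm_ge0.
        by move=> x _; exact: (lenergy_ge lam0 jac_norm_ge0).
      apply: ge0_subset_integral => //.
      * by apply/measurable_EFinP; apply: measurable_lenergy; exact: measurable_jac_norm.
      * by move=> x _; rewrite lee_fin; exact: (lenergy_ge0 lam jac_norm_ge0).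
    + exact: measurable_funX.
    + by move=> x; rewrite exprn_ge0 // jac_norm_ge0.
  - by apply: measurable_funD => //; apply: measurable_funX.
  - by move=> x; rewrite addr_ge0 // exprn_ge0 // jac_norm_ge0.
  - by rewrite invr_ge0 ltW.
pose dl : R := (2 ^+ k0) ^- n.
have dl0 : 0 < dl by rewrite invr_gt0 !exprn_gt0.
have lnd : ln dl <= 0.
  by rewrite ln_le0 // invf_le1 ?exprn_gt0 // exprn_ege1 // exprn_ege1 // ler1n.
have mg3 : measurable_fun Q0 (fun x => 1 - ln dl + dl * 2 ^+ n * lmax x ^- n).
  by apply: measurable_funD => //; apply: measurable_funM.
have g30 x : 0 <= 1 - ln dl + dl * 2 ^+ n * lmax x ^- n.
  have : 0 <= dl * 2 ^+ n * lmax x ^- n by rewrite !mulr_ge0 ?exprn_ge0 // ltW.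
  lra.
(* The density of [nu2] is the pointwise bound [Vpt] for [V]; integrated over fine cells, it makes
   the upper bound for the starting mean an instance of [wavg_le]. *)
have [nu2 nu2E] := restricted_density mu mQ mg3 g30.
have nu2f : (nu2 setT < +oo)%E.
  rewrite nu2E setTI.
  apply: (@le_lt_trans _ _ (\int[mu]_(x in Q0) (1 - ln dl + dl * 2 ^+ n * e^-1 ^+ n)%:E)%E).
    apply: int_le => //; move=> x _; rewrite lerD2l ler_wpM2l ?mulr_ge0 ?exprn_ge0 ?(ltW dl0) //.
    by rewrite -exprVn lerXn2r ?nnegrE ?invr_ge0 ?(ltW e0) // ltW // lmax_gt0.
  by rewrite integral_cst // mu_dcube // -EFinM ltry.
have acst : 0 <= 2 * vavg_cst by rewrite mulr_ge0 // vavg_cst_ge0.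
have nu1fin A : measurable A -> nu A \is a fin_num by exact: fin_num_nu.
have Vnext : forall j c, box M c 0 `<=` Q0 -> box M (cnext j c) 0 `<=` Q0 ->
    `|V (cnext j c) - V c| <= 2 * vavg_cst * (2 ^+ M) ^+ n.-1 *
       (fine (nu (box M c 0)) + fine (nu (box M (cnext j c) 0))).
  move=> j c cQ cQ'.
  have mb (b : Z) : measurable (box M b 0 : set T) by exact: measurable_box.
  (* [t] is the smaller of the two truncated distances; it cancels between the Lipschitz bound for
     [ln] and [D <= 2 * t * (D / lmax)]. *)
  have [t [t0 tc tc' tmin]] := exists_min (S0 c) (S0 (cnext j c)).
  have tm x : box M c 0 x \/ box M (cnext j c) 0 x -> D x <= 2 * t * (D x / lmax x).
    move=> hxc; have h : lmax x <= 2 * t.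
      case: hxc => hxc; apply: tmin.
      - exact: nearc.
      - exact: nearc'.
      - exact: (nearc'' c j x cQ cQ' hxc).
      - exact: nearc.
    rewrite mulrA ler_pdivlMr ?lmax_gt0 // mulrC ler_wpM2r //; exact: jac_norm_ge0.
  have Ib (b : Z) : box M b 0 `<=` Q0 -> (forall x, box M b 0 x -> D x <= 2 * t * (D x / lmax x)) ->
      (\int[mu]_(x in box M b 0) (D x)%:E <= (2 * t * fine (nu (box M b 0)))%:E)%E.
    move=> bQ hb; rewrite [X in (_ <= X)%E]EFinM fineK; last exact: nu1fin.
    rewrite nuE (setIidl bQ) -int_Zl //; last 2 first.
    - by apply: measurable_funS mg.
    - by rewrite mulr_ge0 // ltW.
    apply: int_le => //.
    - by apply: measurable_funS mD.
    - by apply: measurable_funM => //; apply: measurable_funS mg.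
    - exact: jac_norm_ge0.
  have L : l1dist (vavg M (cnext j c)) (vavg M c) <=
      vavg_cst * (2 ^+ M) ^+ n.-1 * (2 * t * (fine (nu (box M c 0)) + fine (nu (box M (cnext j c) 0)))).
    have hdc x : (forall i, (c i)%:~R <= 2 ^+ M * tnth x i <= (c i)%:~R + (i == j)%:R + 1) -> Om x.
      by move=> hxx; apply: hz; apply: (double_cell kM cQ cQ' hxx).
    rewrite -lee_fin; apply: (le_trans (vavg_next (subset_trans cQ QO) (subset_trans cQ' QO) hdc)).
    rewrite [X in (_ <= X)%E]EFinM lee_wpmul2l ?lee_fin ?mulr_ge0 ?vavg_cst_ge0 ?exprn_ge0 //.
    rewrite mulrDr EFinD; apply: leeD; apply: Ib => // x bx; apply: tm; by [left|right].
  have Sl : `|S (cnext j c) - S c| <= l1dist (vavg M (cnext j c)) (vavg M c).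
    by apply: le_trans (max_lipschitz _ _ _) _; exact: l1dist_lipschitz.
  rewrite /V opprK addrC -[_ + _]opprB normrN.
  apply: (le_trans (ln_lipschitz t0 tc' tc)).
  rewrite ler_pdivrMr //; apply: (le_trans Sl); apply: (le_trans L).
  by rewrite le_eqVlt; apply/orP; left; apply/eqP; ring.
have chain := @wavg_chain R n M nu V (2 * vavg_cst) z k0 nuf acst kM (ltnW n2) Vnext.
have Vpt c x : box M c 0 `<=` Q0 -> box M c 0 x -> V c <= 1 - ln dl + dl * 2 ^+ n * lmax x ^- n.
  move=> cQ cx; have [V0|V0] := leP (V c) 0; first by apply: (le_trans V0); exact: g30.
  have an0 : 0 < S c ^- n by rewrite invr_gt0 exprn_gt0.
  have h1 : V c <= ln (S c ^- n).
    rewrite lnV ?posrE ?exprn_gt0 // lnXn // -mulNrn -[- ln _]/(V c) -[X in _ <= X]mulr_natl.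
    by rewrite ler_peMl ?(ltW V0) // ler1n ltnW.
  have h3 : dl * S c ^- n <= dl * 2 ^+ n * lmax x ^- n.
    rewrite -mulrA ler_wpM2l ?(ltW dl0) // ler_pdivlMr ?exprn_gt0 ?lmax_gt0 // mulrC.
    rewrite ler_pdivrMr ?exprn_gt0 // -exprMn lerXn2r ?nnegrE ?(ltW (lmax_gt0 _)) //.
      by rewrite mulr_ge0 // ltW.
    exact: nearc.
  exact: le_trans h1 (ln_scaled_bound an0 dl0 h3).
have Vup : forall c, box M c 0 `<=` Q0 -> V c * (2 ^+ M) ^- n <= fine (nu2 (box M c 0)).
  move=> c cQ; have [V0|V0] := leP (V c) 0.
    apply: (@le_trans _ _ 0); last exact: fine_nu_ge0.
    by rewrite mulr_le0_ge0 // invr_ge0 !exprn_ge0.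
  have mb : measurable (box M c 0 : set T) by exact: measurable_box.
  rewrite -lee_fin fineK; last exact: fin_num_nu.
  rewrite nu2E (setIidl cQ).
  have -> : ((V c * (2 ^+ M) ^- n)%:E = \int[mu]_(x in box M c 0) (V c)%:E)%E.
    by rewrite integral_cst // mu_box // expr0 mul1r exprVn -EFinM.
  apply: int_le => //.
  - by apply: measurable_funS mg3.
  - by move=> _; exact: ltW.
  - by move=> x bx; exact: Vpt.
have upper := @wavg_le R n M nu2 nu2f Q0 V ((2 ^+ M) ^- n) Vup (M - k0) (corner M z k0).
have W : wavg V (M - k0) (corner M z k0) <= 1 - ln dl + 2 ^+ n * fine (\int[mu]_(x in Q0) (lmax x ^- n)%:E).
  have cE : (2 ^+ M) ^- n * (2 ^+ n) ^+ (M - k0) = dl.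
    have -> : (2 ^+ n) ^+ (M - k0) = (2 ^+ (M - k0)) ^+ n :> R by rewrite -!exprM mulnC.
    rewrite /dl -{1}(subnK kM) exprD exprMn invfM mulrAC mulVf ?mul1r //.
  have := upper _; rewrite cE box_corner // => /(_ (@subset_refl _ _)).
  have -> : fine (nu2 (dcube k0 z)) = dl * (1 - ln dl + 2 ^+ n * fine (\int[mu]_(x in Q0) (lmax x ^- n)%:E)).
    rewrite nu2E setIid int_D //.
    - rewrite integral_cst // mu_dcube // int_Zl //; last by rewrite mulr_ge0 ?exprn_ge0 // ltW.
      have I3 : (\int[mu]_(x in Q0) (lmax x ^- n)%:E)%E \is a fin_num.
        rewrite ge0_fin_numE; last by apply: integral_ge0 => x _; rewrite lee_fin.
        apply: (@le_lt_trans _ _ (\int[mu]_(x in Q0) (e^-1 ^+ n)%:E)%E).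
          apply: int_le => // x _.
          by rewrite -exprVn lerXn2r ?nnegrE ?invr_ge0 ?(ltW e0) // ltW // lmax_gt0.
        by rewrite integral_cst // mu_dcube // -EFinM ltry.
      rewrite -(fineK I3) -!EFinM -EFinD /=; rewrite -/dl; ring.
    - by apply: measurable_funM.
    - by move=> _; lra.
    - by move=> x; rewrite !mulr_ge0 ?exprn_ge0 // ltW.
  by rewrite mulrC ler_pM2l.
rewrite Vz in chain.
have nuD k : (k0 <= k)%N -> nu (dcube k z) = (\int[mu]_(x in dcube k z) (D x / lmax x)%:E)%E.
  by move=> k0k; rewrite nuE setIidl //; exact: dcube_mono.
rewrite (_ : \sum_(k0 <= k < M) (2 ^+ k) ^+ n.-1 * fine (\int[mu]_(x in dcube k z) (D x / lmax x)%:E) =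
   \sum_(k0 <= k < M) (2 ^+ k) ^+ n.-1 * fine (nu (dcube k z))); last first.
  rewrite big_nat_cond [RHS]big_nat_cond; apply: eq_bigr => k /andP[/andP[kk _] _].
  by rewrite nuD.
have := ler_norm (N%:R - wavg V (M - k0) (corner M z k0)).
rewrite -/dl; move: chain W; move: (wavg _ _ _) => w chain W h.
by have := le_trans h chain; move: (\sum_(k0 <= k < M) _) => SS; lra.
Qed.

End LogMean.

End Logarithm.

(** * Layer-cake estimate *)

Section LayerCake.
Variable R : realType.

(* The layer [l] dominates on [{e^-(l+1) <= u < e^-l}], and the first term where [u >= e^-l0]. *)
Lemma layer_cake (n N l0 : nat) (u : R) : (l0 <= N)%N ->
  (Num.max u (expR (- N%:R))) ^- n <=
  expR l0%:R ^+ n + \sum_(l0 <= l < N) expR l.+1%:R ^+ n * (u < expR (- l%:R))%R%:R.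
Proof.
move=> lN; rewrite -(subnK lN); elim: (N - l0)%N => [|k IH].
  rewrite add0n [X in _ <= _ + X]big_geq // addr0 -[X in _ <= X ^+ _]invrK -expRN exprVn.
  by rewrite lef_pV2 ?posrE ?exprn_gt0 ?lt_max ?expR_gt0 ?orbT // lerXn2r ?nnegrE ?le_max ?lexx ?expR_ge0 ?orbT.
rewrite addSn big_nat_recr ?leq_addl //= addrA.
have [h|h] := ltP u (expR (- (k + l0)%:R)).
  rewrite mulr1 -[X in X <= _]add0r lerD //.
    by rewrite addr_ge0 ?exprn_ge0 ?expR_ge0 // sumr_ge0 // => i _; rewrite mulr_ge0 // exprn_ge0 // expR_ge0.
  rewrite -[X in _ <= X ^+ _]invrK -expRN exprVn.
  by rewrite lef_pV2 ?posrE ?exprn_gt0 ?lt_max ?expR_gt0 ?orbT // lerXn2r ?nnegrE ?le_max ?lexx ?expR_ge0 ?orbT.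
rewrite mulr0 addr0; apply: le_trans IH.
by rewrite (max_idPl h) (max_idPl (le_trans _ h)) // ler_expR lerN2 ler_nat.
Qed.

Lemma fine_weighted_sum (k0 K : nat) (w : nat -> R) (I : nat -> \bar R) (X : R) :
  (forall k, (k0 <= k)%N -> I k \is a fin_num) ->
  (\sum_(k0 <= k < K) (w k)%:E * I k <= X%:E)%E -> \sum_(k0 <= k < K) w k * fine (I k) <= X.
Proof.
move=> If; rewrite big_nat_cond (eq_bigr (fun k => (w k * fine (I k))%:E)).
  by rewrite -big_nat_cond sumEFin lee_fin.
by move=> k /andP[/andP[kk _] _]; rewrite EFinM fineK // If.
Qed.

Lemma fine_le_real (x : \bar R) (r : R) : (0 <= x)%E -> (x <= r%:E)%E -> fine x <= r.
Proof. by case: x. Qed.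

End LayerCake.

(** * Energy over preimages of small balls *)

Section SlowImage.
Variables (R : realType) (n d : nat) (lam : R).
Local Notation T := (n.-tuple R).
Variables (mu : {measure set T -> \bar R}) (Om : set T) (f : T -> d.-tuple R).
Variable (G : 'I_d -> 'I_n -> T -> R).
Hypotheses (Hmu : lebesgue_on_boxes mu) (n2 : (2 <= n)%N) (oOm : is_open Om).
Hypotheses (HS : sobolev_W1p_with mu Om n f G) (cf : continuous_on Om f).
Local Notation D := (jac_norm G).
Local Notation F := (lenergy lam D).
Hypotheses (lam0 : 0 <= lam) (lam1 : lam <= (n.-1)%:R).
Hypothesis HF : (\int[mu]_(y in Om) (F y)%:E < +oo)%E.

Let mOm : measurable Om.
Proof. exact: dopen_measurable (is_open_dopen oOm). Qed.

Let mD := measurable_jac_norm HS.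

Let mF : measurable_fun Om F.
Proof. exact: measurable_lenergy. Qed.

Let F0 x : 0 <= F x.
Proof. exact: lenergy_ge0 (jac_norm_ge0 G) x. Qed.

Lemma energy_fin (Q : set T) : measurable Q -> Q `<=` Om -> (mu Q < +oo)%E ->
  (\int[mu]_(x in Q) (1 + F x)%:E < +oo)%E.
Proof.
move=> mQ QO Qf; rewrite int_D //; last exact: measurable_funS mF.
rewrite lte_add_pinfty //; first by rewrite integral_cst // mul1e.
apply: le_lt_trans HF; apply: ge0_subset_integral => //.
  exact/measurable_EFinP.
by move=> x _; rewrite lee_fin.
Qed.

Let D_le_F x : D x <= 1 + F x.
Proof.
have D0 := jac_norm_ge0 G x; have h := lenergy_ge lam0 (jac_norm_ge0 G) x.
have [D1|D1] := leP (D x) 1; first by have := F0 x; lra.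
have h2 : D x <= D x ^+ n by apply: ler_eXnr; [exact: ltnW | exact: ltW].
lra.
Qed.

Section AtPoint.
Variables (z : T) (k0 N : nat).
Hypothesis hz : dcube k0 z `<=` Om.
Local Notation m := (lmax f z N).
Let Q0 := dcube k0 z.
Let mQ : measurable Q0. Proof. exact: measurable_box. Qed.

Let mS (g : T -> R) : measurable_fun Om g -> measurable_fun Q0 g.
Proof. by move=> mg; apply: measurable_funS mg. Qed.

Lemma measurable_lmax_inv : measurable_fun Q0 (fun x => (m x)^-1).
Proof.
have -> : (fun x => (m x)^-1) = (fun x => powR (m x) (- 1)).
  by apply/funext => x; rewrite powR_inv1 // ltW // lmax_gt0.
apply: (measurableT_comp (f := fun y : R => powR y (- 1))); first exact: measurable_powR.
by apply: mS; exact: (measurable_lmax HS).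
Qed.

Lemma ratio_le x : D x / m x <= expR N%:R * D x.
Proof.
rewrite mulrC ler_wpM2r ?jac_norm_ge0 // -[X in _ <= X]invrK -expRN lef_pV2 ?posrE ?expR_gt0 ?lmax_gt0 //.
exact: lmax_ge.
Qed.

Lemma ratio_fin k : (k0 <= k)%N -> (\int[mu]_(x in dcube k z) (D x / m x)%:E)%E \is a fin_num.
Proof.
move=> k0k; have kQ : dcube k z `<=` Q0 by exact: dcube_mono.
have mk : measurable (dcube k z) by exact: measurable_box.
have mSk (g : T -> R) : measurable_fun Q0 g -> measurable_fun (dcube k z) g.
  by move=> mg; apply: measurable_funS mg.
rewrite ge0_fin_numE; last first.
  by apply: integral_ge0 => x _; rewrite lee_fin divr_ge0 ?jac_norm_ge0 // ltW // lmax_gt0.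
apply: (@le_lt_trans _ _ (\int[mu]_(x in dcube k z) (expR N%:R * (1 + F x))%:E)%E).
  apply: int_le => //.
  - by apply: measurable_funM; apply: mSk; [exact: mS | exact: measurable_lmax_inv].
  - by apply: measurable_funM => //; apply: measurable_funD => //; apply: mSk; exact: mS.
  - by move=> x; rewrite divr_ge0 ?jac_norm_ge0 // ltW // lmax_gt0.
  - by move=> x _; apply: (le_trans (ratio_le x)); rewrite ler_wpM2l ?expR_ge0 ?D_le_F.
rewrite int_Zl ?expR_ge0 //.
- rewrite lte_mul_pinfty ?lee_fin ?expR_ge0 //; apply: energy_fin => //.
    exact: subset_trans hz.
  by rewrite mu_dcube // ltry.
- by apply: measurable_funD => //; apply: mSk; exact: mS.
- by move=> x; rewrite addr_ge0.
Qed.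

Lemma sublevel_measurable (l : nat) : measurable (Q0 `&` [set x | (l1dist (f x) (f z) < expR (- l%:R))%R]).
Proof.
have h : measurable_fun Q0 (fun x => l1dist (f x) (f z)).
  apply: mS; apply: measurable_sum => i; apply: measurableT_comp => //.
  by apply: measurable_funB => //; exact: (measurable_coord HS).
exact: measurable_fun_ltr.
Qed.

(** A layer contributes at most [e^((l+1) n) * c * e^(-l n) = c * e^n], and there are at most [N]
    layers: hence a term linear in [N] whose slope is proportional to [c]. The weight [1 + F] serves
    both for [m^-n] and for [F / m^n]. *)
Lemma layer_energy (l0 : nat) (c : R) : (l0 <= N)%N -> 0 <= c ->
  (forall l, (l0 <= l)%N ->
    (\int[mu]_(x in Q0 `&` [set x | (l1dist (f x) (f z) < expR (- l%:R))%R]) (1 + F x)%:E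
      <= (c * expR (- l%:R) ^+ n)%:E)%E) ->
  (\int[mu]_(x in Q0) ((1 + F x) * m x ^- n)%:E <=
    (expR l0%:R ^+ n * fine (\int[mu]_(x in Q0) (1 + F x)%:E) + c * expR 1 ^+ n * N%:R)%:E)%E.
Proof.
move=> lN c0 hl; pose L (l : nat) := Q0 `&` [set x | (l1dist (f x) (f z) < expR (- l%:R))%R].
have mL l : measurable (L l) by exact: sublevel_measurable.
have m1F : measurable_fun Q0 (fun x => 1 + F x) by apply: measurable_funD => //; exact: mS.
have F10 x : 0 <= 1 + F x by rewrite addr_ge0.
have e0 (l : nat) : 0 <= expR l%:R ^+ n :> R by rewrite exprn_ge0 // expR_ge0.
have mt l : measurable_fun Q0 (fun x => \1_(L l) x * (1 + F x)) by exact: measurable_indicM.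
have t0 l x : 0 <= \1_(L l) x * (1 + F x) by rewrite mulr_ge0 // indicE.
apply: (@le_trans _ _ (\int[mu]_(x in Q0) (expR l0%:R ^+ n * (1 + F x) +
    \sum_(l0 <= l < N) expR l.+1%:R ^+ n * (\1_(L l) x * (1 + F x)))%:E)%E).
  apply: int_le => //.
  - apply: measurable_funM => //.
    have -> : (fun x => m x ^- n) = (fun x => (m x)^-1 ^+ n) by apply/funext => x; rewrite exprVn.
    by apply: measurable_funX; exact: measurable_lmax_inv.
  - apply: measurable_funD; first exact: measurable_funM.
    by apply: measurable_sum => l; apply: measurable_funM.
  - by move=> x; rewrite mulr_ge0 // invr_ge0 exprn_ge0 // ltW // lmax_gt0.
  move=> x Qx; apply: (le_trans (ler_wpM2l (F10 x) (layer_cake n (l1dist (f x) (f z)) lN))).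
  rewrite mulrDr mulrC lerD2l mulr_sumr; apply: ler_sum => l _.
  rewrite mulrC -mulrA ler_wpM2l // ler_wpM2r // indicE.
  by case: ltP => // h; rewrite mem_set.
rewrite int_D //; last 4 first.
- by apply: measurable_funM.
- by apply: measurable_sum => l; apply: measurable_funM.
- by move=> x; rewrite mulr_ge0.
- by move=> x; rewrite sumr_ge0 // => l _; rewrite mulr_ge0.
rewrite int_Zl // int_sum //.
- have If : (\int[mu]_(x in Q0) (1 + F x)%:E)%E \is a fin_num.
    rewrite ge0_fin_numE; last by apply: integral_ge0 => x _; rewrite lee_fin.
    by apply: energy_fin => //; rewrite mu_dcube // ltry.
  rewrite -{1}(fineK If) EFinD [X in (_ <= X + _)%E]EFinM leeD2l //.
  apply: (@le_trans _ _ (\sum_(l0 <= l < N) (c * expR 1 ^+ n)%:E)%E).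
    rewrite big_nat_cond [X in (_ <= X)%E]big_nat_cond; apply: lee_sum => l /andP[/andP[ll _] _].
    rewrite int_Zl // -int_indic //; last by move=> x [].
    apply: (le_trans (lee_wpmul2l _ (hl l ll))); first by rewrite lee_fin.
    rewrite -EFinM lee_fin mulrCA -exprMn -expRD -natr1 addrAC subrr add0r //.
  rewrite sumEFin lee_fin sumr_const_nat -[X in X <= _]mulr_natr ler_wpM2l ?mulr_ge0 ?exprn_ge0 ?expR_ge0 //.
  by rewrite ler_nat leq_subr.
- by move=> l; apply: measurable_funM.
- by move=> l x; rewrite mulr_ge0.
Qed.

End AtPoint.

(* The logarithmic bound at [z] would otherwise give [N <= const + N / 2] for all large [N]. *)
Lemma slow_decay_image (gam : R) : 0 < gam -> exists2 c : R, 0 < c & forall z, Om z ->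
  (exists C k1, forall k, (k1 <= k)%N ->
    (\int[mu]_(x in dcube k z `&` Om) (F x)%:E <= (C * gdecay n lam gam k)%:E)%E) ->
  forall U, dopen U -> U z -> forall l0, exists2 l : nat, (l0 <= l)%N &
    ((c * expR (- l%:R) ^+ n)%:E <=
     \int[mu]_(x in U `&` (Om `&` [set x | (l1dist (f x) (f z) < expR (- l%:R))%R])) (1 + F x)%:E)%E.
Proof.
move=> gam0; have [B B0 hB] := decay_tail n2 lam0 lam1 gam0.
pose A0 : R := 4 * n%:R * (2 * vavg_cst R n d) * 2 ^+ n.-1.
have A00 : 0 <= A0 by rewrite !mulr_ge0 ?exprn_ge0 ?vavg_cst_ge0.
have Y0 : 0 <= A0 * (12 * B + 10) by rewrite mulr_ge0 // addr_ge0 // mulr_ge0.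
have Y1 : 0 < 4 * (A0 * (12 * B + 10) + 1) by rewrite mulr_gt0 // ltr_wpDl.
(* The first levels contribute [A0 * 2 * s * (6 * B + 5)] per unit of [N]; this choice makes it at
   most [1/4]. *)
pose s : R := (4 * (A0 * (12 * B + 10) + 1))^-1.
have s0 : 0 < s by rewrite invr_gt0.
have s1 : A0 * s * (12 * B + 10) <= 4^-1.
  have -> : A0 * s * (12 * B + 10) = A0 * (12 * B + 10) * s by ring.
  rewrite /s ler_pdivrMr // mulrA mulVf // mul1r; lra.
pose w : R := 2 * s^-1 ^+ n.-1.
have w0 : 0 <= w by rewrite mulr_ge0 // exprn_ge0 // invr_ge0 ltW.
(* [q] collects the coefficients of the layer-cake bound, [2^n] from the starting mean and [A0 * w]
   from the first levels; [c] is then chosen so that the layers contribute [1/4] per unit of [N]. *)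
pose q : R := 2 ^+ n + A0 * w.
have q0 : 0 < q by rewrite ltr_pwDl ?exprn_gt0 // mulr_ge0.
have e10 : 0 < expR 1 ^+ n :> R by rewrite exprn_gt0 // expR_gt0.
pose c : R := (4 * (expR 1 ^+ n * q))^-1.
have c0 : 0 < c by rewrite invr_gt0 !mulr_gt0.
have cq : c * expR 1 ^+ n * q = 4^-1.
  by rewrite /c invfM -!mulrA mulVf ?mulr1 // gt_eqF // mulr_gt0.
exists c => // z Oz [C' [k1 hC']] U oU Uz l0; apply: contrapT => Hn.
pose C := `|C'|.
have [kA hA] := ccell_sub_open oOm Oz.
have [k0 [k0ge kU]] := dopen_at (maxn kA 1) oU Uz.
move: k0ge; rewrite geq_max => /andP[/hA hz k00].
have hz' : dcube k0 z `<=` Om by move=> x /ccell_dcube; exact: hz.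
have mQ : measurable (dcube k0 z) by exact: measurable_box.
have hl l : (l0 <= l)%N ->
    (\int[mu]_(x in dcube k0 z `&` [set x | (l1dist (f x) (f z) < expR (- l%:R))%R]) (1 + F x)%:E
      <= (c * expR (- l%:R) ^+ n)%:E)%E.
  move=> ll; rewrite leNgt; apply/negP => h; apply: Hn; exists l => //.
  apply: (le_trans (ltW h)); apply: ge0_subset_integral.
  - by apply: sublevel_measurable.
  - apply: measurableI; first exact: dopen_measurable.
    apply: measurable_fun_ltr => //; apply: measurable_sum => i; apply: measurableT_comp => //.
    by apply: measurable_funB => //; exact: (measurable_coord HS).
  - apply/measurable_EFinP; apply: measurable_funD => //; apply: measurable_funS mF => //.
    by move=> x [_ []].
  - by move=> x _; rewrite lee_fin addr_ge0.
  - by move=> x [Qx hx]; split; [exact: kU | split => //; exact: hz'].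
have [C2 hC2] := hB (maxn k0 k1).
pose E0 := fine (\int[mu]_(x in dcube k0 z) (1 + F x)%:E).
pose J0 := expR l0%:R ^+ n * E0.
pose X := (1 - ln ((2 ^+ k0) ^- n)) + 2 ^+ n * J0 + A0 * (8 + 12 * s * C2 + w * J0 + (1 + C) * C2).
have key N : (l0 <= N)%N -> N%:R <= X + N%:R / 2.
  move=> lN; have [K [kK TK tail]] := hC2 N.
  move: kK; rewrite geq_max => /andP[k0K k1K].
  pose m := lmax f z N; pose J := J0 + c * expR 1 ^+ n * N%:R.
  have m0 x : 0 < m x by exact: lmax_gt0.
  have mi0 x : 0 <= m x ^- n by rewrite invr_ge0 exprn_ge0 // ltW.
  have mSQ (g : T -> R) : measurable_fun Om g -> measurable_fun (dcube k0 z) g.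
    by move=> mg; apply: measurable_funS mg.
  have mmi : measurable_fun (dcube k0 z) (fun x => m x ^- n).
    have -> : (fun x => m x ^- n) = (fun x => (m x)^-1 ^+ n) by apply/funext => x; rewrite exprVn.
    by apply: measurable_funX; exact: measurable_lmax_inv.
  have mFQ := mSQ _ mF.
  have m1F : measurable_fun (dcube k0 z) (fun x => (1 + F x) * m x ^- n).
    by apply: measurable_funM => //; apply: measurable_funD.
  have JE := layer_energy hz' lN (ltW c0) hl.
  rewrite -/E0 -/J0 -/J in JE.
  have J1 : fine (\int[mu]_(x in dcube k0 z) (m x ^- n)%:E) <= J.
    apply: fine_le_real; first by apply: integral_ge0 => x _; rewrite lee_fin.
    apply: le_trans JE; apply: int_le => // x _.
    by rewrite ler_peMl // lerDl.
  have J2 : (\int[mu]_(x in dcube k0 z) (F x / m x ^+ n)%:E <= J%:E)%E.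
    apply: le_trans JE; apply: int_le => //.
    - exact: measurable_funM.
    - by move=> x; rewrite mulr_ge0.
    - by move=> x _; rewrite ler_wpM2r // lerDr.
  have Ifin k : (k0 <= k)%N -> (\int[mu]_(x in dcube k z) (D x / m x)%:E)%E \is a fin_num.
    exact: ratio_fin hz' k.
  have [M0 hM0] := log_mean_bound Hmu n2 oOm HS cf lam0 HF N hz.
  have := hM0 _ (leq_maxl M0 K); rewrite -/A0 (big_cat_nat (n := K)) ?leq_maxr //=.
  set M := maxn M0 K; set S1 := \sum_(k0 <= k < K) _; set S2 := \sum_(K <= k < M) _ => lnb.
  have hS1 : S1 <= 2 * (4 + s * (6 * Theta n lam K + 5 * N%:R)) + w * J.
    apply: fine_weighted_sum => //.
    apply: (le_trans (head_energy Hmu n2 lam0 lam1 (jac_norm_ge0 G) K k00 (lmax_ge f z N) s0 _ _)).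
    - exact: mSQ.
    - by apply: mSQ; exact: (measurable_lmax HS).
    by rewrite EFinD leeD2l // (EFinM w) lee_wpmul2l // lee_fin.
  have hS2 : S2 <= (1 + C) * C2.
    apply: (@le_trans _ _ (\sum_(K <= k < M) (1 + C) * (expR N%:R * powR (gdecay n lam gam k) n%:R^-1))).
      rewrite /S2 big_nat_cond [X in _ <= X]big_nat_cond; apply: ler_sum => k /andP[/andP[Kk _] _].
      have kk0 := leq_trans k0K Kk.
      have mk : measurable (dcube k z) by exact: measurable_box.
      have kO : dcube k z `<=` Om by apply: subset_trans hz'; exact: dcube_mono.
      have mSk (g : T -> R) : measurable_fun Om g -> measurable_fun (dcube k z) g.
        by move=> mg; apply: measurable_funS mg.
      have gd0 : 0 < gdecay n lam gam k by apply: gdecay_gt0; exact: leq_trans kk0.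
      (* With [sg^n] equal to the gauge, both terms of [tail_energy] are multiples of [sg]; they add
         up to [(1 + C) * sg], which [decay_tail] sums. *)
      set sg := powR _ _.
      have sg0 : 0 < sg by exact: powR_gt0.
      have sgn : sg ^+ n = gdecay n lam gam k.
        rewrite -powR_mulrn ?(ltW sg0) // /sg -powRrM mulVf ?powRr1 ?(ltW gd0) //.
        by rewrite pnatr_eq0 -lt0n ltnW.
      have b0 : 0 <= (2 ^+ k) ^+ n.-1 :> R by rewrite !exprn_ge0.
      rewrite -lee_fin EFinM fineK ?Ifin //.
      apply: (@le_trans _ _ ((expR N%:R)%:E * (((2 ^+ k) ^+ n.-1)%:E * \int[mu]_(x in dcube k z) (D x)%:E))%E).
        rewrite muleCA lee_wpmul2l ?lee_fin // -int_Zl ?expR_ge0 //; last 2 first.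
        - exact: mSk.
        - exact: jac_norm_ge0.
        apply: int_le => //.
        - apply: measurable_funM; first exact: mSk.
          apply: measurable_funS (measurable_lmax_inv N hz') => //; exact: dcube_mono.
        - by apply: measurable_funM => //; exact: mSk.
        - by move=> x; rewrite divr_ge0 ?jac_norm_ge0 // ltW.
        - by move=> x _; exact: ratio_le.
      rewrite mulrCA EFinM lee_wpmul2l ?lee_fin ?expR_ge0 //.
      apply: (le_trans (tail_energy Hmu n2 lam0 (jac_norm_ge0 G) sg0 (mSk _ mD))).
      have hk := hC' k (leq_trans k1K Kk); rewrite (setIidl kO) in hk.
      have q1 : 0 <= sg^-1 ^+ n.-1 by rewrite exprn_ge0 // invr_ge0 ltW.
      rewrite mulrDl mul1r EFinD leeD2l //.
      apply: (@le_trans _ _ ((sg^-1 ^+ n.-1)%:E * (C * gdecay n lam gam k)%:E)%E).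
        rewrite lee_wpmul2l ?lee_fin //; apply: (le_trans hk).
        by rewrite lee_fin ler_wpM2r ?(ltW gd0) // ler_norm.
      rewrite -EFinM lee_fin -sgn -[in sg ^+ n](prednK (ltnW n2)) exprS exprVn.
      have sgm : sg ^+ n.-1 != 0 by rewrite expf_neq0 // gt_eqF.
      by rewrite [X in X <= _]mulrC !mulrA mulfK.
    rewrite -mulr_sumr; apply: ler_wpM2l; last exact: tail.
    by apply: addr_ge0 => //; exact: normr_ge0.
  apply: (le_trans lnb).
  have p1 : 2 ^+ n * fine (\int[mu]_(x in dcube k0 z) (m x ^- n)%:E) <= 2 ^+ n * J.
    by rewrite ler_wpM2l // exprn_ge0.
  have p2 : S1 <= 2 * (4 + s * (6 * (B * N%:R + C2) + 5 * N%:R)) + w * J.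
    apply: (le_trans hS1); rewrite lerD2r ler_wpM2l // lerD2l ler_wpM2l ?(ltW s0) // lerD2r.
    by rewrite ler_wpM2l.
  have p3 := ler_wpM2l A00 (lerD p2 hS2).
  apply: (le_trans (lerD (lerD (lexx _) p1) p3)).
  have -> : 1 - ln ((2 ^+ k0) ^- n) + 2 ^+ n * J +
      A0 * (2 * (4 + s * (6 * (B * N%:R + C2) + 5 * N%:R)) + w * J + (1 + C) * C2) =
      X + (N%:R * (c * expR 1 ^+ n * q) + N%:R * (A0 * s * (12 * B + 10))) by rewrite /X /J /q; ring.
  rewrite cq lerD2l.
  have p4 : N%:R * (A0 * s * (12 * B + 10)) <= N%:R * 4^-1 by rewrite ler_wpM2l.
  apply: (le_trans (lerD (lexx _) p4)).
  by rewrite -mulrDr (_ : 4^-1 + 4^-1 = 2^-1 :> R) //; field.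
(* Any [N] above both [l0] and [2 * X] contradicts [key]. *)
have h := archi_boundP (normr_ge0 (2 * X)).
have h1 := key _ (leq_maxl l0 (Num.bound `|2 * X|)).
have h2 : `|2 * X| < (maxn l0 (Num.bound `|2 * X|))%:R.
  by apply: lt_le_trans h _; rewrite ler_nat leq_maxr.
have h3 := le_lt_trans (ler_norm _) h2; move: h1 h3; move: (_%:R) => N' h1 h3.
lra.
Qed.

End SlowImage.

(** * Hausdorff measures and coverings *)

Section HausdorffNull.
Local Open Scope ereal_scope.
Variables (R : realType) (m : nat) (h : R -> \bar R).
Local Notation T := (m.-tuple R).
Hypotheses (h_ge0 : forall t, (0 <= t)%R -> 0 <= h t) (h0 : h 0%R = 0).

Lemma diam_ge0 (C : set T) : 0 <= diam C.
Proof. by apply: ereal_sup_ubound; left. Qed.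

Lemma diam_le (C : set T) (r : R) : (0 <= r)%R ->
  (forall x y, C x -> C y -> (edist x y <= r)%R) -> diam C <= r%:E.
Proof.
move=> r0 hr; apply: ge_ereal_sup => _ [->|[x Cx [y Cy <-]]]; rewrite lee_fin //.
exact: hr.
Qed.

Lemma diam_set0 : diam (set0 : set T) = 0.
Proof. by apply/eqP; rewrite eq_le diam_ge0 andbT diam_le. Qed.

Lemma hdiam_ge0 (C : set T) : 0 <= h (fine (diam C)).
Proof. by apply: h_ge0; rewrite fine_ge0 // diam_ge0. Qed.

Lemma hausdorff_ge0 (A : set T) : 0 <= hausdorff h A.
Proof.
apply: le_trans (ereal_sup_ubound (x := hausdorff_delta h 1 A) _); last first.
  by exists 1%R => //=; exact: ltr01.
by apply: le_ereal_inf_tmp => _ [C _ <-]; apply: nneseries_ge0 => k _ _; exact: hdiam_ge0.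
Qed.

Lemma hausdorff_eq0 (A : set T) :
  (forall dl e : R, (0 < dl)%R -> (0 < e)%R -> exists C : nat -> set T,
     [/\ A `<=` \bigcup_j C j, forall j, diam (C j) <= dl%:E &
      forall N, \sum_(0 <= j < N) h (fine (diam (C j))) <= e%:E]) ->
  hausdorff h A = 0.
Proof.
move=> H; apply/eqP; rewrite eq_le hausdorff_ge0 andbT.
apply: ge_ereal_sup => _ [dl /= dl0 <-].
apply/lee_addgt0Pr => e e0; rewrite add0e.
have [C [C1 C2 C3]] := H dl e dl0 e0.
apply: (@le_trans _ _ (\sum_(j <oo) h (fine (diam (C j))))).
  by apply: ereal_inf_lbound; exists C.
apply: lime_le; first by apply: is_cvg_nneseries => k _ _; exact: hdiam_ge0.
by apply: nearW => N; exact: C3.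
Qed.

Lemma hausdorff_cover (A : set T) : hausdorff h A = 0 ->
  forall dl e : R, (0 < dl)%R -> (0 < e)%R -> exists C : nat -> set T,
     [/\ A `<=` \bigcup_j C j, forall j, diam (C j) <= dl%:E &
      \sum_(j <oo) h (fine (diam (C j))) <= e%:E].
Proof.
move=> H dl e dl0 e0.
have : hausdorff_delta h dl A < e%:E.
  apply: (@le_lt_trans _ _ 0); last by rewrite lte_fin.
  by rewrite -H; apply: ereal_sup_ubound; exists dl.
by move=> /ereal_inf_lt [_ [C [C1 C2] <-] C3]; exists C; split => //; exact: ltW.
Qed.

Lemma hausdorff_eq0S (A B : set T) : A `<=` B -> hausdorff h B = 0 -> hausdorff h A = 0.
Proof.
move=> AB HB; apply: hausdorff_eq0 => dl e dl0 e0.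
have [C [C1 C2 C3]] := hausdorff_cover HB dl0 e0.
exists C; split=> [|//|N]; first exact: subset_trans AB C1.
by apply: le_trans C3; apply: nneseries_lim_ge => k _ _; exact: hdiam_ge0.
Qed.

(** The family is enumerated by its codes; a number that codes nothing gets the empty set, which
    costs [h 0 = 0]. *)
Lemma hausdorff_eq0_countable (J : countType) (A : set T) :
  (forall dl e : R, (0 < dl)%R -> (0 < e)%R -> exists C : J -> set T,
     [/\ A `<=` \bigcup_j C j, forall j, diam (C j) <= dl%:E &
      forall s : seq J, uniq s -> \sum_(j <- s) h (fine (diam (C j))) <= e%:E]) ->
  hausdorff h A = 0.
Proof.
move=> H; apply: hausdorff_eq0 => dl e dl0 e0.
have [C [C1 C2 C3]] := H dl e dl0 e0.
pose C' i := if choice.pickle_inv i is Some j then C j else set0.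
exists C'; split=> [x /C1[j _ Cx]|i|N].
- by exists (choice.pickle j) => //; rewrite /C' choice.pickleK_inv.
- by rewrite /C'; case: choice.pickle_inv => [j|]; rewrite ?diam_set0 ?lee_fin ?(ltW dl0).
- rewrite (_ : \sum_(0 <= i < N) _ = \sum_(j <- pmap (@choice.pickle_inv J) (index_iota 0 N)) h (fine (diam (C j)))).
    by apply: C3; apply: pmap_uniq (iota_uniq _ _); exact: choice.pickle_invK.
  elim: (index_iota 0 N) => [|i s IH]; first by rewrite !big_nil.
  rewrite big_cons IH /= /C'; case: choice.pickle_inv => [j|] /=; first by rewrite big_cons.
  by rewrite diam_set0 h0 add0e.
Qed.

(** The [i]-th set is covered at cost [e / 2^(i+1)], and the covers are reindexed by pairs. *)
Lemma hausdorff_bigcup (A : nat -> set T) :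
  (forall i, hausdorff h (A i) = 0) -> hausdorff h (\bigcup_i A i) = 0.
Proof.
move=> HA; apply: (@hausdorff_eq0_countable (nat * nat)%type) => dl e dl0 e0.
have e0' i : (0 < e / (2 ^ i.+1)%:R)%R by rewrite divr_gt0 // ltr0n expn_gt0.
have /choice[C HC] : forall i, exists Ci : nat -> set T,
    [/\ A i `<=` \bigcup_j Ci j, forall j, diam (Ci j) <= dl%:E &
      \sum_(j <oo) h (fine (diam (Ci j))) <= (e / (2 ^ i.+1)%:R)%:E].
  by move=> i; exact: hausdorff_cover.
exists (fun p => C p.1 p.2); split=> [x [i _ Ax]|[i j]|s us].
- by have [h1 _ _] := HC i; have [j _ Cx] := h1 x Ax; exists (i, j).
- by have [] := HC i.
pose a i j := h (fine (diam (C i j))).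
have a0 i j : 0 <= a i j by exact: hdiam_ge0.
apply: (@le_trans _ _ (\esum_(p in [set: nat * nat]) a p.1 p.2)).
  rewrite fsbig_seq //; apply: ereal_sup_ubound; exists [set` s] => //.
  by split; [exact: finite_seq | move=> ?].
have -> : \esum_(p in [set: nat * nat]) a p.1 p.2 = \esum_(i in [set: nat]) \esum_(j in [set: nat]) a i j.
  rewrite esum_esum //; congr esum; apply/seteqP; by split => //.
rewrite (_ : \esum_(i in [set: nat]) \esum_(j in [set: nat]) a i j = \sum_(i <oo) \sum_(j <oo) a i j); last first.
  rewrite nneseries_esumT; last by move=> i; apply: nneseries_ge0.
  by apply: eq_esum => i _; rewrite nneseries_esumT.
apply: le_trans (epsilon_trick0 xpredT (ltW e0)).
apply: lee_nneseries => i *; last by have [] := HC i.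
by apply: nneseries_ge0 => *; exact: a0.
Qed.

Lemma hausdorff_bigcup_countable (J : countType) (A : J -> set T) :
  (forall i, hausdorff h (A i) = 0) -> hausdorff h (\bigcup_i A i) = 0.
Proof.
move=> HA.
rewrite (_ : \bigcup_i A i = \bigcup_i (if choice.pickle_inv i is Some j then A j else set0)).
  apply: hausdorff_bigcup => i; case: choice.pickle_inv => [j|] //.
  apply: hausdorff_eq0 => dl e dl0 e0; exists (fun=> set0); split => // [j|N].
    by rewrite diam_set0 lee_fin ltW.
  by rewrite big1 ?lee_fin ?ltW // => j _; rewrite diam_set0.
apply/seteqP; split=> [x [j _ Ax]|x [i _]].
  by exists (choice.pickle j) => //; rewrite choice.pickleK_inv.
by case: choice.pickle_inv => [j|] // Ax; exists j.
Qed.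

End HausdorffNull.

(** * Greedy Vitali selection *)

Section Greedy.

Lemma measure_disjoint_sum d (X : measurableType d) (R : realType) (nu : {measure set X -> \bar R})
  (J : choiceType) (F : J -> set X) (s : seq J) : uniq s -> (forall j, measurable (F j)) ->
  (forall i j, i != j -> F i `&` F j = set0) -> (\sum_(j <- s) nu (F j) <= nu setT)%E.
Proof.
move=> us mF dF; rewrite fsbig_seq // -measure_fin_bigcup //.
- have mU : measurable (\bigcup_(i in [set` s]) F i).
    by apply: fin_bigcup_measurable => [|j _]; [exact: finite_seq | exact: mF].
  by apply: le_measure => //; exact: mem_set.
- move=> i j _ _ [x Fx]; have [//|ij] := eqVneq i j.
  by move: Fx; rewrite dF.
Qed.

Variables (P X : Type) (B : P -> set X) (lev : P -> nat) (H : set P).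

Let free (s : seq P) (q : P) := H q /\ forall p, List.In p s -> B p `&` B q = set0.

Let pick_spec (s : seq P) : exists o : option P,
  if o is Some p then free s p /\ forall q, free s q -> (lev p <= lev q)%N else forall q, ~ free s q.
Proof.
have [[q0 fq0]|no] := pselect (exists q, free s q); last first.
  by exists None => q fq; apply: no; exists q.
have ex : exists k, `[< exists2 q, free s q & lev q = k >].
  by exists (lev q0); apply/asboolP; exists q0.
case: (ex_minnP ex) => k /asboolP[p fp lp] mn; exists (Some p); split => // q fq.
by rewrite lp; apply: mn; apply/asboolP; exists q.
Qed.

(** Each time a set of least level disjoint from the earlier choices is taken, if there is one. The
    last clause is the greedy property: as long as [q] is still available, a choice is made and its
    level does not exceed that of [q]. *)
Lemma greedy_disjoint : exists x : nat -> option P,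
  [/\ forall t p, x t = Some p -> H p,
      forall t t' p p', (t < t')%N -> x t = Some p -> x t' = Some p' -> B p `&` B p' = set0 &
      forall q, H q -> forall t,
        (forall t' p', (t' < t)%N -> x t' = Some p' -> B p' `&` B q = set0) ->
        exists2 p, x t = Some p & (lev p <= lev q)%N].
Proof.
have /choice[pk pkP] := pick_spec.
pose L := fix L t := if t is t'.+1 then (if pk (L t') is Some p then p :: L t' else L t') else [::].
have inL t p : List.In p (L t) -> exists2 t', (t' < t)%N & pk (L t') = Some p.
  elim: t => //= t IH; case E: (pk (L t)) => [q|] /=; last by case/IH => t' lt' h; exists t' => //; exact: leqW.
  by case=> [<-|/IH[t' lt' h]]; [exists t | exists t' => //; exact: leqW].
have Lin t t' p : (t < t')%N -> pk (L t) = Some p -> List.In p (L t').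
  move=> + E; elim: t' => // t' IH; rewrite ltnS leq_eqVlt => /orP[/eqP <-|/IH h] /=.
    by rewrite E /=; left.
  by case: (pk (L t')) => [q|] //=; right.
exists (fun t => pk (L t)); split=> [t p E|t t' p p' tt' E E'|q Hq t ht].
- by have := pkP (L t); rewrite E => -[[]].
- by have := pkP (L t'); rewrite E' => -[[_ h] _]; apply: h; exact: Lin E.
- have := pkP (L t); case: (pk (L t)) => [p|].
    move=> [_ h]; exists p => //; apply: h; split => // p' /inL[t' lt' E']; exact: ht E'.
  by move/(_ q); case; split => // p' /inL[t' lt' E']; exact: ht E'.
Qed.

End Greedy.

(** If [q] met no chosen set of level at most its own, it would stay available for ever; every
    choice would carry mass at least [w (lev q)], and infinitely many disjoint choices contradict
    the finiteness of [nu]. Disjointness is asked in the domain, and levels play the part of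
    radii. *)
Lemma vitali_greedy d (X : measurableType d) (R : realType) (nu : {measure set X -> \bar R})
    (P : Type) (B : P -> set X) (lev : P -> nat) (H : set P) (w : nat -> R) :
  (nu setT < +oo)%E -> (forall p, measurable (B p)) ->
  (forall l, 0 < w l) -> (forall l l', (l <= l')%N -> w l' <= w l) ->
  (forall p, H p -> ((w (lev p))%:E <= nu (B p))%E) ->
  exists x : nat -> option P,
  [/\ forall t p, x t = Some p -> H p,
      forall q, H q -> exists t p, [/\ x t = Some p, (lev p <= lev q)%N & exists z, B p z /\ B q z] &
      forall N, (\sum_(0 <= t < N) (if x t is Some p then w (lev p) else 0)%:E <= nu setT)%E].
Proof.
move=> nuf mB w0 wm hw; have [x [xH xd xg]] := greedy_disjoint B lev H.
pose Bx t := if x t is Some p then B p else set0.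
have mBx t : measurable (Bx t) by rewrite /Bx; case: (x t) => // *; exact: mB.
have Bd i j : i != j -> Bx i `&` Bx j = set0.
  wlog ij : i j / (i < j)%N => [h ne|_].
    by case: (ltngtP i j) => ij; [exact: h | rewrite setIC; apply: h => //; rewrite eq_sym | rewrite ij eqxx in ne].
  rewrite /Bx; case E: (x i) => [p|]; last by rewrite set0I.
  by case E': (x j) => [p'|]; [exact: xd E E' | rewrite setI0].
have sumB N : (\sum_(0 <= t < N) (if x t is Some p then w (lev p) else 0)%:E <= nu setT)%E.
  apply: le_trans (measure_disjoint_sum nu (iota_uniq 0 (N - 0)) mBx Bd).
  apply: lee_sum => t _; rewrite /Bx; case E: (x t) => [p|] //.
  by apply: hw; exact: xH E.
exists x; split => // q Hq; apply: contrapT => no.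
have all t : exists2 p, x t = Some p & (lev p <= lev q)%N.
  elim/ltn_ind: t => t IH; apply: xg => // t' p' lt' E'.
  have [p'' E'' lp] := IH _ lt'; move: E''; rewrite E' => -[e]; subst p''.
  apply/seteqP; split=> // z [z1 z2]; apply: no; exists t', p'; split => //; by exists z.
have wq := w0 (lev q).
have nuE : nu setT = (fine (nu setT))%:E by rewrite fineK // ge0_fin_numE.
pose N := Num.bound `|fine (nu setT) / w (lev q)|.
have hN : fine (nu setT) / w (lev q) < N%:R.
  by apply: le_lt_trans (ler_norm _) _; apply: (le_lt_trans _ (archi_boundP (normr_ge0 _))).
have := sumB N; rewrite nuE; apply/negP; rewrite -ltNge.
apply: (@lt_le_trans _ _ (\sum_(0 <= t < N) (w (lev q))%:E)%E); last first.
  by apply: lee_sum => t _; have [p -> lp] := all t; rewrite lee_fin wm.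
by rewrite sumEFin lte_fin sumr_const_nat subn0 -mulr_natl -ltr_pdivrMr.
Qed.

Lemma expRN_small (R : realType) (a : R) : 0 < a -> exists l0 : nat, expR (- l0%:R) <= a.
Proof.
move=> a0; exists (Num.bound `|- ln a|).
rewrite -[X in _ <= X](lnK (x := a)) ?posrE // ler_expR lerNl.
by apply: le_trans (ler_norm _) _; apply: ltW; exact: archi_boundP (normr_ge0 _).
Qed.

(** * Images of null sets *)

Section LuzinPiece.
Variables (R : realType) (n d : nat) (lam : R).
Local Notation T := (n.-tuple R).
Variables (mu : {measure set T -> \bar R}) (Om : set T) (f : T -> d.-tuple R).
Variable (G : 'I_d -> 'I_n -> T -> R).
Hypotheses (Hmu : lebesgue_on_boxes mu) (n2 : (2 <= n)%N) (oOm : is_open Om).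
Hypotheses (HS : sobolev_W1p_with mu Om n f G) (cf : continuous_on Om f).
Local Notation D := (jac_norm G).
Local Notation F := (lenergy lam D).
Hypotheses (lam0 : 0 <= lam) (lam1 : lam <= (n.-1)%:R).
Hypothesis HF : (\int[mu]_(y in Om) (F y)%:E < +oo)%E.

Definition slow_decay (gam : R) (z : T) := exists C k1, forall k, (k1 <= k)%N ->
  (\int[mu]_(x in dcube k z `&` Om) (F x)%:E <= (C * gdecay n lam gam k)%:E)%E.

(** [V] has finite measure so that [1 + F] has a finite integral over it. Regularity is applied to
    the measure of density [1 + F] rather than to [mu]: an open set around the null set then has
    small energy at once. *)
Lemma luzin_piece (gam : R) (Z V : set T) : 0 < gam -> dopen V -> V `<=` Om -> (mu V < +oo)%E ->
  Z `<=` V -> mu.-negligible Z -> (forall z, Z z -> slow_decay gam z) ->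
  hausdorff (pow_gauge n) (f @` Z) = 0%E.
Proof.
move=> gam0 oV VO Vf ZV [N [mN N0 ZN]] Zs.
have mOm : measurable Om by exact: dopen_measurable (is_open_dopen oOm).
have mV : measurable V by exact: dopen_measurable.
have F0 x : 0 <= F x by exact: lenergy_ge0 (jac_norm_ge0 G) x.
have F10 x : 0 <= 1 + F x by rewrite addr_ge0.
have mF : measurable_fun Om F by apply: measurable_lenergy; exact: (measurable_jac_norm HS).
have m1 : measurable_fun Om (fun x => 1 + F x) by exact: measurable_funD.
have mS (Q : set T) : Q `<=` Om -> measurable_fun Q (fun x => 1 + F x).
  by move=> QO; apply: measurable_funS m1.
apply: hausdorff_eq0; first by move=> t t0; rewrite lee_fin exprn_ge0.
move=> dl e dl0 e0.
have [c c0 hc] := slow_decay_image Hmu n2 oOm HS cf lam0 lam1 HF gam0.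
(* A covering set of diameter at most [4 * e^-l] has [diam^n] at most [4^n / c] times its weight
   [c * e^(-l n)], and the weights add up to at most [eta]. *)
pose eta := e * c / 4 ^+ n.
have eta0 : 0 < eta by rewrite divr_gt0 ?exprn_gt0 // mulr_gt0.
have [nu nuE] := restricted_density mu mV (mS _ VO) F10.
have nuf : (nu setT < +oo)%E by rewrite nuE setTI; apply: (energy_fin oOm HS HF).
have [U0 [V0 [oU0 oV0 NU NV hUV]]] := dregular_measurable nuf mN eta0.
pose U := U0 `&` V.
have oU : dopen U by exact: dopenI.
have mU : measurable U by exact: dopen_measurable.
have UO : U `<=` Om by move=> x [_ /VO].
have nuN : nu N = 0%E.
  rewrite nuE; apply: null_set_integral.
  - exact: measurableI.
  - by apply/measurable_EFinP; apply: mS; move=> x [_ /VO].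
  - apply: (subset_measure0 _ mN _ N0); [exact: measurableI | by move=> x []].
have nuU : (\int[mu]_(x in U) (1 + F x)%:E <= eta%:E)%E.
  have mU0 : measurable U0 by exact: dopen_measurable.
  have mV0 : measurable V0 by exact: dopen_measurable.
  rewrite -nuE; apply: (@le_trans _ _ (nu (U0 `&` V0) + nu N)%E); last by rewrite nuN adde0.
  apply: le_trans (measureU2 _ _ _) => //; last exact: measurableI.
  have mM : measurable (U0 `&` V0 `|` N) by apply: measurableU => //; exact: measurableI.
  apply: le_measure; [exact: mem_set | exact: mem_set |].
  by move=> x Ux; have [Nx|Nx] := pselect (N x); [right | left; split => //; exact: NV].
have [nu2 nu2E] := restricted_density mu mU (mS _ UO) F10.
have nu2f : (nu2 setT < +oo)%E by rewrite nu2E setTI; apply: le_lt_trans nuU (ltry _).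
(* [4 * e^-l0 <= dl] makes all covering sets small enough. *)
have [l0 hl0] := expRN_small (divr_gt0 dl0 (ltr0Sn R 3)).
pose B (p : d.-tuple R * nat) := U `&` (Om `&` [set x | (l1dist (f x) p.1 < expR (- p.2%:R))%R]).
have mB p : measurable (B p).
  apply: measurableI => //; apply: measurable_fun_ltr => //; apply: measurable_sum => i.
  by apply: measurableT_comp => //; apply: measurable_funB => //; exact: (measurable_coord HS).
pose w (l : nat) : R := c * expR (- l%:R) ^+ n.
pose H (p : d.-tuple R * nat) := (l0 <= p.2)%N /\ ((w p.2)%:E <= nu2 (B p))%E.
have w0 l : 0 < w l by rewrite mulr_gt0 // exprn_gt0 // expR_gt0.
have wm l l' : (l <= l')%N -> w l' <= w l.
  move=> ll; rewrite ler_wpM2l ?(ltW c0) // lerXn2r ?nnegrE ?expR_ge0 //.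
  by rewrite ler_expR lerN2 ler_nat.
have [x [xH xg xs]] := @vitali_greedy _ _ _ nu2 _ B snd H w nu2f mB w0 wm (fun p hp => hp.2).
(* Doubling the radius suffices: only the centre [f z] has to be covered, not the ball around it. A
   common point of the two preimages puts [f z] within the sum of the two radii of the selected
   centre, and the selected radius is the larger one. *)
pose C t : set (d.-tuple R) :=
  if x t is Some p then [set y | l1dist y p.1 < 2 * expR (- p.2%:R)] else set0.
have dC p : (diam [set y : d.-tuple R | (l1dist y p.1 < 2 * expR (- p.2%:R))%R] <= (4 * expR (- p.2%:R))%:E)%E.
  apply: diam_le; first by rewrite mulr_ge0 // expR_ge0.
  move=> y y' /= hy hy'; apply: (le_trans (edist_le_l1 y y')).
  apply: (le_trans (l1dist_triangle y p.1 y')); rewrite (l1distC p.1); lra.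
exists C; split.
- move=> _ [z Zz <-].
  have Uz : U z by split; [exact/NU/ZN | exact: ZV].
  have [l l0l hl] := hc z (UO _ Uz) (Zs z Zz) U oU Uz l0.
  have Hq : H (f z, l).
    by split => //=; rewrite nu2E (_ : B _ `&` U = B (f z, l)) //; apply: setIidl => y [].
  have [t [p [Et lp [y [[_ [_ By]] [_ [_ Bq]]]]]]] := xg _ Hq.
  exists t => //; rewrite /C Et /=.
  rewrite /= in By Bq lp; apply: (le_lt_trans (l1dist_triangle (f z) (f y) p.1)).
  rewrite (l1distC (f z)) mulr_natl mulr2n ltrD //; apply: lt_le_trans Bq _.
  by rewrite ler_expR lerN2 ler_nat.
- move=> t; rewrite /C; case E: (x t) => [p|]; last by rewrite diam_set0 lee_fin ltW.
  apply: (le_trans (dC p)); rewrite lee_fin.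
  have [lp _] := xH _ _ E.
  have h : expR (- p.2%:R) <= expR (- l0%:R) :> R by rewrite ler_expR lerN2 ler_nat.
  lra.
- move=> K.
  have c4 : 0 <= 4 ^+ n / c by rewrite divr_ge0 ?exprn_ge0 // ltW.
  apply: (@le_trans _ _ ((4 ^+ n / c)%:E * \sum_(0 <= t < K) (if x t is Some p then w p.2 else 0)%:E)%E).
    rewrite ge0_sume_distrr; last by move=> t _; rewrite lee_fin; case: (x t) => // p; exact: ltW.
    apply: lee_sum => t _; rewrite /C -EFinM; case E: (x t) => [p|]; last first.
      by rewrite diam_set0 mulr0 /pow_gauge /= expr0n eqn0Ngt (ltnW n2).
    rewrite lee_fin /w mulrA divfK ?(gt_eqF c0) // -exprMn lerXn2r ?nnegrE ?mulr_ge0 ?expR_ge0 //.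
      by rewrite fine_ge0 // diam_ge0.
    by apply: fine_le_real (dC p); exact: diam_ge0.
  apply: (@le_trans _ _ ((4 ^+ n / c)%:E * eta%:E)%E).
    rewrite lee_wpmul2l ?lee_fin //; apply: (le_trans (xs K)).
    by rewrite nu2E setTI.
  by rewrite -EFinM lee_fin /eta le_eqVlt; apply/orP; left; apply/eqP; field; rewrite ?expf_neq0 // gt_eqF.
Qed.

End LuzinPiece.

(** * Gauges at dyadic scales *)

Section Decay.
Variables (R : realType) (n : nat) (lam : R).
Hypotheses (n2 : (2 <= n)%N) (lam0 : 0 <= lam) (lam1 : lam <= (n.-1)%:R).

Lemma gdecay_small (gam e : R) (K : nat) : 0 < gam -> 0 < e ->
  exists2 k, (K <= k)%N & gdecay n lam gam k <= e.
Proof.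
move=> g0 e0.
have [C C0 hC] : exists2 C : R, 0 <= C & forall k, (0 < k)%N -> gdecay n lam gam k <= C * powR k%:R (- 1).
  rewrite /gdecay; case: ltP => [a0|_].
    have [C C0 hC] := expR_powR_le g0 a0; exists C => // k k0; apply: (le_trans (hC k k0)).
    by rewrite ler_wpM2l // ler_powR ?ler1n //; lra.
  exists 1 => // k k0; rewrite mul1r ler_powR ?ler1n // lerN2.
  have : (1 : R) <= n%:R by rewrite ler1n ltnW.
  lra.
exists (maxn K (Num.bound (C / e)).+1); first exact: leq_maxl.
set k := maxn _ _; have k0 : (0 < k)%N by rewrite leq_max orbT.
apply: (le_trans (hC k k0)); rewrite powR_inv1 ?ler0n // ler_pdivrMr ?ltr0n //.
rewrite mulrC -ler_pdivrMr //; apply: (le_trans (ltW (archi_boundP _))).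
  by rewrite divr_ge0 // ltW.
by rewrite ler_nat /k leq_max leqnSn orbT.
Qed.

(** [n / 2^k] bounds the diameter of a cell of level [k], and [ln (2^k / n) >= k / 4] for large [k],
    from [ln 2 >= 1/2] and [ln n <= k / 4]. Passing to [g <= gamma / 4] absorbs the factor [4]:
    directly in the exponential case, as [4^-al >= 1/4]; in the power case because [k^(gamma - g)]
    eventually exceeds [4^(n + gamma)]. *)
Lemma gauge_le_gdecay (phi : R -> \bar R) (gamma g : R) : 0 < gamma -> 0 < g <= gamma / 4 ->
  (forall r : R, 0 < r < 1 ->
     phi r = (if 0 < lalpha n lam then expR (- (gamma * powR (ln r^-1) (lalpha n lam)))
              else powR (ln r^-1) (- (n%:R + gamma)))%:E) ->
  exists K, forall k, (K <= k)%N -> (phi (n%:R / 2 ^+ k)%R <= (gdecay n lam g k)%:E)%E.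
Proof.
move=> gam0 /andP[g0 gg] hphi.
have al0 := alpha_ge0 n2 lam0 lam1; have al1 := alpha_le1 n lam0.
have n0 : 0 < n%:R :> R by rewrite ltr0n ltnW.
pose a : R := n%:R + gamma.
have a0 : 0 < a by rewrite addr_gt0.
(* The threshold from which [k^(gamma / 2) >= 4^a]. *)
pose b : R := powR (powR 4 a) (2 / gamma).
exists (maxn (maxn 1 (Num.bound `|4 * ln (n%:R : R)|)) (Num.bound b)) => k.
rewrite !geq_max => /andP[/andP[k1 k2] k3].
have k0 : 0 < k%:R :> R by rewrite ltr0n.
have p0 : 0 < 2 ^+ k :> R by rewrite exprn_gt0.
have hln : 4 * ln n%:R <= k%:R :> R.
  apply: (le_trans (ler_norm _)); apply: (le_trans (ltW (archi_boundP (normr_ge0 _)))).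
  by rewrite ler_nat.
have hL : k%:R / 4 <= ln (n%:R / 2 ^+ k)^-1 :> R.
  rewrite invf_div ln_div ?posrE // lnXn // -[ln 2 *+ k]mulr_natl.
  have h2 : 1 - 2^-1 <= ln 2 :> R by exact: ln_ge_frac.
  have : k%:R * (1 - 2^-1) <= k%:R * ln 2 :> R by rewrite ler_wpM2l // ltW.
  lra.
have L0 : 0 < ln (n%:R / 2 ^+ k)^-1 :> R by apply: lt_le_trans hL; rewrite divr_gt0.
have r1 : 0 < (n%:R / 2 ^+ k : R) < 1.
  rewrite divr_gt0 //= ltNge; apply/negP => h.
  by move: L0; rewrite ltNge ln_le0 // invf_le1 // divr_gt0.
rewrite hphi // lee_fin /gdecay; case: ifPn => [ap|_].
  rewrite ler_expR lerN2.
  apply: (@le_trans _ _ (gamma * (4^-1 * powR k%:R (lalpha n lam)))).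
    by rewrite mulrA ler_wpM2r ?powR_ge0.
  rewrite ler_wpM2l ?(ltW gam0) //.
  apply: (@le_trans _ _ (powR (k%:R / 4) (lalpha n lam))); last first.
    by rewrite ge0_ler_powR // nnegrE ltW // divr_gt0.
  rewrite (mulrC k%:R) powRM ?ler0n ?invr_ge0 // ler_wpM2r ?powR_ge0 //.
  by rewrite ger1_powR //; lra.
rewrite -/a.
apply: (@le_trans _ _ (powR (k%:R / 4) (- a))).
  rewrite !powRN lef_pV2 ?posrE ?powR_gt0 ?divr_gt0 //.
  by rewrite ge0_ler_powR ?nnegrE ?(ltW a0) // ltW // divr_gt0.
have hb : powR 4 a <= powR k%:R (gamma - g).
  apply: (@le_trans _ _ (powR k%:R (gamma / 2))); last by rewrite ler_powR ?ler1n //; lra.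
  have bk : b <= k%:R.
    apply: (le_trans (ltW (archi_boundP (powR_ge0 _ _)))); by rewrite ler_nat.
  have -> : powR 4 a = powR b (gamma / 2).
    rewrite /b -powRrM (_ : 2 / gamma * (gamma / 2) = 1) ?powRr1 ?powR_ge0 //.
    by field; rewrite gt_eqF.
  by rewrite ge0_ler_powR ?nnegrE ?powR_ge0 ?ler0n // ltW // divr_gt0.
rewrite powRM ?ler0n ?invr_ge0 // !powRN.
have -> : powR 4^-1 a = (powR 4 a)^-1 :> R.
  by rewrite -[4^-1]powR_inv1 // -powRrM mulN1r powRN.
rewrite invrK mulrC ler_pdivrMr ?powR_gt0 //.
rewrite mulrC -powRN -powRD ?(gt_eqF k0) ?implybT //.
apply: (le_trans hb); rewrite /a (_ : n%:R + gamma - (n%:R + g) = gamma - g) //; ring.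
Qed.

End Decay.

(** * Nullity of the exceptional set *)

Section Exceptional.
Variables (R : realType) (n d : nat) (lam : R).
Local Notation T := (n.-tuple R).
Local Notation Z := {ffun 'I_n -> int}.
Variables (mu : {measure set T -> \bar R}) (Om : set T).
Variable (G : 'I_d -> 'I_n -> T -> R).
Hypotheses (n2 : (2 <= n)%N) (oOm : is_open Om).
Hypotheses (lam0 : 0 <= lam) (lam1 : lam <= (n.-1)%:R).
Hypothesis mD : measurable_fun Om (jac_norm G).
Local Notation F := (lenergy lam (jac_norm G)).
Hypothesis HF : (\int[mu]_(y in Om) (F y)%:E < +oo)%E.

(* The cells of the first level at which the energy is too large are dyadic, hence disjoint. *)
Lemma exceptional_null (phi : R -> \bar R) (gam : R) : gauge phi -> 0 < gam ->
  (exists K, forall k, (K <= k)%N -> (phi (n%:R / 2 ^+ k)%R <= (gdecay n lam gam k)%:E)%E) ->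
  hausdorff phi [set z | Om z /\ ~ slow_decay lam mu Om G gam z] = 0%E.
Proof.
move=> [phi0 phim _ _] gam0 [K hK].
have rk0 k : 0 <= n%:R / 2 ^+ k :> R by rewrite divr_ge0 ?exprn_ge0.
have phi_ge0 t : 0 <= t -> (0 <= phi t)%E by move=> t0; apply: le_trans phi0 (phim _ _ _ t0).
(* Monotonicity and the bound at small scales force [phi 0 = 0], so that empty sets cost nothing. *)
have phi00 : phi 0 = 0%E.
  apply/eqP; rewrite eq_le phi0 andbT; apply/lee_addgt0Pr => e e0; rewrite add0e.
  have [k Kk hk] := gdecay_small lam n2 K gam0 e0.
  by apply: (le_trans (phim _ _ (lexx 0) (rk0 k))); apply: (le_trans (hK k Kk)); rewrite lee_fin.
have mOm : measurable Om by exact: dopen_measurable (is_open_dopen oOm).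
have F0 x : 0 <= F x by exact: lenergy_ge0 (jac_norm_ge0 G) x.
have mF : measurable_fun Om F by exact: measurable_lenergy.
have [nu nuE] := restricted_density mu mOm mF F0.
have nuf : (nu setT < +oo)%E by rewrite nuE setTI.
have nuT : nu setT = (fine (nu setT))%:E by rewrite fineK // ge0_fin_numE.
apply: (@hausdorff_eq0_countable _ _ _ phi_ge0 phi00 (nat * Z)%type) => dl e dl0 e0.
(* The gauges of disjoint bad cells add up to at most [C^-1] times the total energy, hence to at
   most [e]; the [+ 1] keeps [C] positive. *)
pose C := (fine (nu setT) + 1) / e.
have nuT0 : 0 <= fine (nu setT) by rewrite fine_ge0.
have C0 : 0 < C by rewrite divr_gt0 // ltr_wpDl.
have [K1 hK1] : exists K1, forall k, (K1 <= k)%N -> n%:R / 2 ^+ k <= dl :> R.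
  have n1 : 0 < n.+1%:R :> R by rewrite ltr0n.
  have [K1 h] := pow2_small (divr_gt0 dl0 n1); exists K1 => k /h h1.
  apply: (@le_trans _ _ (n.+1%:R / 2 ^+ k)); first by rewrite ler_wpM2r ?invr_ge0 ?exprn_ge0 // ler_nat.
  by rewrite mulrC -ler_pdivlMr // ltW.
pose k0 := maxn K (maxn 1 K1).
pose bad z k := ((C * gdecay n lam gam k)%:E < nu (dcube k z))%E.
pose first z k := [/\ (k0 <= k)%N, bad z k & forall k', (k0 <= k')%N -> bad z k' -> (k <= k')%N].
pose sel (j : nat * Z) := exists z, idx j.1 z = j.2 /\ first z j.1.
pose cell (j : nat * Z) : set T := if `[< sel j >] then box j.1 j.2 0 else set0.
have dcell j : sel j -> (diam (box j.1 j.2 0 : set T) <= (n%:R / 2 ^+ j.1)%:E)%E.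
  move=> [z [e1 _]]; rewrite -e1; apply: diam_le => // x y hx hy.
  exact: (@dcube_edist _ _ j.1 z).
have disj i j : i != j -> cell i `&` cell j = set0.
  move=> ij; apply/seteqP; split=> // x [].
  rewrite /cell; case: asboolP => // si; case: asboolP => // sj.
  wlog le : i j ij si sj / (i.1 <= j.1)%N => [h hi hj|].
    by have [le|/ltnW le] := leqP i.1 j.1; [exact: (h i j) | apply: (h j i) => //; rewrite eq_sym].
  move=> /box_idx xi /box_idx xj; move: si sj => [z [zi [ki bz _]]] [z' [zj [_ _ mj]]].
  have xz : dcube i.1 z x by apply/dcube_idx; rewrite xi zi.
  have xz' : dcube j.1 z' x by apply/dcube_idx; rewrite xj zj.
  have ji : (j.1 <= i.1)%N.
    apply: mj => //; rewrite /bad.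
    by rewrite -(dcube_eq (dcube_mono le xz')) (dcube_eq xz).
  have e1 : i.1 = j.1 by apply/eqP; rewrite eqn_leq le ji.
  by move/eqP: ij; apply; case: i j e1 xi xj {le zi ki bz mj zj xz xz' ji} => i1 i2 [j1 j2] /= <- <- <-.
exists cell; split.
- move=> z [Oz nz]; have ex : exists k, `[< (k0 <= k)%N /\ bad z k >].
    (* If no level were bad, [C] and [k0] would witness the decay that fails at [z]. *)
    apply: contrapT => no; apply: nz; exists C, k0 => k kk; rewrite leNgt; apply/negP => h.
    by apply: no; exists k; apply/asboolP; split => //; rewrite /bad nuE.
  case: (ex_minnP ex) => k /asboolP[kk bk] mn.
  have sk : sel (k, idx k z).
    by exists z; split => //; split => // k' kk' bk'; apply: mn; apply/asboolP.
  by exists (k, idx k z) => //; rewrite /cell; case: asboolP => //= _; exact: dcube_refl.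
- move=> j; rewrite /cell; case: asboolP => sj; last by rewrite diam_set0 lee_fin ltW.
  apply: (le_trans (dcell j sj)); rewrite lee_fin; apply: hK1.
  by case: sj => z [_ [h _ _]]; apply: leq_trans h; rewrite /k0 !leq_max leqnn !orbT.
- move=> s us.
  have mcell j : measurable (cell j) by rewrite /cell; case: asboolP => ?; [exact: measurable_box | exact: measurable0].
  apply: (@le_trans _ _ (C^-1%:E * \sum_(j <- s) nu (cell j))%E).
    rewrite ge0_sume_distrr; last by move=> j _; exact: measure_ge0.
    apply: lee_sum => j _; rewrite /cell; case: asboolP => sj; last by rewrite diam_set0 phi00 measure0 mule0.
    apply: (@le_trans _ _ (phi (n%:R / 2 ^+ j.1)%R)).
      apply: phim; first by rewrite fine_ge0 // diam_ge0.
      by apply: fine_le_real (dcell j sj); exact: diam_ge0.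
    case: sj => z [<- [kj bj _]].
    apply: (@le_trans _ _ (gdecay n lam gam j.1)%:E).
      by apply: hK; apply: leq_trans kj; rewrite /k0 leq_maxl.
    have -> : gdecay n lam gam j.1 = C^-1 * (C * gdecay n lam gam j.1).
      by rewrite mulrA mulVf ?mul1r // gt_eqF.
    by rewrite EFinM lee_wpmul2l ?lee_fin ?invr_ge0 ?(ltW C0) //; exact: ltW bj.
  apply: (@le_trans _ _ (C^-1%:E * nu setT)%E).
    by rewrite lee_wpmul2l ?lee_fin ?invr_ge0 ?(ltW C0) // measure_disjoint_sum.
  rewrite nuT -EFinM lee_fin /C invf_div mulrC mulrA ler_pdivrMr ?ltr_wpDl // mulrC ler_wpM2l ?(ltW e0) //.
  by rewrite lerDl.
Qed.

End Exceptional.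

Theorem theorem1p2 (R : realType) (n d : nat)
    (mu : {measure set (n.-tuple R) -> \bar R})
    (Omega : set (n.-tuple R)) (f : n.-tuple R -> d.-tuple R)
    (G : 'I_d -> 'I_n -> n.-tuple R -> R) (lam : R) :
  lebesgue_on_boxes mu ->
  (2 <= n)%N -> (1 <= d)%N ->
  is_open Omega ->
  sobolev_W1p_with mu Omega n f G ->
  continuous_on Omega f ->
  0 <= lam <= (n.-1)%:R ->
  (\int[mu]_(y in Omega)
      ((jac_norm G y) ^+ n * powR (ln (expR 1 + jac_norm G y)) lam)%:E < +oo)%E ->
  let alpha := 1 - lam / (n.-1)%:R in
  exists E : set (n.-tuple R),
    E `<=` Omega /\
    luzin_N mu f (Omega `\` E) /\
    forall phi : R -> \bar R, gauge phi ->
      (exists2 gamma : R, 0 < gamma &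
         forall r : R, 0 < r < 1 ->
           phi r = (if 0 < alpha
                    then expR (- (gamma * powR (ln r^-1) alpha))
                    else powR (ln r^-1) (- (n%:R + gamma)))%:E) ->
      hausdorff phi E = 0%E.
Proof.
move=> Hmu n2 _ oOm HS cf /andP[lam0 lam1] HF alpha.
have g0 (i : nat) : 0 < i.+1%:R^-1 :> R by rewrite invr_gt0 ltr0n.
(* The rates [1/(i+1)] make the rest of [Omega] a countable union. *)
exists [set z | Omega z /\ forall i : nat, ~ slow_decay lam mu Omega G i.+1%:R^-1 z].
split; first by move=> z [].
have dbox (c : {ffun 'I_n -> int}) : dopen (box 0 c 0 : set (n.-tuple R)).
  by move=> x /box_idx xc; exists 0%N; rewrite /dcube xc.
split.
- move=> Z ZO Zn.
  (* Besides the rate, pieces are cut along unit cells, so that each lies in an open set of finite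
     measure. *)
  pose Zj (j : nat * {ffun 'I_n -> int}) :=
    Z `&` [set z | slow_decay lam mu Omega G j.1.+1%:R^-1 z /\ box 0 j.2 0 z].
  have -> : f @` Z = \bigcup_j f @` Zj j.
    apply/seteqP; split=> [_ [z Zz <-]|y [j _ [z [Zz _] <-]]]; last by exists z.
    have [Oz nE] := ZO z Zz.
    have [i hi] : exists i : nat, slow_decay lam mu Omega G i.+1%:R^-1 z.
      by apply: contrapT => no; apply: nE; split => // i hi; apply: no; exists i.
    by exists (i, idx 0 z) => //; exists z => //; split => //; split => //; apply/box_idx.
  apply: hausdorff_bigcup_countable => [t t0||[i c]].
  + by rewrite lee_fin exprn_ge0.
  + by rewrite /pow_gauge expr0n eqn0Ngt (ltnW n2).
  apply: (@luzin_piece R n d lam mu Omega f G Hmu n2 oOm HS cf lam0 lam1 HF _ _ (Omega `&` box 0 c 0) (g0 i)).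
  + by apply: dopenI => //; exact: is_open_dopen.
  + by move=> x [].
  + apply: (@le_lt_trans _ _ (mu (box 0 c 0))); last by rewrite mu_box // ltry.
    apply: le_measure; [apply: mem_set | apply: mem_set; exact: measurable_box | by move=> x []].
    by apply: measurableI; [exact: dopen_measurable (is_open_dopen oOm) | exact: measurable_box].
  + by move=> z [Zz [_ bz]]; split => //; case: (ZO z Zz).
  + by apply: negligibleS Zn => z [].
  + by move=> z [_ []].
- move=> phi gphi [gamma gam0 hphi].
  (* One rate is enough here, since the exceptional set is contained in that of every rate;
     [gamma / 4] is the bound asked by [gauge_le_gdecay]. *)
  have [i hi] : exists i : nat, i.+1%:R^-1 <= gamma / 4.
    exists (Num.bound (gamma / 4)^-1).
    rewrite -[X in _ <= X]invrK lef_pV2 ?posrE ?invr_gt0 ?divr_gt0 ?ltr0n //.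
    apply: (le_trans (ltW (archi_boundP _))); first by rewrite invr_ge0 ltW // divr_gt0.
    by rewrite ler_nat.
  have [phi0 phim _ _] := gphi.
  apply: (hausdorff_eq0S _ (B := [set z | Omega z /\ ~ slow_decay lam mu Omega G i.+1%:R^-1 z])).
  + by move=> t t0; apply: le_trans phi0 (phim _ _ _ t0).
  + by move=> z [Oz hz]; split => //; exact: hz.
  apply: (exceptional_null n2 oOm (measurable_jac_norm HS) HF gphi (g0 i)).
  by apply: (gauge_le_gdecay n2 lam0 lam1 gam0) hphi; rewrite g0.
Qed.
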